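(* Let $f(\tau)=\prod_{n\mid N}\eta(n\tau)^{r_n}=\sum_{n\ge0}c_f(n)q^n$ be a weakly admissible eta-quotient of level $N$ and weight $k=\frac12\sum_nr_n$ with $\sum_{n\mid N}nr_n=0$. Let $\varpi=\prod_{n\mid N}(N/n)^{|r_n|}$ and $\delta=0$ (resp. $\delta=1$) if $\varpi=2^\alpha(4m+1)$ (resp. $2^\alpha(4m+3)$), $\alpha,m\in\mathbb{Z}_{\ge0}$. Let $l\in L_f$ be such that for every prime $p$, $p\nmid N$ implies $p^2\nmid l$, and suppose that at least one of $l,N$ is odd. Then $$c_f(l)=\begin{cases}-r_1\displaystyle\sum_{a\mid l,\,(a,N)=1}\Big(\frac a\varpi\Big)a^{k-1}&\text{if }2\mid l,\ 2\nmid N,\\[2mm]-r_1\displaystyle\sum_{a\mid l,\,(a,N)=1}\Big(\frac a\varpi\Big)a^{k-1}e\Big(\frac{(k+\delta)(l-l/a)}4\Big)&\text{if }2\nmid l.\end{cases}$$ In particular, if $\operatorname{rad}(l)\mid\operatorname{rad}(N)$, then $c_f(l)=-r_1$.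
   Context: $e(x)=\exp(2\pi ix)$, $q=e(\tau)$, $\eta(\tau)=q^{1/24}\prod(1-q^n)$, $r_n\in\mathbb{Z}$, level $N=\operatorname{lcm}\{n:r_n\ne0\}$; $r_1$ is the exponent of $\eta(\tau)$. $\widetilde{\Gamma_0(N)}$: pairs $(\gamma,\varepsilon(c\tau+d)^{1/2})$, $\gamma=\begin{pmatrix}a&b\\c&d\end{pmatrix}\in\Gamma_0(N)$, $\varepsilon=\pm1$, principal square root, product $(\gamma_1,\phi_1)(\gamma_2,\phi_2)=(\gamma_1\gamma_2,\phi_1(\gamma_2\tau)\phi_2(\tau))$; $(g|_k(\gamma,\phi))(\tau)=\phi(\tau)^{-2k}g(\gamma\tau)$, $\widetilde\gamma=(\gamma,(c\tau+d)^{1/2})$. Character of $f$: $\chi(\gamma,\varepsilon(c\tau+d)^{1/2})=\varepsilon^{-2k}e(\frac1{24}\sum r_n\Psi\begin{pmatrix}a&bn\\c/n&d\end{pmatrix})$ with $\Psi\begin{pmatrix}a&b\\c&d\end{pmatrix}=\frac{a+d}c+12s(-d,c)-3$ ($c>0$), $\frac{a+d}c+12s(d,-c)+3$ ($c<0$), $b$ ($c=0,a>0$), $-b-6$ ($c=0,a<0$), Dedekind sum $s$. $M_k,S_k$ as usual (holomorphic $g$ with $g|_k\gamma=\chi(\gamma)g$ and all $q$-expansions at cusps having only nonnegative, resp. positive, exponents). Weakly admissible: $f\in M_k(\Gamma_0(N),\chi)$ and either $\dim M_k(\Gamma_0(N),\chi)=1$ or ($\dim M_k\ge2$, $\dim S_k(\Gamma_0(N),\chi)=1$,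 $f$ cusp form). $m_f=24/\gcd(24,\sum(N/n)r_n,\sum nr_n)$; $L_f=\{l\ge1:l\equiv1\bmod m_f\}$ if $k\in\mathbb{Z}$, additionally $l$ a perfect square if $k\in\frac12+\mathbb{Z}$. $(\frac a\varpi)$: Kronecker–Jacobi symbol; $\operatorname{rad}$ = product of distinct prime divisors. *)

(* Defs.v *)
From Stdlib Require Reals Rpower ClassicalEpsilon.
From mathcomp Require Import all_boot all_order all_algebra.
From mathcomp Require Import complex Rstruct.
Set Implicit Arguments. Unset Strict Implicit. Unset Printing Implicit Defensive.
Import Order.TTheory GRing.Theory Num.Theory.
Local Open Scope ring_scope.
Local Open Scope complex_scope.

Notation R := Rdefinitions.R.
Notation C := (R[i]).

Definition cabs (z : C) : R := Num.sqrt (complex.Re z ^+ 2 + complex.Im z ^+ 2).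

Definition cexp (z : C) : C :=
  (Rtrigo_def.exp (complex.Re z))%:C * (Rtrigo_def.cos (complex.Im z) +i* Rtrigo_def.sin (complex.Im z)).

Definition eC (z : C) : C := cexp ((2 * Rtrigo1.PI)%:C * 'i * z).
Definition e (x : R) : C := eC x%:C.

(* principal square root (argument in (-pi/2, pi/2]) *)
Definition psqrt (z : C) : C :=
  Num.sqrt ((cabs z + complex.Re z) / 2) +i*
  ((if 0 <= complex.Im z then 1 else -1) * Num.sqrt ((cabs z - complex.Re z) / 2)).

Definition cvgC (u : nat -> C) (L : C) : Prop :=
  forall eps : R, 0 < eps -> exists M : nat, forall m : nat, (M <= m)%N -> cabs (u m - L) < eps.
Definition limC (u : nat -> C) : C :=
  ClassicalEpsilon.epsilon (inhabits 0) (cvgC u).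

Definition holo_H (g : C -> C) : Prop :=
  forall t : C, 0 < complex.Im t -> exists L : C, forall eps : R, 0 < eps ->
    exists del : R, 0 < del /\ forall h : C, h != 0 -> cabs h < del ->
      cabs ((g (t + h) - g t) / h - L) < eps.

Definition mob (a b c d : int) (t : C) : C :=
  (a%:~R * t + b%:~R) / (c%:~R * t + d%:~R).

Definition eta (t : C) : C :=
  eC (t / 24%:R) * limC (fun M => \prod_(1 <= m < M.+1) (1 - eC t ^+ m)).

Definition eta_quot (N : nat) (r : nat -> int) (t : C) : C :=
  \prod_(n <- divisors N) (eta (n%:R * t)) ^ (r n).

(* q-expansion coefficient c_f(l) of prod_{n|N} prod_{m>=1} (1-q^{nm})^{r_n}
   (this is f itself when sum_n n r_n = 0), computed with truncated
   power series: (1-X^j)^{-1} is replaced by sum_{t<=l} X^{jt}. *)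
Definition geom_trunc (j l : nat) : {poly int} := \sum_(t < l.+1) 'X^(j * t).
Definition eta_factor (j : nat) (s : int) (l : nat) : {poly int} :=
  if (0 <= s)%R then (1 - 'X^j) ^+ `|s|%N else (geom_trunc j l) ^+ `|s|%N.
Definition eta_coef (N : nat) (r : nat -> int) (l : nat) : int :=
  (\prod_(n <- divisors N) \prod_(1 <= m < l.+1) eta_factor (n * m) (r n) l)`_l.

Definition twok (N : nat) (r : nat -> int) : int := \sum_(n <- divisors N) r n.
Definition weight (N : nat) (r : nat -> int) : R := (twok N r)%:~R / 2.

Definition is_level (N : nat) (r : nat -> int) : Prop :=
  (0 < N)%N /\ (forall n, r n != 0 -> (n %| N)%N) /\
  N = \big[lcmn/1%N]_(n <- divisors N | r n != 0) n.

Definition m_f (N : nat) (r : nat -> int) : nat :=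
  let S1 : int := \sum_(n <- divisors N) (N %/ n)%N%:Z * r n in
  let S2 : int := \sum_(n <- divisors N) n%:Z * r n in
  (24 %/ gcdn 24 (gcdn `|S1| `|S2|))%N.

Definition is_square (l : nat) : Prop := exists t : nat, l = (t ^ 2)%N.

Definition in_L_f (N : nat) (r : nat -> int) (l : nat) : Prop :=
  (1 <= l)%N /\ l = 1 %[mod m_f N r] /\ (odd `|twok N r|%N -> is_square l).

Definition varpi (N : nat) (r : nat -> int) : nat :=
  \prod_(n <- divisors N) (N %/ n) ^ `|r n|%N.

Definition delta_of (w : nat) : nat :=
  if ((w %/ 2 ^ logn 2 w) %% 4 == 1)%N then 0%N else 1%N.

Definition radical (n : nat) : nat := \prod_(p <- primes n) p.

Definition kron_p (a p : nat) : int :=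
  if p == 2%N then
    (if ~~ odd a then 0 else if (a %% 8 == 1)%N || (a %% 8 == 7)%N then 1 else -1)
  else if (p %| a)%N then 0
  else if [exists x : 'I_p, (x * x) %% p == a %% p]%N then 1 else -1.
Definition kronecker (a n : nat) : int :=
  \prod_(p <- primes n) (kron_p a p) ^+ logn p n.

Definition saw (m : int) (k : nat) : rat :=
  if (k%:Z %| m)%Z then 0 else ((m %% k%:Z)%Z)%:~R / k%:R - 1 / 2%:R.
Definition dedekind (h : int) (k : nat) : rat :=
  \sum_(1 <= i < k) saw i%:Z k * saw (h * i%:Z) k.

Definition Psi (a b c d : int) : rat :=
  if 0 < c then (a + d)%:~R / c%:~R + 12%:R * dedekind (- d) `|c|%N - 3%:R
  else if c < 0 then (a + d)%:~R / c%:~R + 12%:R * dedekind d `|c|%N + 3%:R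
  else if 0 < a then b%:~R else - b%:~R - 6%:R.

Definition char_exp (N : nat) (r : nat -> int) (a b c d : int) : rat :=
  (1 / 24%:R) * \sum_(n <- divisors N) (r n)%:~R * Psi a (b * n%:Z) (c %/ n%:Z)%Z d.

(* chi((gamma, eps (c t + d)^{1/2})) = eps^{-2k} e(char_exp) *)
Definition chi (N : nat) (r : nat -> int) (a b c d eps : int) : C :=
  (eps%:~R : C) ^ (- twok N r) * e (ratr (char_exp N r a b c d)).

(* (g |_k (gamma, phi))(t) = phi(t)^{-2k} g(gamma t) = chi(gamma, phi) g(t)
   for every (gamma, eps (ct+d)^{1/2}) in the metaplectic cover of Gamma0(N) *)
Definition transf_law (N : nat) (r : nat -> int) (g : C -> C) : Prop :=
  forall a b c d : int, a * d - b * c = 1 -> (N%:Z %| c)%Z ->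
  forall eps : int, eps = 1 \/ eps = -1 ->
  forall t : C, 0 < complex.Im t ->
    (eps%:~R * psqrt (c%:~R * t + d%:~R)) ^ (- twok N r) * g (mob a b c d t)
    = chi N r a b c d eps * g t.

(* holomorphic at all cusps: |(ct+d)|^{-k} |g(gamma t)| bounded as complex.Im t -> oo,
   for every gamma in SL2(Z) *)
Definition cusp_bounded (k : R) (g : C -> C) : Prop :=
  forall a b c d : int, a * d - b * c = 1 ->
  exists M y0 : R, forall t : C, y0 < complex.Im t ->
    cabs (g (mob a b c d t)) * Rpower.Rpower (cabs (c%:~R * t + d%:~R)) (- k) <= M.

Definition cusp_vanishing (k : R) (g : C -> C) : Prop :=
  forall a b c d : int, a * d - b * c = 1 ->
  forall eps : R, 0 < eps -> exists y0 : R, forall t : C, y0 < complex.Im t ->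
    cabs (g (mob a b c d t)) * Rpower.Rpower (cabs (c%:~R * t + d%:~R)) (- k) < eps.

Definition in_M (N : nat) (r : nat -> int) (g : C -> C) : Prop :=
  holo_H g /\ transf_law N r g /\ cusp_bounded (weight N r) g.
Definition in_S (N : nat) (r : nat -> int) (g : C -> C) : Prop :=
  holo_H g /\ transf_law N r g /\ cusp_vanishing (weight N r) g.

Definition dim_eq1 (P : (C -> C) -> Prop) : Prop :=
  exists g0, P g0 /\ (exists t : C, 0 < complex.Im t /\ g0 t != 0) /\
    forall g, P g -> exists lam : C, forall t : C, 0 < complex.Im t -> g t = lam * g0 t.
Definition dim_ge2 (P : (C -> C) -> Prop) : Prop :=
  exists g1 g2, P g1 /\ P g2 /\
    forall l1 l2 : C, (forall t : C, 0 < complex.Im t -> l1 * g1 t + l2 * g2 t = 0) ->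
      l1 = 0 /\ l2 = 0.

Definition weakly_admissible (N : nat) (r : nat -> int) : Prop :=
  in_M N r (eta_quot N r) /\
  (dim_eq1 (in_M N r) \/
   (dim_ge2 (in_M N r) /\ dim_eq1 (in_S N r) /\ in_S N r (eta_quot N r))).

(* Main.v *)
Require Import Defs.
From Stdlib Require Reals Rpower.
From mathcomp Require Import all_boot all_order all_algebra.
From mathcomp Require Import complex Rstruct.
From mathcomp Require Import zify ring lra.
Import Order.TTheory GRing.Theory Num.Theory.
Local Open Scope ring_scope.
Local Open Scope complex_scope.

(** Since f tends to 1 at the cusp oo, it is not a cusp form, so M_k is spanned
    by f. The operator T sending f to the sum of psi(a) a^k f((a t + b) / d),
    over a d = l with a prime to N and b modulo d, preserves M_k, hence
    multiplies f by a scalar lambda. The constant term of T f gives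
    lambda = sum_a psi(a) a^k (l / a), and its coefficient at q is l c_f(l), so
    that l c_f(l) = - r_1 lambda.

    That T preserves M_k means that psi compensates the change of the character
    from gamma to gamma' = delta gamma delta'^-1, with delta = (a b; 0 d). By
    translations one may assume that delta and delta' are diagonal and that the
    lower row (c, d) of gamma is positive; the reciprocity law of Dedekind sums
    then gives Psi(gamma) = (b - c) / d + 12 s(c, d). Modulo 8, the integer
    12 k s(h, k) is k + 1 - 2 (h / k) for odd k, with (h / k) the Jacobi symbol;
    it vanishes modulo 3 if 3 does not divide k. The assumption l = 1 mod m_f
    makes the linear parts of the exponents agree, and the Jacobi symbols give
    psi. Quadratic reciprocity for (h / k) is the reciprocity law of Dedekind
    sums modulo 8. *)

(** * Dedekind sums *)

(** Automorphy factors of T f are never computed. As f has no zeros in the upper half-plane, its law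
    gives that of T f once T f (gamma t) f(t) = T f(t) f(gamma t), and this holds term by term:
    delta gamma = gamma' delta' matches each delta of the first sum with a delta' of the second. The
    factors c t + d of gamma at t and of gamma' at delta' t differ by a positive rational, whence
    the power a^k; in half-integral weight only a = 1 remains, the two factors coincide, and no
    branches of the square root have to be compared.

    The obstacle is the character, a sum of Dedekind sums with different denominators. Its exponent
    is computed modulo 3 and modulo 8 separately, dividing by c or by d, whichever is invertible.
    For odd l a translation makes d odd. For even l this may fail, and division by c leads to the
    symbol (d / varpi), with varpi odd because N is. The condition on squares of primes dividing l
    makes a and l / a coprime, so that every delta is diagonal up to translations. *)

Lemma sum_mul_residues (V : nmodType) (h k : nat) (F : nat -> V) :
  coprime h k -> \sum_(i < k) F ((h * i) %% k)%N = \sum_(i < k) F i.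
Proof.
move=> chk; case: k chk => [|k] chk; first by rewrite !big_ord0.
pose s (i : 'I_k.+1) : 'I_k.+1 := inord ((h * i) %% k.+1).
have sE i : s i = (h * i %% k.+1)%N :> nat by rewrite inordK // ltn_mod.
have sI : injective s.
  move=> i j /(congr1 val); rewrite /= !sE => /eqP.
  wlog lij : i j / (i <= j)%N.
    by move=> W; case/orP: (leq_total i j) => [/W//|/W W' e]; apply/esym/W'; rewrite eq_sym.
  rewrite eq_sym eqn_mod_dvd ?leq_mul2l ?lij ?orbT // -mulnBr Gauss_dvdr 1?coprime_sym //.
  move=> dv; apply/val_inj/eqP; rewrite eqn_leq lij /= -subn_eq0.
  case: posnP => // gt0; have := dvdn_leq gt0 dv; have := ltn_ord j; lia.
rewrite [RHS](reindex_inj sI); by apply: eq_bigr => i _; rewrite sE.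
Qed.

Definition floor_sum (h k : nat) : nat := \sum_(i < k) i * (h * i %/ k).

(* [ds h k] is [12 k s(h, k)] for the Dedekind sum [s], with the denominators
   cleared; it is an integer. *)
Definition ds (h k : nat) : int :=
  2 * h%:Z * (k%:Z - 1) * (2 * k%:Z - 1) - 12 * (floor_sum h k)%:Z
  - 3 * k%:Z * (k%:Z - 1).

Lemma sum_ord_id (R : comPzRingType) (k : nat) :
  2 * \sum_(i < k) (i%:R : R) = k%:R * (k%:R - 1).
Proof.
elim: k => [|k IH]; first by rewrite big_ord0 mulr0 mul0r.
by rewrite big_ord_recr /= mulrDr IH -natr1; ring.
Qed.

Lemma sum_ord_sqr (R : comPzRingType) (k : nat) :
  6 * \sum_(i < k) (i%:R : R) ^+ 2 = k%:R * (k%:R - 1) * (2 * k%:R - 1).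
Proof.
elim: k => [|k IH]; first by rewrite big_ord0 mulr0 !mul0r.
by rewrite big_ord_recr /= mulrDr IH -natr1; ring.
Qed.

Lemma saw_nat (m k : nat) : (0 < k)%N ->
  saw m%:Z k = if (m %% k == 0)%N then 0 else (m %% k)%:R / k%:R - 1 / 2.
Proof.
move=> k0; rewrite /saw dvdzE !absz_nat /dvdn modz_nat -pmulrn.
by [].
Qed.

Lemma saw_opp (m : int) (k : nat) : (0 < k)%N -> saw (- m) k = - saw m k.
Proof.
move=> k0; rewrite /saw dvdzE abszN -dvdzE.
case: ifP => [_|ndv]; first by rewrite oppr0.
have kn0 : k%:R != 0 :> rat by rewrite pnatr_eq0 -lt0n.
suff -> : ((- m) %% k%:Z)%Z = k%:Z - (m %% k%:Z)%Z.
  by rewrite rmorphB /= -pmulrn; field.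
have h1 := divz_eq m k%:Z; have h2 := ltz_mod m (_ : k%:Z != 0).
have h3 := modz_ge0 m (_ : k%:Z != 0).
have k0' : k%:Z != 0 by rewrite eqz_nat -lt0n.
have {h2} h2 := h2 k0'; have {h3} h3 := h3 k0'.
have h4 : (m %% k%:Z)%Z != 0.
  by apply/eqP => e0; move: ndv; rewrite (sameP dvdz_mod0P eqP) e0 eqxx.
have -> : - m = (- (m %/ k%:Z)%Z - 1) * k%:Z + (k%:Z - (m %% k%:Z)%Z).
  rewrite {1}h1; ring.
rewrite modzMDl modz_small //; lia.
Qed.

Lemma dedekind_opp (h : int) (k : nat) : dedekind (- h) k = - dedekind h k.
Proof.
rewrite /dedekind big_nat_cond [in RHS]big_nat_cond -sumrN.
apply: eq_bigr => i /andP[/andP[i0 ik] _].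
by rewrite mulNr saw_opp ?mulrN //; apply: leq_ltn_trans ik.
Qed.

(** Remainders are traded for floors: h i mod k = h i - k floor(h i / k). *)
Lemma sum_mod_floor (R : comPzRingType) (h k : nat) (F : nat -> R) :
  \sum_(i < k) F i * (h * i %% k)%:R =
  h%:R * (\sum_(i < k) F i * i%:R) - k%:R * \sum_(i < k) F i * (h * i %/ k)%:R.
Proof.
rewrite !mulr_sumr -sumrB; apply: eq_bigr => i _.
have := congr1 (fun n => n%:R : R) (divn_eq (h * i) k).
rewrite natrD !natrM => /(congr1 (fun x => F i * x)); rewrite mulrDr => E.
have -> : F i * (h * i %% k)%:R = F i * (h%:R * i%:R) - F i * ((h * i %/ k)%:R * k%:R).
  by rewrite E; ring.
ring.
Qed.

(** Expanding the product of sawtooth values gives the sums of i, of h i mod k and of their product.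
    The first two agree because h permutes the residues; the third is expressed by [floor_sum]. *)
Lemma dedekind_nat (h k : nat) : (0 < k)%N -> coprime h k ->
  12 * k%:R * dedekind h%:Z k = (ds h k)%:~R.
Proof.
move=> k0 chk.
have kn0 : k%:R != 0 :> rat by rewrite pnatr_eq0 -lt0n.
pose G (i : nat) : rat := if (i == 0)%N then 0 else i%:R / k%:R - 1 / 2.
have E1 : dedekind h%:Z k = \sum_(i < k) G i * G (h * i %% k)%N.
  rewrite -(big_mkord xpredT (fun i => G i * G (h * i %% k)%N)) big_ltn //.
  rewrite {1}/G eqxx mul0r add0r /dedekind; apply: eq_big_nat => i /andP[i0 ik].
  by rewrite -PoszM !saw_nat // /G modn_small.
(* The sawtooth vanishes at 0, where x - 1/2 does not: the term i = 0 adds 1/4. *)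
have E2 : dedekind h%:Z k = \sum_(i < k) (i%:R / k%:R - 1 / 2) * ((h * i %% k)%:R / k%:R - 1 / 2) - 1 / 4.
  rewrite E1; case: k k0 chk kn0 @G {E1} => // k k0 chk kn0 G.
  rewrite !big_ord_recl /= !muln0 mod0n /G /= mul0r.
  rewrite [X in _ + X - _](eq_bigr (fun i : 'I_k => G (bump 0 i) * G (h * bump 0 i %% k.+1)%N)); last first.
    move=> i _; rewrite /G /bump /=; case: ifP => // /eqP /eqP h0.
    have : (k.+1 %| (1 + i))%N by rewrite -(Gauss_dvdr _ (_ : coprime _ h)) // coprime_sym.
    by move/dvdn_leq => /(_ isT); have := ltn_ord i; lia.
  rewrite /G; set S := \sum_(i < k) _; field; by rewrite addrC natr1.
rewrite E2; rewrite -/(ds h k).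
have E3 : \sum_(i < k) (i%:R / k%:R - 1 / 2) * ((h * i %% k)%:R / k%:R - 1 / 2) =
   k%:R ^- 2 * (\sum_(i < k) i%:R * (h * i %% k)%:R) 
   - (2 * k%:R)^-1 * (\sum_(i < k) i%:R) - (2 * k%:R)^-1 * (\sum_(i < k) i%:R) + k%:R / 4 :> rat.
  rewrite -[X in _ - _ - _ * X + _](sum_mul_residues _ _ _ (fun i => i%:R) chk).
  rewrite -[k%:R / 4](_ : \sum_(i < k) 1 / 4 = _); last first.
    by rewrite sumr_const card_ord -[LHS]mulr_natl; field.
  rewrite !mulr_sumr -!sumrB -big_split /=; apply: eq_bigr => i _; field.
  by rewrite kn0.
rewrite E3 (sum_mod_floor _ _ _ (fun i => i%:R)).
have -> : \sum_(i < k) (i%:R : rat) * i%:R = k%:R * (k%:R - 1) * (2 * k%:R - 1) / 6.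
  by rewrite -(sum_ord_sqr rat k) [RHS]mulrAC divff // mul1r; apply: eq_bigr => i _; rewrite expr2.
have -> : \sum_(i < k) (i%:R : rat) = k%:R * (k%:R - 1) / 2.
  by rewrite -sum_ord_id [RHS]mulrAC divff // mul1r.
have -> : \sum_(i < k) (i%:R : rat) * (h * i %/ k)%:R = (floor_sum h k)%:R.
  by rewrite /floor_sum natr_sum; apply: eq_bigr => i _; rewrite natrM.
rewrite /ds !(rmorphB, rmorphM) /= -!pmulrn; field.
by rewrite kn0.
Qed.

(** Summed over i, the remainders of h i modulo k give the sum of the i themselves, so the floors
    account for (h - 1) times that sum. *)
Lemma sum_floor (h k : nat) : coprime h k ->
  2 * \sum_(i < k) (h * i %/ k)%:R = (h%:R - 1) * (k%:R - 1) :> int.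
Proof.
case: (posnP k) => [-> /eqP|k0 chk]; first by rewrite gcdn0 => ->; rewrite big_ord0 subrr mulr0 mul0r.
have E := sum_mod_floor int h k (fun=> 1).
have S := sum_ord_id int k.
have kn0 : k%:R != 0 :> int by rewrite pnatr_eq0 -lt0n.
apply: (mulfI kn0).
move: E; rewrite -(eq_bigr _ (fun i _ => esym (mul1r _))).
rewrite (sum_mul_residues _ _ _ (fun i => i%:R) chk).
rewrite -(eq_bigr _ (fun i _ => esym (mul1r _))).
rewrite -(eq_bigr _ (fun i _ => esym (mul1r _))).
set A := \sum_(i < k) i%:R in S *; set B := \sum_(i < k) _ => E.
have -> : k%:R * (2 * B) = 2 * (k%:R * B) by ring.
have -> : k%:R * B = h%:R * A - A by rewrite {2}E; ring.
transitivity ((h%:R - 1) * (2 * A)); [ring | rewrite S; ring].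
Qed.

Lemma sum_double_below (h q : nat) : (q < h)%N ->
  \sum_(j < h | (j <= q)%N) (j%:R : int) *+ 2 = q%:R * (q%:R + 1).
Proof.
move=> qh; rewrite -(big_mkord (fun j => j <= q)%N (fun j => (j%:R : int) *+ 2)).
rewrite (big_cat_nat (n := q.+1)) //= [X in _ + X]big1_seq ?addr0; last first.
  by move=> j; rewrite mem_index_iota => /andP[H1 /andP[H2 _]]; lia.
rewrite big_nat_cond (eq_bigl (fun j => (0 <= j < q.+1)%N)); last by move=> j; lia.
rewrite -big_nat big_mkord.
transitivity (2 * \sum_(j < q.+1) (j%:R : int)); last by rewrite sum_ord_id -natr1; ring.
by rewrite mulr_sumr; apply: eq_bigr => j _; rewrite mulr_natl.
Qed.

Lemma count_above (k m : nat) : (m < k)%N ->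
  \sum_(i < k | (m < i)%N) (1 : int) = k%:R - 1 - m%:R.
Proof.
move=> mk; rewrite -(big_mkord (fun i => m < i)%N (fun=> 1 : int)).
rewrite (big_cat_nat (n := m.+1)) //= [X in X + _]big1_seq ?add0r; last first.
  by move=> j; rewrite mem_index_iota => /andP[H1 /andP[H2 H3]]; lia.
rewrite big_nat_cond (eq_bigl (fun j => (m.+1 <= j < k)%N)); last by move=> j; lia.
rewrite -big_nat sumr_const_nat natrB // -natr1; ring.
Qed.

(* Count the lattice points [(i, j)] with [k j <= h i] by rows and by columns. *)
Lemma sum_floor_sqr (h k : nat) : (0 < h)%N -> (0 < k)%N -> coprime h k ->
  \sum_(i < k) ((h * i %/ k)%:R * ((h * i %/ k)%:R + 1)) =
  (k%:R - 1) * (h%:R * (h%:R - 1)) - 2 * (floor_sum k h)%:R :> int.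
Proof.
move=> h0 k0 chk.
have -> : \sum_(i < k) ((h * i %/ k)%:R * ((h * i %/ k)%:R + 1)) =
   \sum_(i < k) \sum_(j < h | (j <= h * i %/ k)%N) (j%:R : int) *+ 2.
  by apply: eq_bigr => i _; rewrite sum_double_below // ltn_divLR // ltn_mul2l h0 ltn_ord.
rewrite (exchange_big_dep xpredT) //=.
transitivity (\sum_(j < h) (j%:R : int) *+ 2 * (k%:R - 1 - (k * j %/ h)%:R)).
  apply: eq_bigr => j _; case: (posnP j) => [j0|j0].
    by rewrite j0 mul0rn mul0r big1 // => i _; rewrite mul0rn.
  have ltk : (k * j %/ h < k)%N by rewrite ltn_divLR // ltn_mul2l k0 ltn_ord.
  rewrite -(count_above _ _ ltk) mulr_sumr.
  apply: eq_big => [i|i _]; last by rewrite mulr1.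
  rewrite leq_divRL // ltn_divLR // [(i * h)%N]mulnC [(j * k)%N]mulnC leq_eqVlt.
  case: eqP => //= E; exfalso.
  have : (h %| j * k)%N by rewrite mulnC E dvdn_mulr.
  rewrite Gauss_dvdl // => /dvdn_leq; have := ltn_ord j; lia.
have -> : h%:R * (h%:R - 1) = 2 * \sum_(j < h) (j%:R : int) by rewrite sum_ord_id.
rewrite /floor_sum natr_sum !mulr_sumr -sumrB; apply: eq_bigr => j _.
by rewrite natrM -mulr_natl; ring.
Qed.

(** The squares of h i mod k have the same sum as the squares of i. In the square of h i - k floor(h
    i / k), the cross term brings in [floor_sum h k], and the squared floors bring in
    [floor_sum k h] through the lattice point count. *)
Lemma ds_reciprocity (h k : nat) : (0 < h)%N -> (0 < k)%N -> coprime h k ->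
  h%:Z * ds h k + k%:Z * ds k h = h%:Z ^+ 2 + k%:Z ^+ 2 + 1 - 3 * h%:Z * k%:Z.
Proof.
move=> h0 k0 chk.
have kn0 : k%:Z != 0 by rewrite eqz_nat -lt0n.
have S2 := sum_ord_sqr int k.
have S1 := sum_ord_id int k.
have SF := sum_floor h k chk.
have SFS := sum_floor_sqr h k h0 k0 chk.
have E : \sum_(i < k) ((h * i %% k)%:R : int) ^+ 2 = \sum_(i < k) (i%:R : int) ^+ 2.
  exact: (sum_mul_residues _ _ _ (fun i => (i%:R : int) ^+ 2) chk).
have E' : \sum_(i < k) ((h * i %% k)%:R : int) ^+ 2 =
   h%:R ^+ 2 * (\sum_(i < k) (i%:R : int) ^+ 2) - 2 * h%:R * k%:R * (floor_sum h k)%:R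
   + k%:R ^+ 2 * (\sum_(i < k) ((h * i %/ k)%:R * ((h * i %/ k)%:R + 1)) - \sum_(i < k) (h * i %/ k)%:R).
  rewrite /floor_sum natr_sum -sumrB !mulr_sumr -sumrB -big_split /=.
  apply: eq_bigr => i _; have := congr1 (fun n => n%:R : int) (divn_eq (h * i) k).
  rewrite natrD !natrM => E1.
  have -> : (h * i %% k)%:R = h%:R * i%:R - (h * i %/ k)%:R * k%:R :> int by rewrite E1; ring.
  ring.
rewrite E' SFS in E.
move: S2 S1 SF E; set A := \sum_(i < k) _ ^+ 2; set G := \sum_(i < k) (h * i %/ k)%:R.
rewrite /ds -(natz h) -(natz k) -(natz (floor_sum h k)) -(natz (floor_sum k h)).
set T : int := (floor_sum h k)%:R; set T' : int := (floor_sum k h)%:R.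
set H := h%:R; set K := k%:R => S2 S1 SF E.
apply: (mulfI (_ : K != 0)); first by rewrite /K natz.
apply/eqP; rewrite -subr_eq0; apply/eqP.
have E6 : 6 * (H ^+ 2 * A - 2 * H * K * T + K ^+ 2 * ((K - 1) * (H * (H - 1)) - 2 * T' - G)) = 6 * A.
  by rewrite E.
(* The claim times K as a combination of three known relations; the multipliers eliminate A and
   G. *)
transitivity ((H ^+ 2 - 1) * (K * (K - 1) * (2 * K - 1) - 6 * A) 
   + (6 * (H ^+ 2 * A - 2 * H * K * T + K ^+ 2 * ((K - 1) * (H * (H - 1)) - 2 * T' - G)) - 6 * A)
   + 3 * K ^+ 2 * (2 * G - (H - 1) * (K - 1))).
  ring.
by rewrite E6 S2 SF; ring.
Qed.

(** Modulo 3 only 2 h (k - 1) (2 k - 1) survives, and 3 divides k - 1 or 2 k - 1 according as k is 1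
    or 2 modulo 3. *)
Lemma ds_mod3 (h k : nat) : ~~ (3 %| k)%N -> exists t : int, ds h k = 3 * t.
Proof.
move=> k3; have [m [r [Ek r12]]] : exists m r : int, k%:Z = 3 * m + r /\ (r = 1 \/ r = 2).
  exists (k %/ 3)%:Z, (k %% 3)%:Z; split; lia.
rewrite /ds Ek; set T := Posz (floor_sum h k).
case: r12 => ->.
  exists (2 * h%:Z * m * (6 * m + 1) - 4 * T - (3 * m + 1) * (3 * m)); ring.
exists (2 * h%:Z * (3 * m + 1) * (2 * m + 1) - 4 * T - (3 * m + 2) * (3 * m + 1)); ring.
Qed.

(** * The Jacobi symbol *)

(* Jacobi symbol [(h / k)] for odd [k] coprime to [h], by the Gauss lemma for
   the half-system of even residues. *)
Definition jac (h k : nat) : int :=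
  \prod_(i < k | ~~ odd i) (-1) ^+ (h * i %% k).

Lemma jac_mod (h k : nat) : jac (h %% k) k = jac h k.
Proof. by apply: eq_bigr => i _; rewrite modnMml. Qed.

Lemma jac_pm (h k : nat) : jac h k = 1 \/ jac h k = -1.
Proof.
rewrite /jac; elim/big_ind: _ => [|x y [] -> [] ->|i _]; rewrite ?mulr1 ?mul1r ?mulrNN; auto.
by rewrite -signr_odd; case: odd; auto.
Qed.

(** Modulo 8 only the parity of [floor_sum] matters, and this is the parity of the sum of the floors
    at odd i; [sum_floor] exchanges it for the sum at even i. For even i and odd k, the remainder of
    h i has the parity of the floor, so [jac] is the sign given by that last sum. *)
Lemma ds_mod8 (h k : nat) : odd k -> coprime h k ->
  exists t : int, ds h k = k%:Z + 1 - 2 * jac h k + 8 * t.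
Proof.
move=> ok chk.
have SF := sum_floor h k chk.
pose Qe := (\sum_(i < k | ~~ odd i) (h * i %/ k))%N.
pose Qo := (\sum_(i < k | odd i) (h * i %/ k))%N.
have EQ : \sum_(i < k) (h * i %/ k)%:R = Qo%:Z + Qe%:Z.
  rewrite (bigID (fun i : 'I_k => odd i)) /= -!natr_sum -/Qe -/Qo; lia.
have [s Es] : exists s, floor_sum h k = (Qo + 2 * s)%N.
  exists (\sum_(i < k | odd i) (i./2 * (h * i %/ k)) + \sum_(i < k | ~~ odd i) (i./2 * (h * i %/ k)))%N.
  rewrite /floor_sum (bigID (fun i : 'I_k => odd i)) /= mulnDr !big_distrr /= addnA -big_split /=.
  congr (_ + _)%N; apply: eq_bigr => i oi.
    by rewrite mulnA -{1}[i : nat]odd_double_half oi -mul2n mulnDl mul1n.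
  by rewrite mulnA -{1}[i : nat]odd_double_half (negbTE oi) -mul2n add0n.
have EJ : jac h k = (-1) ^+ Qe.
  rewrite /jac /Qe -prodrXr; apply: eq_bigr => i oi.
  rewrite -signr_odd -[RHS]signr_odd; congr (_ ^+ nat_of_bool _).
  have := congr1 odd (divn_eq (h * i) k).
  by rewrite oddD !oddM ok andbT (negbTE oi) andbF; case: odd; case: odd.
have [j Ek] : exists j : nat, k = (2 * j + 1)%N by exists k./2; lia.
have [m Em] : exists m : int, (j%:Z * (j%:Z - 1)) = 2 * m.
  exists ((j%:Z * (j%:Z - 1)) %/ 2)%Z; have [n [En|En]] : exists n : int, j%:Z = 2 * n \/ j%:Z = 2 * n + 1.
  - by exists (j./2)%:Z; lia.
  - by rewrite En -mulrA mulrC mulzK //; ring.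
  - by rewrite En addrK (mulrC 2) mulrA mulzK //; ring.
have [e Ee] : exists e : int, jac h k = 1 - 2 * Qe%:Z + 4 * e.
  rewrite EJ -signr_odd; case Eo : (odd Qe).
    by exists (Qe./2)%:Z; rewrite expr1; lia.
  by exists (Qe./2)%:Z; rewrite expr0; lia.
have Eo : Qo%:Z = (h%:Z - 1) * j%:Z - Qe%:Z.
  apply: (mulfI (_ : (2 : int) != 0)) => //; rewrite EQ in SF.
  transitivity (2 * (Qo%:Z + Qe%:Z) - 2 * Qe%:Z); first ring.
  rewrite SF Ek !natz PoszD PoszM; ring.
exists (2 * h%:Z * j%:Z ^+ 2 - h%:Z * j%:Z + Qe%:Z - 3 * s%:Z - 3 * m - j%:Z + e).
rewrite Ee /ds Es Ek !(PoszD, PoszM) Eo.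
transitivity (16 * h%:Z * j%:Z ^+ 2 - 8 * h%:Z * j%:Z + 12 * Qe%:Z - 24 * s%:Z 
  - 12 * (j%:Z * (j%:Z - 1)) - 6 * j%:Z); first ring.
rewrite Em; ring.
Qed.

(** For odd k, the even representative of h i or of - h i modulo k: the action of h on the
    half-system of even residues, up to sign. *)
Definition half_perm (h k i : nat) : nat :=
  if odd (h * i %% k) then (k - h * i %% k)%N else (h * i %% k)%N.

Lemma half_perm_lt (h k i : nat) : (0 < k)%N -> (half_perm h k i < k)%N.
Proof.
move=> k0; rewrite /half_perm; have := ltn_mod (h * i) k; rewrite k0.
by case: ifP => // o l; case: (h * i %% k)%N o l => // n; lia.
Qed.

Lemma half_perm_even (h k i : nat) : odd k -> ~~ odd (half_perm h k i).
Proof.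
move=> ok; have k0 : (0 < k)%N by case: k ok.
rewrite /half_perm; case: ifP => [o|->//].
by rewrite oddB ?ok ?o // ltnW // ltn_mod.
Qed.

(** A coincidence with opposite signs makes k divide i + j, an even number below 2 k; as k is odd,
    this forces i = j = 0. *)
Lemma half_perm_inj (h k i j : nat) : odd k -> coprime h k ->
  (i < k)%N -> (j < k)%N -> ~~ odd i -> ~~ odd j ->
  half_perm h k i = half_perm h k j -> i = j.
Proof.
move=> ok chk ik jk oi oj; have k0 : (0 < k)%N by case: k ok {chk ik jk}.
have Hmod u v : (u < k)%N -> (v < k)%N -> h * u = h * v %[mod k] -> u = v.
  move=> uk vk /eqP E; wlog luv : u v uk vk E / (u <= v)%N.
    by move=> W; case/orP: (leq_total u v) => [/W|/W W']; [apply|apply/esym/W' => //; rewrite eq_sym].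
  move: E; rewrite eq_sym eqn_mod_dvd ?leq_mul2l ?luv ?orbT // -mulnBr Gauss_dvdr 1?coprime_sym //.
  by case: (posnP (v - u)) => [|p /(dvdn_leq p)]; lia.
have lti := ltn_mod (h * i) k; have ltj := ltn_mod (h * j) k; rewrite k0 in lti ltj.
rewrite /half_perm; case: ifP => Hi; case: ifP => Hj E.
- by apply: Hmod => //; lia.
- have : (k %| h * (i + j))%N.
    rewrite /dvdn mulnDr -modnDm -E subnKC ?modnn //; exact: ltnW.
  rewrite Gauss_dvdr 1?coprime_sym // => /dvdnP[q Eq].
  have : (q < 2)%N by rewrite -(ltn_pmul2r k0) -Eq; lia.
  by case: q Eq => [|[|//]] Eq _; lia.
- have : (k %| h * (i + j))%N.
    rewrite /dvdn mulnDr -modnDm E addnC subnKC ?modnn //; exact: ltnW.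
  rewrite Gauss_dvdr 1?coprime_sym // => /dvdnP[q Eq].
  have : (q < 2)%N by rewrite -(ltn_pmul2r k0) -Eq; lia.
  by case: q Eq => [|[|//]] Eq _; lia.
- exact: Hmod.
Qed.

Lemma prod_half_perm (R : comPzRingType) (h k : nat) (F : nat -> R) :
  odd k -> coprime h k ->
  \prod_(i < k | ~~ odd i) F (half_perm h k i) = \prod_(i < k | ~~ odd i) F i.
Proof.
case: k => // k ok chk.
pose A := [set i : 'I_k.+1 | ~~ odd i].
pose s (i : 'I_k.+1) : 'I_k.+1 := inord (half_perm h k.+1 i).
have sE i : s i = half_perm h k.+1 i :> nat by rewrite inordK // half_perm_lt.
have sA : {in A &, injective s}.
  move=> i j; rewrite !inE => oi oj /(congr1 val); rewrite /= !sE => E; apply: val_inj.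
  exact: half_perm_inj E.
have EA : s @: A = A.
  apply/eqP; rewrite eqEcard card_in_imset // leqnn andbT.
  by apply/subsetP => _ /imsetP[i _ ->]; rewrite inE sE half_perm_even.
have L (G : 'I_k.+1 -> R) : \prod_(i < k.+1 | ~~ odd i) G i = \prod_(i in A) G i.
  by apply: eq_bigl => i; rewrite inE.
rewrite !L -[in RHS]EA big_imset //; by apply: eq_bigr => i _; rewrite sE.
Qed.

(** In the product for h, reindexed by [half_perm h'], the residue of h h' i is replaced by its
    negative exactly where h' has the sign -1 at i; as k is odd, this flips the parity. *)
Lemma jacMl (h h' k : nat) : odd k -> coprime h k -> coprime h' k ->
  jac (h * h') k = jac h k * jac h' k.
Proof.
move=> ok ch ch'; have k0 : (0 < k)%N by case: k ok {ch ch'}.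
rewrite {2}/jac -(prod_half_perm _ h' k (fun i => (-1) ^+ (h * i %% k)) ok ch') /jac -big_split /=.
apply: eq_bigr => i oi; rewrite -mulnA -modnMmr /half_perm.
have lt := ltn_mod (h' * i) k; rewrite k0 in lt.
rewrite -[X in _ * X]signr_odd; case: ifP => o; last by rewrite mulr1.
move: o lt; set r := (h' * i %% k)%N => o lt.
have r0 : (0 < r)%N by case: (r) o.
have Hr : (0 < h * r %% k)%N.
  rewrite lt0n; apply/negP => D; have : (k %| h * r)%N := D.
  by rewrite Gauss_dvdr 1?coprime_sym // => /(dvdn_leq r0); lia.
have ltr := ltn_mod (h * r) k; rewrite k0 in ltr.
have -> : (h * (k - r) %% k = k - h * r %% k)%N.
  apply/eqP; rewrite -(modn_small (_ : (k - h * r %% k < k)%N)); last lia.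
  rewrite -(eqn_modDr (h * r)) -mulnDr subnK; last exact: ltnW.
  rewrite modnMl -(modnDmr (k - _)) subnK ?modnn //; exact: ltnW.
by rewrite mulrN1 -signr_odd -[in RHS]signr_odd oddB ?ok /= ?(ltnW ltr) //; case: odd => /=; rewrite ?expr0 ?expr1 ?opprK.
Qed.

Lemma jac_sq (h k : nat) : jac h k * jac h k = 1.
Proof. by case: (jac_pm h k) => ->. Qed.

Lemma jac1l (k : nat) : odd k -> jac 1 k = 1.
Proof. by move=> ok; have := jacMl 1 1 k ok (coprime1n k) (coprime1n k); rewrite jac_sq muln1. Qed.

Lemma jac_n1 (h : nat) : jac h 1 = 1.
Proof. by rewrite /jac big_mkcond big_ord1 /= muln0. Qed.

(* The reciprocity law of Dedekind sums, modulo 8. *)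
Lemma jac_quadratic_reciprocity (h k : nat) : odd h -> odd k -> coprime h k ->
  jac h k = (-1) ^+ (h./2 * k./2) * jac k h.
Proof.
move=> oh ok chk; have h0 : (0 < h)%N by case: h oh {chk}.
have k0 : (0 < k)%N by case: k ok {chk}.
have ckh : coprime k h by rewrite coprime_sym.
have R := ds_reciprocity h k h0 k0 chk.
have [t Et] := ds_mod8 h k ok chk; have [t' Et'] := ds_mod8 k h oh ckh.
have [a [m Ea]] : exists (a : bool) (m : int), h%:Z = 4 * m + 1 + 2 * a%:Z /\ a = odd h./2 :> bool.
  by exists (odd h./2), (h./2./2)%:Z; split => //; lia.
have [b [n Eb]] : exists (b : bool) (n : int), k%:Z = 4 * n + 1 + 2 * b%:Z /\ b = odd k./2 :> bool.
  by exists (odd k./2), (k./2./2)%:Z; split => //; lia.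
rewrite -signr_odd oddM -Ea.2 -Eb.2.
case: Ea => Ea _; case: Eb => Eb _; rewrite Et Et' Ea Eb in R.
by move: R; case: (jac_pm h k) => ->; case: (jac_pm k h) => ->; case: a {Ea}; case: b {Eb} => /= R;
  rewrite ?expr0 ?expr1 ?mulN1r ?mul1r ?opprK //; exfalso; lia.
Qed.

(** Since s(k, 2) = 0, reciprocity reads 2 [ds 2 k] = k^2 - 6 k + 5, which determines the symbol
    modulo 16. *)
Lemma jac2l (k : nat) : odd k ->
  jac 2 k = if (k %% 8 == 1)%N || (k %% 8 == 7)%N then 1 else -1.
Proof.
move=> ok; have k0 : (0 < k)%N by case: k ok.
have c2k : coprime 2 k by rewrite coprime2n.
have R := ds_reciprocity 2 k isT k0 c2k.
have [t Et] := ds_mod8 2 k ok c2k.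
have D : ds k 2 = 0.
  rewrite /ds /floor_sum !big_ord_recr big_ord0 /= mul0n !add0n mul1n muln1.
  have -> : (k %/ 2 = k./2)%N by rewrite divn2.
  have : k%:Z = 2 * (k./2)%:Z + 1 by lia.
  by move=> {1}->; ring.
rewrite D mulr0 addr0 Et in R.
have [r [m [Ek Er]]] : exists (r : nat) (m : int), k%:Z = 8 * m + r%:Z /\ r = (k %% 8)%N.
  by exists (k %% 8)%N, (k %/ 8)%:Z; split => //; lia.
have r8 : (r < 8)%N by rewrite Er ltn_mod.
have orr : odd r by move: Er ok; lia.
rewrite -Er; rewrite Ek in R; clear -R r8 orr.
case: r r8 orr R => [|[|[|[|[|[|[|[|//]]]]]]]] //= _ _;
  by case: (jac_pm 2 k) => -> // R; exfalso; lia.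
Qed.

(** Reciprocity carries multiplicativity from the upper to the lower entry, because (k k' - 1)/2 and
    (k - 1)/2 + (k' - 1)/2 have the same parity. *)
Lemma jacMr_odd (h k k' : nat) : odd h -> odd k -> odd k' ->
  coprime h (k * k') -> jac h (k * k') = jac h k * jac h k'.
Proof.
move=> oh ok ok' ch; have /andP[c1 c2] : coprime h k && coprime h k' by rewrite -coprimeMr.
rewrite (jac_quadratic_reciprocity h (k * k')) ?oddM ?ok // (jac_quadratic_reciprocity h k) // (jac_quadratic_reciprocity h k') //.
rewrite jacMl 1?coprime_sym // 1?coprime_sym //.
have -> : (-1) ^+ (h./2 * (k * k')./2) = (-1) ^+ (h./2 * k./2) * (-1) ^+ (h./2 * k'./2) :> int.
  have -> : ((k * k')./2 = k./2 + k'./2 + 2 * (k./2 * k'./2))%N.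
    rewrite -{1}[k]odd_double_half -{1}[k']odd_double_half ok ok' -!mul2n.
    by move: k./2 k'./2 => m n; nia.
  by rewrite mulnDr exprD mulnCA [X in _ * X]exprM sqrrN !expr1n mulr1 mulnDr exprD.
ring.
Qed.

(** An even h is replaced by h + k k', which is odd and has the same symbols. *)
Lemma jacMr (h k k' : nat) : odd k -> odd k' ->
  coprime h (k * k') -> jac h (k * k') = jac h k * jac h k'.
Proof.
move=> ok ok' ch; case oh: (odd h); first exact: jacMr_odd.
have E m : (m %| k * k')%N -> jac h m = jac (h + k * k') m.
  by move=> /dvdnP[q ->]; rewrite -(jac_mod (h + _)) addnC modnMDl jac_mod.
rewrite (E k) ?dvdn_mulr // (E k') ?dvdn_mull // (E _ (dvdnn _)).
apply: jacMr_odd => //; first by rewrite oddD oh oddM ok ok'.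
by rewrite /coprime addnC gcdnC gcdnDl gcdnC.
Qed.

Lemma prod_even_const (R : comPzRingType) (m : nat) (x : R) :
  \prod_(i < (m.*2).+1 | ~~ odd i) (if (i == 0 :> nat)%N then 1 else x) = x ^+ m.
Proof.
elim: m => [|m IH]; first by rewrite big_mkcond big_ord1.
rewrite doubleS big_mkcond big_ord_recr big_ord_recr -big_mkcond /= IH.
by rewrite odd_double /= mulr1 exprSr.
Qed.

Lemma Fp_natr_eq0 (p n : nat) : prime p -> ((n%:R : 'F_p) == 0) = (p %| n)%N.
Proof. by move=> pp; rewrite -(dvdn_pcharf (pchar_Fp pp)). Qed.

Lemma gauss_lemma (h p : nat) : prime p -> odd p -> coprime h p ->
  (h%:R : 'F_p) ^+ p./2 = (jac h p)%:~R.
Proof.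
move=> pp op ch; have p0 := prime_gt0 pp.
(* The half-system contains 0; the factor 1 there keeps the product invertible. *)
pose G (i : nat) : 'F_p := if (i == 0)%N then 1 else i%:R.
have E0 : \prod_(i < p | ~~ odd i) G i != 0.
  apply/prodf_neq0 => i oi; rewrite /G; case: ifP => [_|i0]; first exact: oner_neq0.
  rewrite Fp_natr_eq0 //; apply/negP => /dvdn_leq; have := ltn_ord i; lia.
apply: (mulIf E0); rewrite -{2}(prod_half_perm _ h p G op ch).
have -> : (h%:R : 'F_p) ^+ p./2 = \prod_(i < p | ~~ odd i) (if (i == 0 :> nat)%N then 1 else h%:R).
  by have := prod_even_const 'F_p p./2 h%:R; have -> : (p./2).*2.+1 = p by lia.
rewrite /jac rmorph_prod /= -!big_split /=; apply: eq_bigr => i oi.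
rewrite /G /half_perm; case: eqP => [->|i0]; first by rewrite muln0 mod0n /= !mulr1.
have ndv : (h * i %% p == 0)%N = false.
  apply/negP => D; have : (p %| h * i)%N := D.
  by rewrite Gauss_dvdr 1?coprime_sym // => /dvdn_leq; have := ltn_ord i; lia.
have Em : (h%:R : 'F_p) * i%:R = (h * i %% p)%:R.
  by rewrite -natrM Fp_nat_mod.
rewrite Em -[in RHS]signr_odd rmorphXn /= rmorphN1.
case: (odd (h * i %% p)); last by rewrite ndv expr0 mul1r.
have lt := ltn_mod (h * i) p; rewrite p0 in lt.
have -> : (p - h * i %% p == 0)%N = false by lia.
rewrite natrB ?(ltnW lt) //.
have -> : (p%:R : 'F_p) = 0 by apply/eqP; rewrite Fp_natr_eq0.
by rewrite expr1 sub0r mulrNN mul1r.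
Qed.

Lemma Fp_signs_neq (p : nat) : prime p -> odd p -> (1 : 'F_p) != -1.
Proof.
move=> pp op; rewrite -addr_eq0.
have -> : (1 + 1 : 'F_p) = 2%:R by [].
rewrite Fp_natr_eq0 //; apply/negP => /dvdn_leq => /(_ isT).
by have := prime_gt1 pp; lia.
Qed.

Lemma Fp_fermat (p x : nat) : prime p -> odd p -> ~~ (p %| x)%N ->
  (x%:R : 'F_p) ^+ (p./2 * 2) = 1.
Proof.
move=> pp op px; have x0 : (x%:R : 'F_p) != 0 by rewrite Fp_natr_eq0.
apply: (mulIf x0); rewrite mul1r -exprSr.
have -> : (p./2 * 2).+1 = p by lia.
have E := fermat_little x pp.
rewrite -natrX.
by rewrite -(Fp_nat_mod pp (x ^ p)) E Fp_nat_mod.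
Qed.

(** The polynomial X^((p - 1)/2) - 1 has the distinct squares of 1, ..., (p - 1)/2 as roots; if h
    were none of them, it would be one root too many. *)
Lemma euler_criterion (h p : nat) : prime p -> odd p -> ~~ (p %| h)%N ->
  (h%:R : 'F_p) ^+ p./2 = 1 -> exists2 x : nat, (x < p)%N & (x * x = h %[mod p])%N.
Proof.
move=> pp op ph E1.
pose rs := [seq (i%:R : 'F_p) ^+ 2 | i <- iota 1 p./2].
have [/mapP[m]|hrs] := boolP ((h%:R : 'F_p) \in rs).
  rewrite mem_iota => /andP[m1 m2] E; exists m; first by lia.
  apply/eqP; have [le|lt] := leqP h (m * m).
    by rewrite eqn_mod_dvd // -Fp_natr_eq0 // natrB // E natrM -expr2 subrr.
  rewrite eq_sym eqn_mod_dvd ?(ltnW lt) // -Fp_natr_eq0 // natrB ?(ltnW lt) //.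
  by rewrite E natrM -expr2 subrr.
exfalso.
have sz : size ('X^(p./2) - 1%:P : {poly 'F_p}) = (p./2).+1.
  by rewrite size_XnsubC //; have := prime_gt1 pp; lia.
have nz : ('X^(p./2) - 1%:P : {poly 'F_p}) != 0 by rewrite -size_poly_eq0 sz.
have lt_p i : i \in iota 1 p./2 -> ~~ (p %| i)%N.
  by rewrite mem_iota => H; apply/negP => /dvdn_leq; lia.
have := max_poly_roots nz (rs := h%:R :: rs).
rewrite sz /= size_map size_iota ltnn; move=> H; suff: false by []; apply: H.
  apply/andP; split; first by rewrite rootE !hornerE E1 subrr.
  apply/allP => _ /mapP[m Hi ->]; rewrite rootE !hornerE -exprM.
  by rewrite mulnC Fp_fermat ?subrr // lt_p.
rewrite hrs map_inj_in_uniq ?iota_uniq // => i j Hi Hj /eqP.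
rewrite eqf_sqr => /orP[]; last first.
  rewrite -addr_eq0 -natrD Fp_natr_eq0 // => /dvdn_leq.
  by move: Hi Hj; rewrite !mem_iota; lia.
wlog le : i j Hi Hj / (i <= j)%N => [W|].
  by case/orP: (leq_total i j) => [|l E]; [exact: W|apply/esym/W => //; rewrite eq_sym].
rewrite eq_sym -subr_eq0 -natrB // Fp_natr_eq0 // => D.
case: (posnP (j - i)) => [|/dvdn_leq/(_ D)]; move: Hi Hj; rewrite !mem_iota; lia.
Qed.

Lemma jac_prime (h p : nat) : prime p -> odd p -> coprime h p -> jac h p = kron_p h p.
Proof.
move=> pp op ch.
have ph : ~~ (p %| h)%N by rewrite -prime_coprime // coprime_sym.
have E := gauss_lemma h p pp op ch.
rewrite /kron_p; have -> : (p == 2%N) = false by apply/eqP => e; move: op; rewrite e.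
rewrite (negbTE ph); case: existsP => [[x /eqP Hx]|nx].
  case: (jac_pm h p) => // Ej; rewrite Ej in E; exfalso.
  have px : ~~ (p %| x)%N.
    by apply: contra ph => /dvdnP[q Eq]; rewrite /dvdn -Hx Eq mulnA modnMl.
  have := Fp_signs_neq p pp op; rewrite -[-1](_ : (-1)%:~R = _) // -E.
  have -> : (h%:R : 'F_p) = (x * x)%:R.
    by rewrite -(Fp_nat_mod pp h) -Hx Fp_nat_mod.
  by rewrite natrM -expr2 -exprM mulnC Fp_fermat ?eqxx.
case: (jac_pm h p) => // Ej; rewrite Ej in E; exfalso.
have [x xp Hx] := euler_criterion h p pp op ph E.
by apply: nx; exists (Ordinal xp); apply/eqP.
Qed.

(** With a range of primes that does not depend on n, multiplicativity in n follows from the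
    additivity of [logn]. *)
Lemma kronecker_bound (a n b : nat) : (0 < n)%N -> (n < b)%N ->
  kronecker a n = \prod_(0 <= p < b | prime p) kron_p a p ^+ logn p n.
Proof.
move=> n0 nb.
have -> : \prod_(0 <= p < b | prime p) kron_p a p ^+ logn p n =
          \prod_(0 <= p < b | p \in primes n) kron_p a p ^+ logn p n.
  rewrite big_mkcond [RHS]big_mkcond; apply: eq_bigr => p _.
  case: ifP => pp; last by rewrite mem_primes pp.
  by case: ifP => // /negbT H; rewrite -logn_gt0 -leqNgt leqn0 in H; rewrite (eqP H) expr0.
rewrite -big_filter /kronecker; apply: perm_big; apply: uniq_perm.
- exact: primes_uniq.
- by rewrite filter_uniq // iota_uniq.
move=> p; rewrite mem_filter mem_index_iota andb_idr //= => H.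
by apply: leq_ltn_trans nb; move: H; rewrite mem_primes => /and3P[_ _]; apply: dvdn_leq.
Qed.

Lemma kroneckerMr (a m n : nat) : (0 < m)%N -> (0 < n)%N ->
  kronecker a (m * n) = kronecker a m * kronecker a n.
Proof.
move=> m0 n0; have mn0 : (0 < m * n)%N by rewrite muln_gt0 m0.
rewrite !(fun x y => kronecker_bound a x (m * n).+1 y) ?ltnS ?leq_pmulr ?leq_pmull //.
by rewrite -big_split /=; apply: eq_bigr => p pp; rewrite lognM // exprD.
Qed.

Lemma kronecker_n1 (a : nat) : kronecker a 1 = 1.
Proof. by rewrite /kronecker big_nil. Qed.

Lemma kronecker_prime (a p : nat) : prime p -> kronecker a p = kron_p a p.
Proof. by move=> pp; rewrite /kronecker primes_prime // big_seq1 logn_prime // eqxx. Qed.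

(** Splitting off the least prime factor of w reduces the claim to [jac_prime]. *)
Lemma kronecker_jac (a w : nat) : odd w -> coprime a w -> kronecker a w = jac a w.
Proof.
elim/ltn_ind: w => w IH ow caw; have w0 : (0 < w)%N by case: w ow {IH caw}.
have [w1|w1] := leqP w 1.
  by rewrite (_ : w = 1%N) ?kronecker_n1 ?jac_n1 //; lia.
have pp := pdiv_prime w1; have /dvdnP[m Em] := pdiv_dvd w.
set p := pdiv w in pp Em; have p1 := prime_gt1 pp.
move: ow caw; rewrite Em oddM coprimeMr => /andP[om op] /andP[cm cp].
have m0 : (0 < m)%N by case: m om {Em cm}.
rewrite kroneckerMr ?(prime_gt0 pp) // IH //; last by rewrite Em; nia.
by rewrite kronecker_prime // jacMr ?coprimeMr ?cm // (jac_prime a p).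
Qed.

(** For w = 2^al m with m odd, the powers of 2 contribute equally to both sides, and reciprocity for
    m costs the sign with exponent (m - 1)/2 times (a - 1)/2. The parity of (m - 1)/2 is
    [delta_of w]: this is the origin of delta. *)
Lemma jac_kronecker (a w : nat) : odd a -> (0 < w)%N -> coprime a w ->
  jac w a = (-1) ^+ (delta_of w * a./2) * kronecker a w.
Proof.
move=> oa w0 caw; set al := logn 2 w.
pose m := (w %/ 2 ^ al)%N.
have Ew : w = (m * 2 ^ al)%N by rewrite divnK // pfactor_dvdnn.
have m0 : (0 < m)%N by move: w0; rewrite {1}Ew; case: (m).
have om : odd m.
  have := pfactor_coprime (isT : prime 2) w0; case=> m' c2 E'.
  suff -> : m = m' by rewrite -coprime2n.
  by rewrite /m {1}E' mulnK // expn_gt0.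
have cam : coprime a m by move: caw; rewrite Ew coprimeMr => /andP[].
have ca2 : coprime 2 a by rewrite coprime2n.
have cma : coprime m a by rewrite coprime_sym.
have J2 : forall n, jac (2 ^ n) a = kron_p a 2 ^+ n.
  elim=> [|n IH]; first by rewrite expn0 jac1l.
  rewrite expnS jacMl ?coprimeXl // IH exprS jac2l // /kron_p /= oa /=; by [].
have K2 : forall n, kronecker a (2 ^ n) = kron_p a 2 ^+ n.
  elim=> [|n IH]; first by rewrite kronecker_n1.
  by rewrite expnS kroneckerMr ?expn_gt0 // IH kronecker_prime // exprS.
have -> : jac w a = jac (m * 2 ^ al) a by rewrite -Ew.
have -> : kronecker a w = kronecker a (m * 2 ^ al) by rewrite -Ew.
rewrite jacMl ?coprimeXl // kroneckerMr ?expn_gt0 // J2 K2.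
rewrite mulrA kronecker_jac // jac_quadratic_reciprocity //.
congr (_ * _ * _).
rewrite /delta_of -/al -/m -signr_odd -[RHS]signr_odd !oddM; congr (_ ^+ nat_of_bool (_ && _)).
by case: ifP => /eqP; move: om; lia.
Qed.

(** * The character of an eta-quotient *)

(* [Psi] for positive [c] and [d]. By reciprocity, [d Psi = b - c + 12 d s(c, d)]
   and [c Psi = a + d - 12 c s(d, c) - 3 c]; as [a d - b c = 1], both relations
   together show that [Psi] is an integer. *)
Definition psiZ (a b : int) (c d : nat) : int :=
  a * (b - c%:Z + ds c d) - b * (a + d%:Z - ds d c - 3 * c%:Z).

Lemma psiZ_mul (a b : int) (c d : nat) : (0 < c)%N -> (0 < d)%N ->
  a * d%:Z - b * c%:Z = 1 ->
  [/\ coprime c d, d%:Z * psiZ a b c d = b - c%:Z + ds c d &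
      c%:Z * psiZ a b c d = a + d%:Z - ds d c - 3 * c%:Z].
Proof.
move=> c0 d0 det.
have cop : coprime c d.
  suff : coprimez c%:Z d%:Z by [].
  by apply/coprimezP; exists (- b, a); rewrite /= -det; ring.
have R := ds_reciprocity c d c0 d0 cop.
have E : c%:Z * (b - c%:Z + ds c d) = d%:Z * (a + d%:Z - ds d c - 3 * c%:Z).
  apply/eqP; rewrite -subr_eq0; apply/eqP.
  transitivity (c%:Z * ds c d + d%:Z * ds d c - (c%:Z ^+ 2 + d%:Z ^+ 2 + (a * d%:Z - b * c%:Z) - 3 * c%:Z * d%:Z)).
    ring.
  by rewrite R det; ring.
split=> //; rewrite /psiZ.
- transitivity (a * d%:Z * (b - c%:Z + ds c d) - b * (d%:Z * (a + d%:Z - ds d c - 3 * c%:Z))); first ring.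
  rewrite -E; transitivity ((a * d%:Z - b * c%:Z) * (b - c%:Z + ds c d)); first ring.
  by rewrite det mul1r.
- transitivity (a * (c%:Z * (b - c%:Z + ds c d)) - b * c%:Z * (a + d%:Z - ds d c - 3 * c%:Z)); first ring.
  rewrite E; transitivity ((a * d%:Z - b * c%:Z) * (a + d%:Z - ds d c - 3 * c%:Z)); first ring.
  by rewrite det mul1r.
Qed.

Lemma Psi_psiZ (a b : int) (c d : nat) : (0 < c)%N -> (0 < d)%N ->
  a * d%:Z - b * c%:Z = 1 -> Psi a b c%:Z d%:Z = (psiZ a b c d)%:~R.
Proof.
move=> c0 d0 det; have [cop _ E] := psiZ_mul a b c d c0 d0 det.
have cn0 : c%:R != 0 :> rat by rewrite pnatr_eq0 -lt0n.
rewrite /Psi ltz_nat c0 absz_nat dedekind_opp.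
have DN := dedekind_nat d c c0; rewrite coprime_sym in DN; have {}DN := DN cop.
apply: (mulfI cn0); rewrite [c%:R in RHS]pmulrn -[RHS]rmorphM /= E.
move: (ds d c) DN => X DN; rewrite !rmorphB !rmorphD rmorphM /= -DN.
rewrite -!pmulrn; field.
exact: cn0.
Qed.

Lemma Zp_intr_eq0 (m : nat) (x : int) : (1 < m)%N ->
  ((x%:~R : 'Z_m) == 0) = (m%:Z %| x)%Z.
Proof.
move=> m1; have H (n : nat) : ((n%:R : 'Z_m) == 0) = (m %| n)%N.
  by rewrite -val_eqE /= val_Zp_nat.
case: x => n.
  by rewrite -pmulrn H dvdzE.
by rewrite NegzE rmorphN /= oppr_eq0 -pmulrn H dvdzE abszN.
Qed.

(** Congruences modulo 3 and 8 are treated as equalities in ['Z_3] and ['Z_8], where they can be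
    rewritten and passed to [ring]. *)
Lemma Zp_intr_eq (m : nat) (x y : int) : (1 < m)%N ->
  (x%:~R : 'Z_m) = y%:~R <-> exists t, x = y + m%:Z * t.
Proof.
move=> m1; split=> [/eqP|[t ->]].
  rewrite -subr_eq0 -rmorphB Zp_intr_eq0 // => /dvdzP[t Et]; exists t.
  by rewrite mulrC -Et addrC subrK.
rewrite rmorphD rmorphM /=; have /eqP -> : (m%:Z%:~R : 'Z_m) == 0 by rewrite Zp_intr_eq0.
by rewrite mul0r addr0.
Qed.

(** In Z/8 the equation 4 x = 4 expresses that x is odd. Odd residues are their own inverses, which
    replaces all divisions by c or d below. *)
Lemma Z8_odd_sqr (x : 'Z_8) : 4 * x = 4 -> x * x = 1.
Proof.
move=> H; apply/eqP; move/eqP: H.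
by case: x => [[|[|[|[|[|[|[|[|?]]]]]]]]].
Qed.

Lemma Z3_sqr (x : 'Z_3) : x != 0 -> x * x = 1.
Proof. by move=> H; apply/eqP; move: H; case: x => [[|[|[|?]]]]. Qed.

Lemma Z3_mul_neq0 (x y : 'Z_3) : x * y != 0 -> x != 0 /\ y != 0.
Proof. by move=> H; split; apply: contra H => /eqP ->; rewrite ?mul0r ?mulr0. Qed.

Lemma Z8_odd_intr (d : nat) : odd d -> 4 * (d%:R : 'Z_8) = 4.
Proof.
move=> od; rewrite -{1}[d]odd_double_half od natrD -mul2n natrM mulrDr mulr1 mulrA.
have -> : (4 * 2 : 'Z_8) = 0 by apply/val_inj.
by rewrite mul0r addr0.
Qed.

(** For signs x and y, (1 - x) (1 - y) is 0 modulo 4, so x + y - 1 and x y agree there. A weighted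
    sum of Jacobi symbols thereby becomes a single product of symbols. *)
Lemma sum_signs (T : Type) (s : seq T) (r E : T -> int) :
  (forall n, E n = 1 \/ E n = -1) ->
  exists t, \sum_(n <- s) r n * E n =
    \sum_(n <- s) r n - 1 + \prod_(n <- s) E n ^+ `|r n| + 4 * t.
Proof.
move=> HE.
have H1 (n : T) : exists t, r n * E n = r n - 1 + E n ^+ `|r n| + 4 * t.
  case: (HE n) => ->; first by exists 0; rewrite expr1n; ring.
  by rewrite -signr_odd; case o: (odd _); [exists (- ((r n - 1) %/ 2)%Z)|exists (- ((r n) %/ 2)%Z)];
    rewrite /= ?expr0 ?expr1; lia.
have HP : \prod_(n <- s) E n ^+ `|r n| = 1 \/ \prod_(n <- s) E n ^+ `|r n| = -1.
  elim/big_ind: _ => [|x y [] -> [] ->|n _]; rewrite ?mulr1 ?mul1r ?mulrNN; auto.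
  by case: (HE n) => ->; rewrite ?expr1n -1?signr_odd; auto; case: odd; auto.
elim: s HP => [|n s IH] HP; first by exists 0; rewrite !big_nil; ring.
have HPs : \prod_(n <- s) E n ^+ `|r n| = 1 \/ \prod_(n <- s) E n ^+ `|r n| = -1.
  elim/big_ind: _ => [|x y [] -> [] ->|m _]; rewrite ?mulr1 ?mul1r ?mulrNN; auto.
  by case: (HE m) => ->; rewrite ?expr1n -1?signr_odd; auto; case: odd; auto.
have [t Et] := IH HPs; have [t' Et'] := H1 n.
have HEn : E n ^+ `|r n| = 1 \/ E n ^+ `|r n| = -1.
  by case: (HE n) => ->; rewrite ?expr1n -1?signr_odd; auto; case: odd; auto.
rewrite !big_cons Et Et'; case: HEn => ->; case: HPs => ->.
- by exists (t + t'); ring.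
- by exists (t + t'); ring.
- by exists (t + t'); ring.
- by exists (t + t' - 1); ring.
Qed.

Definition cosum (N : nat) (r : nat -> int) : int :=
  \sum_(n <- divisors N) (N %/ n)%N%:Z * r n.

(* 24 times the exponent of the character at [(a, b; C N, d)], for positive [C], [d]. *)
Definition chexp (N : nat) (r : nat -> int) (a b : int) (C d : nat) : int :=
  \sum_(n <- divisors N) r n * psiZ a (b * n%:Z) (C * (N %/ n)) d.

(** For c = C N, the entry c / n of the matrix attached to eta(n t) is C (N / n). *)
Lemma level_matrix (N C d n : nat) (a b : int) : (0 < N)%N -> (0 < C)%N -> 
  a * d%:Z - b * (C * N)%N%:Z = 1 -> n \in divisors N ->
  (0 < C * (N %/ n))%N /\ a * d%:Z - b * n%:Z * (C * (N %/ n))%N%:Z = 1.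
Proof.
move=> N0 C0 det; rewrite -dvdn_divisors // => nN; split.
  by rewrite muln_gt0 C0 divn_gt0 ?(dvdn_gt0 N0 nN) // dvdn_leq.
rewrite -det; congr (_ - _).
rewrite -mulrA -PoszM; congr (_ * Posz _).
by rewrite mulnCA [(n * _)%N]mulnC divnK.
Qed.

Lemma char_exp_chexp (N : nat) (r : nat -> int) (a b : int) (C d : nat) :
  (0 < N)%N -> (0 < C)%N -> (0 < d)%N -> a * d%:Z - b * (C * N)%N%:Z = 1 ->
  char_exp N r a b (C * N)%N%:Z d%:Z = (chexp N r a b C d)%:~R / 24.
Proof.
move=> N0 C0 d0 det; rewrite /char_exp mul1r mulrC; congr (_ / _).
rewrite /chexp rmorph_sum /= big_seq [RHS]big_seq; apply: eq_bigr => n nD.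
have [c0 det'] := level_matrix N C d n a b N0 C0 det nD.
rewrite intrM -Psi_psiZ //; congr (_ * Psi _ _ _ _).
move: nD; rewrite -dvdn_divisors // => nN.
by rewrite divz_nat muln_divA.
Qed.

(** Modulo 3, d is its own inverse and [ds] drops out of the relation for d [psiZ]; the terms b n
    cancel because the sum of n [r n] is 0. *)
Lemma chexp_mod3_d (N : nat) (r : nat -> int) (a b : int) (C d : nat) :
  (0 < N)%N -> (0 < C)%N -> (0 < d)%N -> a * d%:Z - b * (C * N)%N%:Z = 1 ->
  \sum_(n <- divisors N) n%:Z * r n = 0 -> ~~ (3 %| d)%N ->
  (chexp N r a b C d)%:~R = - (d%:R * C%:R * (cosum N r)%:~R) :> 'Z_3.
Proof.
move=> N0 C0 d0 det S2 d3.
have dd : (d%:R : 'Z_3) * d%:R = 1.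
  by apply: Z3_sqr; rewrite pmulrn Zp_intr_eq0.
transitivity ((d%:Z * (b * (\sum_(n <- divisors N) n%:Z * r n) - C%:Z * cosum N r))%:~R : 'Z_3); last first.
  by rewrite S2 mulr0 sub0r !(rmorphM, rmorphN) /= -!pmulrn; ring.
rewrite /cosum !mulr_sumr -sumrB mulr_sumr /chexp !rmorph_sum /= big_seq [RHS]big_seq.
apply: eq_bigr => n nD.
have [c0 det'] := level_matrix N C d n a b N0 C0 det nD.
have [cop E _] := psiZ_mul a (b * n%:Z) _ d c0 d0 det'.
have [t Et] := ds_mod3 (C * (N %/ n)) d d3.
have E' : ((d%:Z * psiZ a (b * n%:Z) (C * (N %/ n)) d)%:~R : 'Z_3) = (b * n%:Z - (C * (N %/ n))%N%:Z)%:~R.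
  by rewrite E Et; apply/Zp_intr_eq => //; exists t.
have K : (psiZ a (b * n%:Z) (C * (N %/ n)) d)%:~R = d%:R * (d%:Z * psiZ a (b * n%:Z) (C * (N %/ n)) d)%:~R :> 'Z_3.
  by rewrite intrM mulrA dd mul1r.
rewrite intrM K E'.
by rewrite PoszM !(rmorphM, rmorphB, rmorphD) /= -!pmulrn; ring.
Qed.

(** The counterpart for 3 dividing d: then c is a unit modulo 3, and the relation for c [psiZ] is
    used. *)
Lemma chexp_mod3_c (N : nat) (r : nat -> int) (a b : int) (C d : nat) :
  (0 < N)%N -> (0 < C)%N -> (0 < d)%N -> a * d%:Z - b * (C * N)%N%:Z = 1 ->
  ~~ (3 %| C * N)%N ->
  (chexp N r a b C d)%:~R = (a%:~R + d%:R) * C%:R * (cosum N r)%:~R :> 'Z_3.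
Proof.
move=> N0 C0 d0 det c3.
transitivity (((a + d%:Z) * (C%:Z * cosum N r))%:~R : 'Z_3); last first.
  by rewrite !(rmorphM, rmorphD) /= -!pmulrn; ring.
rewrite /cosum !mulr_sumr /chexp !rmorph_sum /= big_seq [RHS]big_seq.
apply: eq_bigr => n nD.
have [c0 det'] := level_matrix N C d n a b N0 C0 det nD.
set c := (C * (N %/ n))%N in c0 det'.
have cn3 : ~~ (3 %| c)%N.
  apply: contra c3 => /dvdn_trans; apply; move: nD; rewrite -dvdn_divisors // => nN.
  by rewrite dvdn_pmul2l // dvdn_div.
have cc : (c%:R : 'Z_3) * c%:R = 1.
  by apply: Z3_sqr; rewrite pmulrn Zp_intr_eq0.
have [cop _ E] := psiZ_mul a (b * n%:Z) _ d c0 d0 det'.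
have [t Et] := ds_mod3 d c cn3.
have E' : ((c%:Z * psiZ a (b * n%:Z) c d)%:~R : 'Z_3) = (a + d%:Z)%:~R.
  by rewrite E Et; apply/Zp_intr_eq => //; exists (- t - c%:Z); ring.
have K : (psiZ a (b * n%:Z) c d)%:~R = c%:R * (c%:Z * psiZ a (b * n%:Z) c d)%:~R :> 'Z_3.
  by rewrite intrM mulrA cc mul1r.
rewrite -/c intrM K E'.
by rewrite /c natrM !(rmorphM, rmorphD) /= -!pmulrn; ring.
Qed.

(** The Jacobi symbols enter with the coefficient 2, so their weighted sum is needed only modulo 4,
    where [sum_signs] applies. *)
Lemma chexp_mod8_d (N : nat) (r : nat -> int) (a b : int) (C d : nat) :
  (0 < N)%N -> (0 < C)%N -> odd d -> a * d%:Z - b * (C * N)%N%:Z = 1 ->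
  \sum_(n <- divisors N) n%:Z * r n = 0 ->
  (chexp N r a b C d)%:~R =
    - (d%:R * C%:R * (cosum N r)%:~R) + (1 + d%:R) * (twok N r)%:~R
    - 2 * d%:R * ((twok N r)%:~R - 1 + (\prod_(n <- divisors N) jac (C * (N %/ n)) d ^+ `|r n|)%:~R) :> 'Z_8.
Proof.
move=> N0 C0 od det S2; have d0 : (0 < d)%N by case: d od {det}.
have dd : (d%:R : 'Z_8) * d%:R = 1 by apply/Z8_odd_sqr/Z8_odd_intr.
have [t Et] := sum_signs _ (divisors N) r (fun n => jac (C * (N %/ n)) d) (fun n => jac_pm _ _).
rewrite -/(twok N r) in Et.
have Et' : 2 * ((twok N r)%:~R - 1 + (\prod_(n <- divisors N) jac (C * (N %/ n)) d ^+ `|r n|)%:~R) =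
   2 * (\sum_(n <- divisors N) r n * jac (C * (N %/ n)) d)%:~R :> 'Z_8.
  rewrite Et !rmorphD rmorphN rmorph1 rmorphM /= [RHS]mulrDr [in RHS]mulrA.
  have -> : (2 * 4%:~R : 'Z_8) = 0 by apply/val_inj.
  by rewrite mul0r addr0.
have R3 (x : 'Z_8) : 2 * d%:R * x = d%:R * (2 * x) by ring.
rewrite R3 Et'.
transitivity ((d%:Z * (b * (\sum_(n <- divisors N) n%:Z * r n) - C%:Z * cosum N r 
   + (1 + d%:Z) * twok N r - 2 * (\sum_(n <- divisors N) r n * jac (C * (N %/ n)) d)))%:~R : 'Z_8); last first.
  rewrite S2 mulr0 sub0r !(rmorphM, rmorphD, rmorphN) /= -!pmulrn.
  set K := (twok N r)%:~R; set S1 := (cosum N r)%:~R; set S := (\sum_(n <- _) _)%:~R.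
  transitivity (- (d%:R * C%:R * S1) + (d%:R + d%:R * d%:R) * K - d%:R * (2 * S) : 'Z_8); first ring.
  by rewrite dd; ring.
rewrite /cosum /twok !mulr_sumr -!sumrB -big_split -sumrB mulr_sumr /chexp !rmorph_sum /= big_seq [RHS]big_seq.
apply: eq_bigr => n nD.
have [c0 det'] := level_matrix N C d n a b N0 C0 det nD.
have [cop E _] := psiZ_mul a (b * n%:Z) _ d c0 d0 det'.
set c := (C * (N %/ n))%N in c0 det' cop E *.
have [s Es] := ds_mod8 c d od cop.
have E' : ((d%:Z * psiZ a (b * n%:Z) c d)%:~R : 'Z_8) =
    (b * n%:Z - c%:Z + (d%:Z + 1 - 2 * jac c d))%:~R.
  by rewrite E Es; apply/Zp_intr_eq => //; exists s; ring.
have K : (psiZ a (b * n%:Z) c d)%:~R = d%:R * (d%:Z * psiZ a (b * n%:Z) c d)%:~R :> 'Z_8.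
  by rewrite intrM mulrA dd mul1r.
rewrite intrM K E'.
rewrite [in RHS]rmorphM /= -pmulrn mulrCA -rmorphM /=; congr (_ * _%:~R).
rewrite /c PoszM; ring.
Qed.

Lemma chexp_mod8_c (N : nat) (r : nat -> int) (a b : int) (C d : nat) :
  (0 < N)%N -> odd (C * N) -> (0 < d)%N -> a * d%:Z - b * (C * N)%N%:Z = 1 ->
  (chexp N r a b C d)%:~R =
    (a%:~R + d%:R + 1) * C%:R * (cosum N r)%:~R - 6 * (twok N r)%:~R
    + 2 * ((twok N r)%:~R - 1 + (\prod_(n <- divisors N) jac d (C * (N %/ n)) ^+ `|r n|)%:~R) :> 'Z_8.
Proof.
move=> N0 oCN d0 det; have C0 : (0 < C)%N by move: oCN; rewrite oddM; case: (C).
have [t Et] := sum_signs _ (divisors N) r (fun n => jac d (C * (N %/ n))) (fun n => jac_pm _ _).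
rewrite -/(twok N r) in Et.
have Et' : 2 * ((twok N r)%:~R - 1 + (\prod_(n <- divisors N) jac d (C * (N %/ n)) ^+ `|r n|)%:~R) =
   2 * (\sum_(n <- divisors N) r n * jac d (C * (N %/ n)))%:~R :> 'Z_8.
  rewrite Et !rmorphD rmorphN rmorph1 rmorphM /= [RHS]mulrDr [in RHS]mulrA.
  have -> : (2 * 4%:~R : 'Z_8) = 0 by apply/val_inj.
  by rewrite mul0r addr0.
rewrite Et'.
transitivity (((a + d%:Z + 1) * (C%:Z * cosum N r) - 6 * twok N r + 2 * (\sum_(n <- divisors N) r n * jac d (C * (N %/ n))))%:~R : 'Z_8); last first.
  rewrite !(rmorphM, rmorphD, rmorphN) /= -!pmulrn; ring.
rewrite /cosum /twok !mulr_sumr -!sumrB -big_split /chexp !rmorph_sum /= big_seq [RHS]big_seq.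
apply: eq_bigr => n nD.
have [c0 det'] := level_matrix N C d n a b N0 C0 det nD.
have [cop _ E] := psiZ_mul a (b * n%:Z) _ d c0 d0 det'.
have oc : odd (C * (N %/ n)).
  move: nD; rewrite -dvdn_divisors // => /divnK EN; move: oCN.
  by rewrite -{1}EN mulnA oddM => /andP[].
set c := (C * (N %/ n))%N in c0 det' cop E oc *.
have cc : (c%:R : 'Z_8) * c%:R = 1 by apply/Z8_odd_sqr/Z8_odd_intr.
have c4 := Z8_odd_intr c oc.
rewrite coprime_sym in cop.
have [s Es] := ds_mod8 d c oc cop.
have E' : ((c%:Z * psiZ a (b * n%:Z) c d)%:~R : 'Z_8) =
    (a + d%:Z - (c%:Z + 1 - 2 * jac d c) - 3 * c%:Z)%:~R.
  by rewrite E Es; apply/Zp_intr_eq => //; exists (- s); ring.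
have K : (psiZ a (b * n%:Z) c d)%:~R = c%:R * (c%:Z * psiZ a (b * n%:Z) c d)%:~R :> 'Z_8.
  by rewrite intrM mulrA cc mul1r.
rewrite intrM K E'.
have Ec : c = (C * (N %/ n))%N by [].
rewrite -/c; clearbody c.
have -> : (c%:R : 'Z_8) * (a + d%:Z - (c%:Z + 1 - 2 * jac d c) - 3 * c%:Z)%:~R =
   (c%:Z * (a + d%:Z + 1) - 6 + 2 * jac d c)%:~R.
  rewrite !(rmorphM, rmorphD, rmorphN) /= -!pmulrn.
  (* For odd c, 2 (c - 1) is a multiple of 4 and thus equal to its opposite modulo 8: it absorbs the
     sign. *)
  have J2 : 2 * (c%:R - 1) * (jac d c)%:~R = 2 * (c%:R - 1) :> 'Z_8.
    case: (jac_pm d c) => ->; first by rewrite mulr1.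
    rewrite rmorphN1; apply/eqP; rewrite -subr_eq0; apply/eqP.
    transitivity (- (4 * c%:R - 4) : 'Z_8); [ring | by rewrite c4 subrr oppr0].
  transitivity (c%:R * (a%:~R + d%:R + 1) - 4 * (c%:R * c%:R) - 2 * c%:R + 2 * (jac d c)%:~R + 2 * (c%:R - 1) * (jac d c)%:~R : 'Z_8).
    ring.
  by rewrite J2 cc; ring.
rewrite -rmorphM /=; congr (_%:~R).
rewrite Ec PoszM; ring.
Qed.

Lemma jac_prodl (T : eqType) (s : seq T) (F e : T -> nat) (d : nat) : odd d ->
  (forall n, n \in s -> coprime (F n) d) ->
  coprime (\prod_(n <- s) F n ^ e n) d /\
  jac (\prod_(n <- s) F n ^ e n) d = \prod_(n <- s) jac (F n) d ^+ e n.
Proof.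
move=> od; elim: s => [|n s IH] H; first by rewrite !big_nil coprime1n jac1l.
have [cs Es] : coprime (\prod_(n <- s) F n ^ e n) d /\
  jac (\prod_(n <- s) F n ^ e n) d = \prod_(n <- s) jac (F n) d ^+ e n.
  by apply: IH => m ms; apply: H; rewrite inE ms orbT.
have cn : coprime (F n) d by apply: H; rewrite inE eqxx.
rewrite !big_cons coprimeMl cs coprimeXl // jacMl ?coprimeXl // Es; split=> //; congr (_ * _).
elim: (e n) => [|m IHm]; first by rewrite expn0 jac1l.
by rewrite expnS jacMl ?coprimeXl // IHm exprS.
Qed.

Lemma jac_prodr (T : eqType) (s : seq T) (F e : T -> nat) (d : nat) :
  (forall n, n \in s -> odd (F n) && coprime d (F n)) ->
  [/\ coprime d (\prod_(n <- s) F n ^ e n), odd (\prod_(n <- s) F n ^ e n) &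
  jac d (\prod_(n <- s) F n ^ e n) = \prod_(n <- s) jac d (F n) ^+ e n].
Proof.
elim: s => [|n s IH] H; first by rewrite !big_nil coprimen1 jac_n1.
have [cs os Es] : [/\ coprime d (\prod_(n <- s) F n ^ e n), odd (\prod_(n <- s) F n ^ e n) &
  jac d (\prod_(n <- s) F n ^ e n) = \prod_(n <- s) jac d (F n) ^+ e n].
  by apply: IH => m ms; apply: H; rewrite inE ms orbT.
have /andP[on cn] : odd (F n) && coprime d (F n) by apply: H; rewrite inE eqxx.
rewrite !big_cons coprimeMr cs coprimeXr // oddM os oddX on orbT.
rewrite jacMr ?coprimeMr ?coprimeXr ?oddX ?on ?orbT // Es; split=> //; congr (_ * _).
elim: (e n) => [|m IHm]; first by rewrite expn0 jac_n1.
by rewrite expnS jacMr ?oddX ?on ?orbT ?coprimeMr ?cn ?coprimeXr // IHm exprS.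
Qed.

Lemma odd_abszD (x y : int) : odd `|x + y| = odd `|x| (+) odd `|y|.
Proof. by case ox: (odd `|x|); case oy: (odd `|y|) => /=; lia. Qed.

Lemma odd_sum_abs (T : Type) (s : seq T) (r : T -> int) :
  odd (\sum_(n <- s) `|r n|)%N = odd `|\sum_(n <- s) r n|.
Proof.
elim: s => [|n s IH]; first by rewrite !big_nil.
by rewrite !big_cons oddD IH odd_abszD.
Qed.

Lemma signX_even (x : int) (m : nat) : x = 1 \/ x = -1 -> ~~ odd m -> x ^+ m = 1.
Proof. by move=> [] -> om; rewrite ?expr1n // -signr_odd (negbTE om). Qed.

Definition chi4 (n : nat) : int := (-1) ^+ (n./2).

Lemma chi4M (m n : nat) : odd m -> odd n -> chi4 (m * n) = chi4 m * chi4 n.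
Proof.
move=> om on; rewrite /chi4.
have -> : ((m * n)./2 = m./2 + n./2 + 2 * (m./2 * n./2))%N.
  rewrite -{1}[m]odd_double_half -{1}[n]odd_double_half om on -!mul2n.
  by move: m./2 n./2 => p q; nia.
by rewrite exprD [X in _ * X]exprM sqrrN !expr1n mulr1 exprD.
Qed.

Lemma chi4_pm (n : nat) : chi4 n = 1 \/ chi4 n = -1.
Proof. by rewrite /chi4 -signr_odd; case: odd; auto. Qed.

Lemma chi4_mod4 (n : nat) : odd n -> exists t, n%:Z = chi4 n + 4 * t.
Proof.
move=> on; exists ((n./2./2)%:Z + (odd n./2)%:Z); rewrite /chi4 -signr_odd.
by case o: (odd n./2); rewrite ?expr1 ?expr0; lia.
Qed.

Lemma coprime_level (N C d : nat) (a b : int) :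
  a * d%:Z - b * (C * N)%N%:Z = 1 -> coprime C d /\ coprime N d.
Proof.
move=> det; apply/andP; rewrite -coprimeMl.
suff : coprimez (C * N)%N%:Z d%:Z by [].
by apply/coprimezP; exists (- b, a); rewrite /= -det; ring.
Qed.

Lemma varpi_coprime (N : nat) (r : nat -> int) (d : nat) : coprime N d ->
  coprime (varpi N r) d.
Proof.
move=> cN; rewrite /varpi big_seq; apply: (big_ind (fun m => coprime m d)) => [|m n cm cn|n nD].
- exact: coprime1n.
- by rewrite coprimeMl cm.
apply/coprimeXl/(coprime_dvdl _ cN).
have [N0|N0] := posnP N; first by rewrite N0 div0n.
by apply: dvdn_div; rewrite dvdn_divisors.
Qed.

Lemma odd_varpi (N : nat) (r : nat -> int) : odd N -> odd (varpi N r).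
Proof.
move=> oN; rewrite /varpi big_seq; elim/big_ind: _ => // [p q op oq|p]; first by rewrite oddM op.
have N0 : (0 < N)%N by case: (N) oN.
rewrite -dvdn_divisors // => pN; rewrite oddX; apply/orP; right.
by move: oN; rewrite -{1}(divnK pN) oddM => /andP[->].
Qed.

Lemma varpi_gt0 (N : nat) (r : nat -> int) : (0 < N)%N -> (0 < varpi N r)%N.
Proof.
move=> N0; rewrite /varpi big_seq; elim/big_ind: _ => // [m n m0 n0|n]; first by rewrite muln_gt0 m0.
rewrite -dvdn_divisors // => nN.
by rewrite expn_gt0 divn_gt0 ?(dvdn_gt0 N0 nN) // dvdn_leq.
Qed.

(** The symbol (C / d) occurs with total exponent the sum of the |r n|, which has the parity of 2 k;
    in integral weight it disappears and only N / n contributes. *)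
Lemma prod_jac_level_l (N : nat) (r : nat -> int) (a b : int) (C d : nat) :
  (0 < N)%N -> odd d -> ~~ odd `|twok N r| -> a * d%:Z - b * (C * N)%N%:Z = 1 ->
  \prod_(n <- divisors N) jac (C * (N %/ n)) d ^+ `|r n| = jac (varpi N r) d.
Proof.
move=> N0 od ek det; have [cC cN] := coprime_level N C d a b det.
have cn n : n \in divisors N -> coprime (N %/ n) d.
  by rewrite -dvdn_divisors // => nN; apply: coprime_dvdl (dvdn_div nN) cN.
have [_ ->] := jac_prodl _ (divisors N) (fun n => N %/ n)%N (fun n => `|r n|%N) d od cn.
transitivity (\prod_(n <- divisors N) (jac C d ^+ `|r n| * jac (N %/ n) d ^+ `|r n|)).
  rewrite big_seq [RHS]big_seq; apply: eq_bigr => n nD.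
  by rewrite jacMl ?cn // exprMn.
rewrite big_split /= prodrXr signX_even ?mul1r ?odd_sum_abs //; exact: jac_pm.
Qed.

Lemma prod_jac_level_r (N : nat) (r : nat -> int) (a b : int) (C d : nat) :
  odd (C * N) -> ~~ odd `|twok N r| -> a * d%:Z - b * (C * N)%N%:Z = 1 ->
  \prod_(n <- divisors N) jac d (C * (N %/ n)) ^+ `|r n| = jac d (varpi N r).
Proof.
rewrite oddM => /andP[oC oN] ek det; have [cC cN] := coprime_level N C d a b det.
have N0 : (0 < N)%N by case: (N) oN.
have cn n : n \in divisors N -> odd (N %/ n) && coprime d (N %/ n).
  rewrite -dvdn_divisors // => nN; apply/andP; split.
    by move: oN; rewrite -{1}(divnK nN) oddM => /andP[].
  by rewrite coprime_sym; apply: coprime_dvdl (dvdn_div nN) cN.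
have [_ _ ->] := jac_prodr _ (divisors N) (fun n => N %/ n)%N (fun n => `|r n|%N) d cn.
transitivity (\prod_(n <- divisors N) (jac d C ^+ `|r n| * jac d (N %/ n) ^+ `|r n|)).
  rewrite big_seq [RHS]big_seq; apply: eq_bigr => n nD.
  by have /andP[on cdn] := cn n nD; rewrite jacMr ?coprimeMr ?cdn 1?coprime_sym ?cC // exprMn.
rewrite big_split /= prodrXr signX_even ?mul1r ?odd_sum_abs //; exact: jac_pm.
Qed.

(* The sign by which the character changes, as a function of the lower right entry. *)
Definition hsign (N : nat) (r : nat -> int) (l m : nat) : int :=
  if odd l then jac (varpi N r) m * chi4 m ^+ `|twok N r|./2
  else jac m (varpi N r).

Lemma hsign_pm (N : nat) (r : nat -> int) (l m : nat) : hsign N r l m = 1 \/ hsign N r l m = -1.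
Proof.
rewrite /hsign; case: ifP => _; last exact: jac_pm.
have : chi4 m ^+ `|twok N r|./2 = 1 \/ chi4 m ^+ `|twok N r|./2 = -1.
  by case: (chi4_pm m) => ->; rewrite ?expr1n -1?signr_odd; auto; case: odd; auto.
by case: (jac_pm (varpi N r) m) => -> [] ->; auto.
Qed.

(* In the paper's notation: [k] and [delta] have the same parity. *)
Lemma varpi_chi4 (N : nat) (r : nat -> int) : odd N -> ~~ odd `|twok N r| ->
  ((cosum N r)%:~R = 0 :> 'Z_8) -> chi4 (varpi N r) = (-1) ^+ (`|twok N r|./2) /\ odd (varpi N r).
Proof.
move=> oN ek /eqP; rewrite Zp_intr_eq0 // => S8.
have N0 : (0 < N)%N by case: (N) oN.
have on n : n \in divisors N -> odd (N %/ n).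
  by rewrite -dvdn_divisors // => nN; move: oN; rewrite -{1}(divnK nN) oddM => /andP[].
have [Ew ow] : chi4 (varpi N r) = \prod_(n <- divisors N) chi4 (N %/ n) ^+ `|r n| /\ odd (varpi N r).
  rewrite /varpi; elim: (divisors N) on => [|n s IH] on; first by rewrite !big_nil.
  have [] : chi4 (\prod_(n <- s) (N %/ n) ^ `|r n|) = \prod_(n <- s) chi4 (N %/ n) ^+ `|r n| /\
      odd (\prod_(n <- s) (N %/ n) ^ `|r n|).
    by apply: IH => m ms; apply: on; rewrite inE ms orbT.
  have onn : odd (N %/ n) by apply: on; rewrite inE eqxx.
  move=> E os; rewrite !big_cons oddM os oddX onn orbT chi4M ?oddX ?onn ?orbT // E; split=> //.
  congr (_ * _); elim: `|r n|%N => [|m IHm] //.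
  by rewrite expnS chi4M ?oddX ?onn ?orbT // IHm exprS.
split=> //.
(* As N / n is [chi4 (N %/ n)] modulo 4, [cosum] is there the weighted sum of these signs, that is 2
   k - 1 + [chi4 (varpi N r)]; it vanishes, which gives the sign (-1)^k. *)
have [t Et] := sum_signs _ (divisors N) r (fun n => chi4 (N %/ n)) (fun n => chi4_pm _).
have [s Es] : exists s, cosum N r = \sum_(n <- divisors N) r n * chi4 (N %/ n) + 4 * s.
  rewrite /cosum; elim: (divisors N) on => [|n q IH] on; first by exists 0; rewrite !big_nil.
  have [s Es] : exists s, \sum_(n <- q) (N %/ n)%N%:Z * r n = \sum_(n <- q) r n * chi4 (N %/ n) + 4 * s.
    by apply: IH => m ms; apply: on; rewrite inE ms orbT.
  have [t' Et'] := chi4_mod4 (N %/ n) (on n (mem_head _ _)).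
  by exists (s + t' * r n); rewrite !big_cons Es Et'; ring.
move: S8; rewrite Es Et -Ew -/(twok N r) -signr_odd => /dvdzP[q Eq].
case: (chi4_pm (varpi N r)) Eq => -> Eq; case o: (odd _) => //; exfalso; lia.
Qed.

(** In the formula for odd d, the terms (1 + d) 2k - 2 d 2k combine to (1 - d) 2k, which is the sign
    chi4(d)^k. For even l, where d may be even, the symbol (d / varpi) has to serve for both
    parities of d. *)
Lemma chexp_hsign (N : nat) (r : nat -> int) (l : nat) (a b : int) (C d : nat) :
  (0 < N)%N -> (0 < C)%N -> (0 < d)%N -> a * d%:Z - b * (C * N)%N%:Z = 1 ->
  \sum_(n <- divisors N) n%:Z * r n = 0 -> ~~ odd `|twok N r| ->
  (if odd l then odd d else odd N && ((cosum N r)%:~R == 0 :> 'Z_8)) ->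
  (chexp N r a b C d)%:~R = - (d%:R * C%:R * (cosum N r)%:~R)
     + 2 * (1 - (hsign N r l d)%:~R) :> 'Z_8.
Proof.
move=> N0 C0 d0 det S2 ek H.
have e48 : 4 * 2 = 0 :> 'Z_8 by apply/val_inj.
have Jz (J : int) : J = 1 \/ J = -1 -> 4 * J%:~R = 4 :> 'Z_8.
  by move=> [] ->; rewrite ?mulr1 // rmorphN1; apply/val_inj.
have [k Ek] : exists k : int, twok N r = 2 * k.
  by exists ((twok N r) %/ 2)%Z; lia.
have Hd (od : odd d) : (chexp N r a b C d)%:~R = - (d%:R * C%:R * (cosum N r)%:~R)
     + 2 * (1 - (jac (varpi N r) d * chi4 d ^+ `|twok N r|./2)%:~R) :> 'Z_8.
  rewrite chexp_mod8_d // (prod_jac_level_l N r a b) //.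
  have d4 := Z8_odd_intr d od.
  set J := jac _ _; have JJ : J = 1 \/ J = -1 := jac_pm _ _.
  rewrite -addrA; congr (_ + _).
  have Jd : 2 * d%:R * (1 - J%:~R) = 2 * (1 - J%:~R) :> 'Z_8.
    case: JJ => ->; first by rewrite subrr !mulr0.
    rewrite rmorphN1 opprK; transitivity (4 * d%:R : 'Z_8); first ring.
    by rewrite d4; ring.
  have -> : (1 + d%:R) * (twok N r)%:~R - 2 * d%:R * ((twok N r)%:~R - 1 + J%:~R) =
     (1 - d%:R) * (twok N r)%:~R + 2 * d%:R * (1 - J%:~R) :> 'Z_8 by ring.
  rewrite Jd; have [t Et] := chi4_mod4 d od.
  have -> : (d%:R : 'Z_8) = (chi4 d)%:~R + 4 * t%:~R.
    by rewrite [d%:R]pmulrn Et rmorphD rmorphM.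
  rewrite Ek rmorphM /=.
  transitivity (2 * (1 - (chi4 d)%:~R) * k%:~R - (4 * 2) * t%:~R * k%:~R + 2 * (1 - J%:~R) : 'Z_8); first ring.
  rewrite e48 !mul0r subr0.
  have -> : `|2 * k|./2 = `|k|%N by lia.
  have -> : 2 * (1 - (chi4 d)%:~R) * k%:~R = 2 * (1 - (chi4 d ^+ `|k|)%:~R) :> 'Z_8.
    case: (chi4_pm d) => ->; first by rewrite expr1n !subrr !mulr0 mul0r.
    rewrite rmorphN1 opprK -signr_odd.
    have -> : k = 2 * (k %/ 2)%Z + (odd `|k|)%:Z by lia.
    have -> : odd `|2 * (k %/ 2)%Z + (odd `|k|)%:Z| = odd `|k| by lia.
    rewrite rmorphD rmorphM /= mulrDr.
    transitivity ((4 * 2) * ((k %/ 2)%Z)%:~R + 4 * (odd `|k|)%:~R : 'Z_8); first ring.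
    by rewrite e48 mul0r add0r; case: odd; apply/val_inj.
  set K := chi4 d ^+ _; have KK : K = 1 \/ K = -1.
    by rewrite /K; case: (chi4_pm d) => ->; rewrite ?expr1n -1?signr_odd; auto; case: odd; auto.
  by case: JJ => ->; case: KK => ->; apply/val_inj.
case ol: (odd l) H => /= H; first by rewrite /hsign ol Hd.
have /andP[oN /eqP S8] := H.
have [Ew ow] := varpi_chi4 N r oN ek S8.
have [cC cN] := coprime_level N C d a b det.
(* For odd d, reciprocity turns (varpi / d) into (d / varpi); by [varpi_chi4] its sign is chi4(d)^k
   and cancels the one in [Hd]. *)
rewrite /hsign ol; case od: (odd d).
  rewrite Hd // (jac_quadratic_reciprocity (varpi N r)) //; last exact: varpi_coprime.
  congr (_ + 2 * (1 - _%:~R)); rewrite mulrAC -[RHS]mul1r; congr (_ * _).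
  rewrite mulnC exprM -/(chi4 d).
  have -> : chi4 d ^+ (varpi N r)./2 = chi4 d ^+ `|twok N r|./2.
    rewrite -/(chi4 _) in Ew; case: (chi4_pm d) => ->; first by rewrite !expr1n.
    exact: Ew.
  by rewrite -expr2 -exprM mulnC exprM; case: (chi4_pm d) => ->; rewrite ?sqrrN !expr1n.
(* For even d the determinant forces C N to be odd, and the formula obtained from division by c
   applies. *)
have oC : odd C.
  have := det; case oC : (odd C) => // det'; exfalso.
  have : 2 * (a * (d./2)%:Z - b * (C./2)%:Z * N%:Z) = 1.
    rewrite -[RHS]det -{2}[d]odd_double_half -{2}[C]odd_double_half od oC /= !add0n -!mul2n !PoszM; ring.
  lia.
rewrite chexp_mod8_c ?oddM ?oC // (prod_jac_level_r N r a b) ?oddM ?oC //.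
rewrite S8 !mulr0 oppr0 sub0r add0r Ek rmorphM /=.
case: (jac_pm d (varpi N r)) => ->; [rewrite rmorph1|rewrite rmorphN1].
  by transitivity (- ((4 * 2) * k%:~R) : 'Z_8); [ring | rewrite e48; ring].
by transitivity (- ((4 * 2) * k%:~R) - 4 * 2 + 2 * (1 - -1) : 'Z_8); [ring | rewrite e48; ring].
Qed.

Lemma hsignM (N : nat) (r : nat -> int) (l m n : nat) :
  coprime N m -> coprime N n -> (if odd l then odd m && odd n else odd N) ->
  hsign N r l (m * n) = hsign N r l m * hsign N r l n.
Proof.
move=> cm cn; rewrite /hsign.
have wm := varpi_coprime N r m cm; have wn := varpi_coprime N r n cn.
case: ifP => ol.
  move=> /andP[om on]; rewrite jacMr ?coprimeMr ?wm // chi4M // exprMn; ring.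
by move=> oN; apply: jacMl; rewrite ?odd_varpi // coprime_sym.
Qed.

(** * Comparison of the exponents at gamma and gamma' *)

Lemma eq_mod24 (X Y : int) : X%:~R = Y%:~R :> 'Z_3 -> X%:~R = Y%:~R :> 'Z_8 ->
  exists t, X = Y + 24 * t.
Proof.
move=> /Zp_intr_eq [//|t Et] /Zp_intr_eq [//|s Es].
by exists (3 * s - t); lia.
Qed.

(** The data come from gamma' = delta gamma delta'^-1 with delta = diag(x u, y v) and delta' =
    diag(y u, x v), where l = u x y v. If [cosum] is a unit modulo 3, then l = 1 there and all four
    factors are their own inverses; hence C' d' = l C d = C d. *)
Lemma chexp_hecke_mod3 (N : nat) (r : nat -> int) (u x y v : nat)
    (a b a' b' : int) (C C' d d' : nat) :
  (0 < N)%N -> (0 < C)%N -> (0 < d)%N -> (0 < C')%N -> (0 < d')%N ->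
  a * d%:Z - b * (C * N)%N%:Z = 1 -> a' * d'%:Z - b' * (C' * N)%N%:Z = 1 ->
  \sum_(n <- divisors N) n%:Z * r n = 0 ->
  (cosum N r)%:~R * ((u * x * y * v)%:R - 1) = 0 :> 'Z_3 ->
  x%:Z * a = y%:Z * a' -> (v * C = u * C')%N -> (y * d = x * d')%N ->
  (chexp N r a' b' C' d')%:~R = (chexp N r a b C d)%:~R :> 'Z_3.
Proof.
move=> N0 C0 d0 C0' d0' det det' S2 S1 Ea EC Ed.
have n3 c e (a1 b1 : int) : a1 * e%:Z - b1 * (c * N)%N%:Z = 1 -> (3 %| e)%N -> ~~ (3 %| c * N)%N.
  move=> de /dvdnP[p Ep]; apply/negP => /dvdnP[q Eq]; move: de; rewrite Ep Eq !PoszM; nia.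
have [S0|S0] := eqVneq ((cosum N r)%:~R : 'Z_3) 0.
  have Z c e (a1 b1 : int) : (0 < c)%N -> (0 < e)%N -> a1 * e%:Z - b1 * (c * N)%N%:Z = 1 ->
      (chexp N r a1 b1 c e)%:~R = 0 :> 'Z_3.
    move=> c0 e0 de; have [e3|e3] := boolP (3 %| e)%N.
      by rewrite chexp_mod3_c ?(n3 _ _ _ _ de) // S0 mulr0.
    by rewrite chexp_mod3_d // S0 mulr0 oppr0.
  by rewrite !Z.
have L1 : (u * x * y * v)%:R = 1 :> 'Z_3.
  apply/eqP; rewrite -subr_eq0; apply/eqP.
  transitivity ((cosum N r)%:~R * ((cosum N r)%:~R * ((u * x * y * v)%:R - 1)) : 'Z_3); last by rewrite S1 mulr0.
  by rewrite mulrA Z3_sqr // mul1r.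
rewrite !natrM in L1.
have sq := Z3_sqr.
have nz : u%:R * x%:R * y%:R * v%:R != 0 :> 'Z_3 by rewrite L1 oner_neq0.
have [/Z3_mul_neq0[/Z3_mul_neq0[/sq uu xn0] yn0] vn0] := Z3_mul_neq0 _ _ nz.
have xx := sq _ xn0; have yy := sq _ yn0.
have EC' : v%:R * C%:R = u%:R * C'%:R :> 'Z_3 by rewrite -!natrM EC.
have Ed' : y%:R * d%:R = x%:R * d'%:R :> 'Z_3 by rewrite -!natrM Ed.
have Ea' : x%:R * a%:~R = y%:R * a'%:~R :> 'Z_3 by rewrite !pmulrn -!rmorphM /= Ea.
have d3 e : (3 %| e)%N = (e%:R == 0 :> 'Z_3) by rewrite pmulrn Zp_intr_eq0.
have dd' : (3 %| d)%N = (3 %| d')%N.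
  have E1 : d%:R = y%:R * (x%:R * d'%:R) :> 'Z_3 by rewrite -Ed' mulrA yy mul1r.
  have E2 : d'%:R = x%:R * (y%:R * d%:R) :> 'Z_3 by rewrite Ed' mulrA xx mul1r.
  by rewrite !d3; apply/eqP/eqP => E0; [rewrite E2 E0 !mulr0|rewrite E1 E0 !mulr0].
have [e3|e3] := boolP (3 %| d)%N.
  have e3' : (3 %| d')%N by rewrite -dd'.
  rewrite !chexp_mod3_c ?(n3 _ _ _ _ det) ?(n3 _ _ _ _ det') //; congr (_ * _).
  move: e3 e3'; rewrite !d3 => /eqP -> /eqP ->; rewrite !addr0.
  transitivity (y%:R * a'%:~R * (u%:R * C'%:R) * (y%:R * u%:R) : 'Z_3).
    by transitivity ((y%:R * y%:R) * (u%:R * u%:R) * (a'%:~R * C'%:R) : 'Z_3); [rewrite yy uu; ring|ring].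
  rewrite -Ea' -EC'; transitivity ((u%:R * x%:R * y%:R * v%:R) * (a%:~R * C%:R) : 'Z_3); first ring.
  by rewrite L1 mul1r.
rewrite !chexp_mod3_d -?dd' //; congr (- (_ * _)).
transitivity (x%:R * d'%:R * (u%:R * C'%:R) * (x%:R * u%:R) : 'Z_3).
  by transitivity ((x%:R * x%:R) * (u%:R * u%:R) * (d'%:R * C'%:R) : 'Z_3); [rewrite xx uu; ring|ring].
rewrite -Ed' -EC'; transitivity ((u%:R * x%:R * y%:R * v%:R) * (d%:R * C%:R) : 'Z_3); first ring.
by rewrite L1 mul1r.
Qed.

Lemma dvd24_mod (m : nat) (S : int) (l : nat) : (1 < m)%N -> (m %| 24)%N ->
  (24%:Z %| S * (l%:Z - 1))%Z -> S%:~R * (l%:R - 1) = 0 :> 'Z_m.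
Proof.
move=> m1 m24 H; apply/eqP.
have -> : S%:~R * (l%:R - 1) = (S * (l%:Z - 1))%:~R :> 'Z_m.
  by rewrite rmorphM rmorphB /= -pmulrn.
by rewrite Zp_intr_eq0 //; apply: dvdz_trans H.
Qed.

(** The first claim is the multiplicativity of [hsign] on y d = x d'. In the second, the coefficient
    6 vanishes modulo 3 and, a difference of two signs being even, acts as 2 modulo 8. *)
Lemma chexp_hecke (N : nat) (r : nat -> int) (l u x y v : nat)
    (a b a' b' : int) (C C' d d' : nat) :
  (0 < N)%N -> (0 < C)%N -> (0 < d)%N -> (0 < C')%N -> (0 < d')%N ->
  a * d%:Z - b * (C * N)%N%:Z = 1 -> a' * d'%:Z - b' * (C' * N)%N%:Z = 1 ->
  \sum_(n <- divisors N) n%:Z * r n = 0 ->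
  (24%:Z %| cosum N r * (l%:Z - 1))%Z ->
  l = (u * x * y * v)%N -> coprime N x -> coprime N y ->
  x%:Z * a = y%:Z * a' -> (v * C = u * C')%N -> (y * d = x * d')%N ->
  ~~ odd `|twok N r| -> odd l || odd N -> (odd l -> odd d) ->
  hsign N r l y * hsign N r l d = hsign N r l x * hsign N r l d' /\
  exists t, chexp N r a' b' C' d' = chexp N r a b C d + 6 * (hsign N r l d - hsign N r l d') + 24 * t.
Proof.
move=> N0 C0 d0 C0' d0' det det' S2 S1 El cx cy Ea EC Ed ek ol od.
have olu : odd l -> [/\ odd u, odd x, odd y & odd v].
  by rewrite El !oddM => /andP[/andP[/andP[]]].
have od' : odd l -> odd d'.
  move=> o; have [ou ox oy ov] := olu o; have := congr1 odd Ed.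
  by rewrite !oddM ox oy /= => <-; exact: od.
have [_ cd] := coprime_level N C d a b det.
have [_ cd'] := coprime_level N C' d' a' b' det'.
have oxyd (p q : nat) : (odd l -> odd p && odd q) -> (if odd l then odd p && odd q else odd N).
  by case: (odd l) ol => /= [_|->//]; apply.
split.
  rewrite -!hsignM ?Ed //; apply: oxyd => o.
    by have [_ -> _ _] := olu o; rewrite od'.
  by have [_ _ -> _] := olu o; rewrite od.
have S1_3 := dvd24_mod 3 _ _ isT isT S1.
have S1_8 := dvd24_mod 8 _ _ isT isT S1.
apply: eq_mod24.
  rewrite rmorphD rmorphM /=; have -> : 6%:~R = 0 :> 'Z_3 by apply/val_inj.
  rewrite mul0r addr0; apply: (chexp_hecke_mod3 N r u x y v a b a' b') => //.
  by rewrite -El.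
have cond e : (odd l -> odd e) -> (if odd l then odd e else odd N && ((cosum N r)%:~R == 0 :> 'Z_8)).
  case o: (odd l) ol; first by move=> _; apply.
  (* For even l, l - 1 is a unit modulo 8, so the divisibility by 24 forces [cosum] to vanish modulo
     8. *)
  move=> /= oN _; rewrite oN /=; have lm : (l%:R - 1) * (l%:R - 1) = 1 :> 'Z_8.
    apply: Z8_odd_sqr; rewrite mulrBr -[l]odd_double_half o add0n -mul2n natrM mulrA.
    by have -> : (4 * 2 = 0 :> 'Z_8) by [apply/val_inj]; rewrite mul0r sub0r; apply/val_inj.
  apply/eqP; transitivity ((cosum N r)%:~R * (l%:R - 1) * (l%:R - 1) : 'Z_8); last by rewrite S1_8 mul0r.
  by rewrite -mulrA lm mulr1.
rewrite (chexp_hsign N r l a' b') // ?cond // rmorphD rmorphM rmorphB /= (chexp_hsign N r l a b) // ?cond //.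
have -> : (d'%:R * C'%:R * (cosum N r)%:~R) = (d%:R * C%:R * (cosum N r)%:~R) :> 'Z_8.
  move: ol; case o : (odd l) => /= oN; last first.
    by have := cond d od; rewrite o oN => /eqP ->; rewrite !mulr0.
  have [ou ox _ _] := olu o.
  have xx : (x%:R : 'Z_8) * x%:R = 1 by apply/Z8_odd_sqr/Z8_odd_intr.
  have uu : (u%:R : 'Z_8) * u%:R = 1 by apply/Z8_odd_sqr/Z8_odd_intr.
  have EC' : v%:R * C%:R = u%:R * C'%:R :> 'Z_8 by rewrite -!natrM EC.
  have Ed' : y%:R * d%:R = x%:R * d'%:R :> 'Z_8 by rewrite -!natrM Ed.
  set S := (cosum N r)%:~R in S1_8 *.
  transitivity (x%:R * d'%:R * (u%:R * C'%:R) * (x%:R * u%:R) * S : 'Z_8).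
    by transitivity ((x%:R * x%:R) * (u%:R * u%:R) * (d'%:R * C'%:R) * S : 'Z_8); [rewrite xx uu; ring|ring].
  rewrite -Ed' -EC'.
  transitivity ((S * (l%:R - 1)) * (d%:R * C%:R) + d%:R * C%:R * S : 'Z_8).
    by rewrite El !natrM; ring.
  by rewrite S1_8 mul0r add0r.
by case: (hsign_pm N r l d) => ->; case: (hsign_pm N r l d') => ->; 
  rewrite -!addrA; congr (_ + _); apply/val_inj.
Qed.

(** The case of half-integral weight, where delta = delta' = diag(1, s^2): a square factor does not
    affect the Jacobi symbols. *)
Lemma chexp_square (N : nat) (r : nat -> int) (s : nat)
    (a b b' : int) (C d : nat) :
  (0 < N)%N -> (0 < C)%N -> (0 < s)%N ->
  a * d%:Z - b * (C * N)%N%:Z = 1 -> a * d%:Z - b' * (s * s * C * N)%N%:Z = 1 ->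
  \sum_(n <- divisors N) n%:Z * r n = 0 ->
  (24%:Z %| cosum N r * ((s * s)%N%:Z - 1))%Z -> odd d ->
  exists t, chexp N r a b' (s * s * C) d = chexp N r a b C d + 24 * t.
Proof.
move=> N0 C0 s0 det det' S2 S1 od; have d0 : (0 < d)%N by case: d od {det det'}.
have C0' : (0 < s * s * C)%N by rewrite !muln_gt0 s0.
have S1_3 := dvd24_mod 3 _ _ isT isT S1.
have S1_8 := dvd24_mod 8 _ _ isT isT S1.
apply: eq_mod24.
  apply: (chexp_hecke_mod3 N r 1 1 1 (s * s) a b a b') => //; last by rewrite mul1n.
  by rewrite !mul1n.
rewrite !chexp_mod8_d //.
have [csC cN] := coprime_level N _ d a b' det'.
move: csC; rewrite !coprimeMl => /andP[/andP[cs _] cC].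
have -> : \prod_(n <- divisors N) jac (s * s * C * (N %/ n)) d ^+ `|r n| =
    \prod_(n <- divisors N) jac (C * (N %/ n)) d ^+ `|r n|.
  rewrite big_seq [RHS]big_seq; apply: eq_bigr => n nD.
  have cn : coprime (N %/ n) d.
    by move: nD; rewrite -dvdn_divisors // => nN; apply: coprime_dvdl (dvdn_div nN) cN.
  by rewrite -mulnA jacMl ?coprimeMl ?cs ?cC ?cn // (jacMl s s) // jac_sq mul1r.
congr (- _ + _ - _); set S := (cosum N r)%:~R in S1_8 *.
transitivity ((S * ((s * s)%N%:R - 1)) * (d%:R * C%:R) + d%:R * C%:R * S : 'Z_8).
  by rewrite !natrM; ring.
by rewrite S1_8 mul0r add0r.
Qed.

(** * The complex exponential *)

Lemma cabsE (z : C) : (cabs z)%:C = `|z|.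
Proof. by rewrite normc_def. Qed.

Lemma cabsM (z w : C) : cabs (z * w) = cabs z * cabs w.
Proof. by apply: complexI; rewrite rmorphM /= !cabsE normrM. Qed.

Lemma cabsX (z : C) (n : nat) : cabs (z ^+ n) = cabs z ^+ n.
Proof. by apply: complexI; rewrite rmorphXn /= !cabsE normrX. Qed.

Lemma cabsV (z : C) : cabs z^-1 = (cabs z)^-1.
Proof. by apply: complexI; rewrite fmorphV /= !cabsE normfV. Qed.

Lemma cabs_div (z w : C) : cabs (z / w) = cabs z / cabs w.
Proof. by rewrite cabsM cabsV. Qed.

Lemma cabsN (z : C) : cabs (- z) = cabs z.
Proof. by apply: complexI; rewrite !cabsE normrN. Qed.

Lemma cabs_sub (z w : C) : cabs (z - w) = cabs (w - z).
Proof. by rewrite -cabsN opprB. Qed.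

Lemma cabsD (z w : C) : cabs (z + w) <= cabs z + cabs w.
Proof. by rewrite -lecR rmorphD /= !cabsE ler_normD. Qed.

Lemma cabsB (z w : C) : cabs (z - w) <= cabs z + cabs w.
Proof. by rewrite -(cabsN w) cabsD. Qed.

Lemma cabs_ge_sub (z w : C) : cabs z - cabs w <= cabs (z - w).
Proof. by rewrite lerBlDr -{1}(subrK w z) cabsD. Qed.

Lemma cabs_ge0 (z : C) : 0 <= cabs z.
Proof. by rewrite sqrtr_ge0. Qed.

Lemma cabs_eq0 (z : C) : (cabs z == 0) = (z == 0).
Proof. by rewrite -(normr_eq0 z) -cabsE -(inj_eq (@complexI _)). Qed.

Lemma cabs_gt0 (z : C) : (0 < cabs z) = (z != 0).
Proof. by rewrite lt_def cabs_eq0 cabs_ge0 andbT. Qed.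

Lemma cabs0 : cabs 0 = 0.
Proof. by apply/eqP; rewrite cabs_eq0. Qed.

Lemma cabs1 : cabs 1 = 1.
Proof. by apply: complexI; rewrite cabsE normr1. Qed.

Lemma cabs_real (x : R) : cabs x%:C = `|x|.
Proof. by rewrite /cabs /= expr0n addr0 sqrtr_sqr. Qed.

Lemma cabs_nat (n : nat) : cabs n%:R = n%:R.
Proof. by rewrite -[n%:R](rmorph_nat (real_complex R)) cabs_real normr_nat. Qed.

Lemma cabs_sum (T : Type) (s : seq T) (P : pred T) (F : T -> C) :
  cabs (\sum_(i <- s | P i) F i) <= \sum_(i <- s | P i) cabs (F i).
Proof.
elim/big_rec2: _ => [|i y x _ le]; first by rewrite cabs0.
by apply: le_trans (cabsD _ _) _; rewrite lerD2l.
Qed.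

Lemma cabs_ReIm (z : C) : `|complex.Re z| <= cabs z /\ `|complex.Im z| <= cabs z.
Proof.
have H (x y : R) : `|x| <= Num.sqrt (x ^+ 2 + y ^+ 2).
  by rewrite -sqrtr_sqr ler_wsqrtr // lerDl sqr_ge0.
by split; rewrite /cabs ?H // addrC H.
Qed.

Lemma cabs_le_ReIm (z : C) : cabs z <= `|complex.Re z| + `|complex.Im z|.
Proof.
rewrite -[X in _ <= X]ger0_norm ?addr_ge0 // -sqrtr_sqr ler_wsqrtr //.
rewrite sqrrD !real_normK ?num_real // lerD2r lerDl.
by rewrite mulrn_wge0 // mulr_ge0.
Qed.

Lemma cexpD (z w : C) : cexp (z + w) = cexp z * cexp w.
Proof.
case: z w => [a b] [c d]; rewrite /cexp /= -expRD cosD sinD.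
by simpc; congr (_ +i* _); ring.
Qed.

Lemma cexp0 : cexp 0 = 1.
Proof.
by rewrite /cexp /= Rtrigo_def.exp_0 Rtrigo_def.cos_0 Rtrigo_def.sin_0; simpc.
Qed.

Lemma cabs_cexp (z : C) : cabs (cexp z) = Rtrigo_def.exp (complex.Re z).
Proof.
rewrite /cexp cabsM cabs_real ger0_norm; last by apply/ltW/RltP/Exp_prop.exp_pos.
have -> : cabs (Rtrigo_def.cos (complex.Im z) +i* Rtrigo_def.sin (complex.Im z)) = 1; last by rewrite mulr1.
rewrite /cabs /= -(sqrtr1 R); congr Num.sqrt.
have := Rtrigo1.sin2_cos2 (complex.Im z); rewrite /RIneq.Rsqr !RealsE => E.
by rewrite addrC !expr2 E.
Qed.

Lemma eCD (z w : C) : eC (z + w) = eC z * eC w.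
Proof. by rewrite /eC mulrDr cexpD. Qed.

Lemma eC0 : eC 0 = 1.
Proof. by rewrite /eC mulr0 cexp0. Qed.

Lemma eC_neq0 (z : C) : eC z != 0.
Proof.
apply/eqP => E; have := eCD z (- z); rewrite subrr eC0 E mul0r => /eqP.
by rewrite oner_eq0.
Qed.

Lemma eCN (z : C) : eC (- z) = (eC z)^-1.
Proof. by apply: (mulfI (eC_neq0 z)); rewrite -eCD subrr eC0 divff // eC_neq0. Qed.

Lemma eCMn (n : nat) (z : C) : eC (n%:R * z) = eC z ^+ n.
Proof.
elim: n => [|n IH]; first by rewrite mul0r eC0.
by rewrite -natr1 mulrDl mul1r eCD IH exprSr.
Qed.

Lemma eCMz (n : int) (z : C) : eC (n%:~R * z) = eC z ^ n.
Proof.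
case: n => n; first by rewrite -pmulrn eCMn.
by rewrite NegzE rmorphN /= mulNr eCN -pmulrn eCMn exprnN.
Qed.

Lemma IZR2 : Rdefinitions.IZR (BinNums.Zpos (BinNums.xO BinNums.xH)) = 2 :> R.
Proof. by []. Qed.

Lemma eC1 : eC 1 = 1.
Proof.
rewrite /eC mulr1; have -> : (2 * Rtrigo1.PI)%:C * 'i = 0 +i* (2 * Rtrigo1.PI) by simpc.
have := Rtrigo1.cos_2PI; have := Rtrigo1.sin_2PI; rewrite !RmultE IZR2 => s c.
by rewrite /cexp /= Rtrigo_def.exp_0 s c; simpc.
Qed.

Lemma eC_int (n : int) : eC n%:~R = 1.
Proof. by rewrite -[n%:~R]mulr1 eCMz eC1 exp1rz. Qed.

Lemma eC_nat (n : nat) : eC n%:R = 1.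
Proof. by rewrite -[n%:R]mulr1 eCMn eC1 expr1n. Qed.

Lemma cabs_eC (z : C) : cabs (eC z) = Rtrigo_def.exp (- (2 * Rtrigo1.PI * complex.Im z)).
Proof.
rewrite /eC cabs_cexp; congr Rtrigo_def.exp.
by case: z => a b; simpc => /=; ring.
Qed.

Lemma PI_gt0 : 0 < Rtrigo1.PI :> R.
Proof. by apply/RltP/Rtrigo1.PI_RGT_0. Qed.

Lemma expR_gt0 (x : R) : 0 < Rtrigo_def.exp x.
Proof. by apply/RltP/Exp_prop.exp_pos. Qed.

Lemma expR_lt1 (x : R) : x < 0 -> Rtrigo_def.exp x < 1.
Proof. by move=> /RltP x0; rewrite -expR0; apply/RltP; apply: Rpower.exp_increasing. Qed.

Lemma cabs_eC_lt1 (t : C) : 0 < complex.Im t -> cabs (eC t) < 1.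
Proof.
move=> t0; rewrite cabs_eC; apply: expR_lt1; rewrite oppr_lt0.
by do 2![apply: mulr_gt0 => //]; exact: PI_gt0.
Qed.

Lemma eC_real (x : R) :
  eC x%:C = Rtrigo_def.cos (2 * Rtrigo1.PI * x) +i* Rtrigo_def.sin (2 * Rtrigo1.PI * x).
Proof.
have E : (2 * Rtrigo1.PI)%:C * 'i * x%:C = 0 +i* (2 * Rtrigo1.PI * x) by simpc.
by rewrite /eC E /cexp /= expR0; simpc.
Qed.

Lemma e_half : e (1 / 2) = -1.
Proof.
rewrite /e eC_real; have -> : 2 * Rtrigo1.PI * (1 / 2) = Rtrigo1.PI by field.
by rewrite Rtrigo1.cos_PI Rtrigo1.sin_PI; apply/eqP; rewrite eq_complex /= oppr0 !eqxx.
Qed.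

(** * Eta-quotients near the cusp oo *)

Lemma expr_small (x eps : R) : 0 <= x -> x < 1 -> 0 < eps ->
  exists M, forall m, (M <= m)%N -> x ^+ m < eps.
Proof.
move=> x0 x1 /RltP e0; have ax : Rdefinitions.Rlt (Rbasic_fun.Rabs x) (Rdefinitions.IZR (BinNums.Zpos BinNums.xH)).
  by rewrite RabsE ger0_norm //; apply/RltP.
have [M HM] := Rfunctions.pow_lt_1_zero x ax eps e0.
exists M => m mM; have := HM m (elimT ssrnat.leP mM); rewrite RpowE RabsE => /RltP.
by rewrite ger0_norm // exprn_ge0.
Qed.

Lemma cvgC_unique (u : nat -> C) (L L' : C) : cvgC u L -> cvgC u L' -> L = L'.
Proof.
move=> cL cL'; apply/eqP; rewrite -subr_eq0 -cabs_eq0; apply: contraT => n0.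
have p0 : 0 < cabs (L - L') / 2 by rewrite divr_gt0 // lt_def n0 cabs_ge0.
have [M HM] := cL _ p0; have [M' HM'] := cL' _ p0.
have H1 := HM (maxn M M') (leq_maxl _ _); have H2 := HM' (maxn M M') (leq_maxr _ _).
have : cabs (L - L') <= cabs (u (maxn M M') - L') + cabs (u (maxn M M') - L).
  have -> : L - L' = (u (maxn M M') - L') - (u (maxn M M') - L) by ring.
  exact: cabsB.
lra.
Qed.

Lemma limC_eq (u : nat -> C) (L : C) : cvgC u L -> limC u = L.
Proof.
move=> cL; apply: (cvgC_unique u) => //.
exact: (ClassicalEpsilon.epsilon_spec (inhabits 0) (cvgC u) (ex_intro _ L cL)).
Qed.

Lemma sum_geom_le (x : R) (M N : nat) : 0 <= x -> x < 1 ->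
  \sum_(M <= i < N) x ^+ i <= x ^+ M / (1 - x).
Proof.
move=> x0 x1; have d0 : 0 < 1 - x by lra.
have [le|lt] := leqP M N; last first.
  by rewrite big_geq ?(ltnW lt) // divr_ge0 ?exprn_ge0 // ltW.
rewrite ler_pdivlMr // -(subnKC le).
suff -> : (\sum_(M <= i < M + (N - M)) x ^+ i) * (1 - x) = x ^+ M - x ^+ (M + (N - M)).
  by rewrite gerBl exprn_ge0.
elim: (N - M)%N => [|j IH]; first by rewrite addn0 big_geq // mul0r subrr.
by rewrite addnS big_nat_recr ?leq_addr //= mulrDl IH exprS; ring.
Qed.

(** Real completeness is applied to the real and imaginary parts. The explicit tail bound is what
    later yields error terms of order q^(l+1). *)
Lemma geom_cauchy_cvg (u : nat -> C) (B x : R) : 0 <= B -> 0 <= x -> x < 1 ->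
  (forall n, cabs (u n.+1 - u n) <= B * x ^+ n.+1) ->
  exists L, cvgC u L /\ forall n, cabs (u n - L) <= B * (x ^+ n.+1 / (1 - x)).
Proof.
move=> B0 x0 x1 H; have d0 : 0 < 1 - x by lra.
have Hd n m : (n <= m)%N -> cabs (u m - u n) <= B * (x ^+ n.+1 / (1 - x)).
  move=> le; apply: (@le_trans _ _ (B * \sum_(n.+1 <= i < m.+1) x ^+ i)); last first.
    by apply: ler_wpM2l => //; exact: sum_geom_le.
  rewrite -(subnKC le); elim: (m - n)%N => [|j IH].
    by rewrite addn0 subrr cabs0 big_geq // mulr0.
  rewrite addnS big_nat_recr ?ltnS ?leq_addr //= mulrDr.
  have -> : u (n + j).+1 - u n = (u (n + j) - u n) + (u (n + j).+1 - u (n + j)) by ring.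
  by apply: le_trans (cabsD _ _) _; apply: lerD.
have small eps : 0 < eps -> exists M, forall n, (M <= n)%N -> B * (x ^+ n.+1 / (1 - x)) < eps.
  move=> e0; have p0 : 0 < eps * (1 - x) / (B + 1) by rewrite divr_gt0 ?mulr_gt0 //; lra.
  have [M HM] := expr_small x _ x0 x1 p0; exists M => n Mn.
  have := HM n.+1 (leqW Mn); rewrite ltr_pdivlMr; last lra.
  move=> K; rewrite mulrA ltr_pdivrMr //; apply: le_lt_trans K.
  by rewrite mulrC; apply: ler_wpM2l; [rewrite exprn_ge0|lra].
(* Here f is the real or the imaginary part. *)
have cau (f : C -> R) : (forall z, `|f z| <= cabs z) -> (forall z w, f (z - w) = f z - f w) ->
    {l : R | forall eps, 0 < eps -> exists M, forall m, (M <= m)%N -> `|f (u m) - l| < eps}.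
  move=> fle fB.
  have [] := Rcomplete.R_complete (fun n => f (u n)).
    move=> eps /RltP e0; have {}e0 : 0 < eps :> R by exact: e0.
    have e2 : 0 < eps / 2 by lra.
    have [M HM] := small _ e2; exists M => n m /ssrnat.leP nM /ssrnat.leP mM.
    rewrite RdistE -fB; apply/RltP.
    apply: le_lt_trans (fle _) _.
    have -> : u n - u m = (u n - u M) - (u m - u M) by ring.
    apply: le_lt_trans (cabsB _ _) _.
    have := Hd _ _ nM; have := Hd _ _ mM; have := HM M (leqnn M).
    lra.
  move=> l Hl; exists l => eps e0; have [M HM] := Hl eps (elimT RltP e0).
  by exists M => m /ssrnat.leP mM; have := HM m mM; rewrite RdistE => /RltP.
have [a Ha] := cau (@complex.Re R) (fun z => (cabs_ReIm z).1) (fun z w => raddfB (@complex.Re R : Rcomplex R -> R) z w).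
have [b Hb] := cau (@complex.Im R) (fun z => (cabs_ReIm z).2) (fun z w => raddfB (@complex.Im R : Rcomplex R -> R) z w).
have cv : cvgC u (a +i* b).
  move=> eps e0; have e2 : 0 < eps / 2 by lra.
  have [M HM] := Ha _ e2; have [M' HM'] := Hb _ e2.
  exists (maxn M M') => m; rewrite geq_max => /andP[h1 h2].
  apply: le_lt_trans (cabs_le_ReIm _) _.
  have := HM m h1; have := HM' m h2; case: (u m) => p q /= X Y.
  lra.
exists (a +i* b); split=> // n.
apply/ler_addgt0Pr => eps e0; have [M HM] := cv eps e0.
have h1 := HM (maxn M n) (leq_maxl _ _); have h2 := Hd n (maxn M n) (leq_maxr _ _).
have -> : u n - (a +i* b) = (u (maxn M n) - (a +i* b)) - (u (maxn M n) - u n) by ring.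
apply: le_trans (cabsB _ _) _; lra.
Qed.

Definition euler_partial (q : C) (M : nat) : C := \prod_(1 <= m < M.+1) (1 - q ^+ m).

Definition euler_prod (q : C) : C := limC (euler_partial q).

Lemma euler_partialS (q : C) (M : nat) :
  euler_partial q M.+1 = euler_partial q M * (1 - q ^+ M.+1).
Proof. by rewrite /euler_partial big_nat_recr. Qed.

(** Each factor satisfies |1 - q^m| <= 1 + |q|^m <= exp(|q|^m). *)
Lemma euler_partial_le (q : C) (M : nat) : cabs q < 1 ->
  cabs (euler_partial q M) <= Rtrigo_def.exp (1 - cabs q)^-1.
Proof.
move=> q1; have q0 := cabs_ge0 q.
have H : cabs (euler_partial q M) <= Rtrigo_def.exp (\sum_(1 <= m < M.+1) cabs q ^+ m).
  elim: M => [|M IH]; first by rewrite /euler_partial !big_geq // cabs1 expR0.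
  rewrite euler_partialS cabsM big_nat_recr //= -expRD.
  apply: ler_pM; rewrite ?cabs_ge0 //.
  apply: (@le_trans _ _ (1 + cabs q ^+ M.+1)); first by rewrite -{1}cabs1 -cabsX cabsB.
  by apply/RleP; exact: Rpower.exp_ineq1_le.
apply: le_trans H _.
have le : \sum_(1 <= m < M.+1) cabs q ^+ m <= (1 - cabs q)^-1.
  apply: le_trans (sum_geom_le _ 1 M.+1 q0 q1) _.
  by rewrite expr1 ler_pdivrMr ?subr_gt0 // mulVf ?ltW // gt_eqF // subr_gt0.
move: le; rewrite le_eqVlt => /orP[/eqP -> //|/RltP lt].
by apply/ltW/RltP; apply: Rpower.exp_increasing.
Qed.

Lemma euler_prod_approx (q : C) : cabs q < 1 ->
  cvgC (euler_partial q) (euler_prod q) /\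
  forall n, cabs (euler_partial q n - euler_prod q) <=
    Rtrigo_def.exp (1 - cabs q)^-1 * (cabs q ^+ n.+1 / (1 - cabs q)).
Proof.
move=> q1; have [n|L [cL HL]] := geom_cauchy_cvg (euler_partial q) (Rtrigo_def.exp (1 - cabs q)^-1) (cabs q) (ltW (expR_gt0 _)) (cabs_ge0 q) q1.
  rewrite euler_partialS; have -> : euler_partial q n * (1 - q ^+ n.+1) - euler_partial q n = - (euler_partial q n * q ^+ n.+1) by ring.
  by rewrite cabsN cabsM cabsX ler_wpM2r ?exprn_ge0 ?cabs_ge0 // euler_partial_le.
by rewrite /euler_prod (limC_eq _ _ cL).
Qed.

(** For the factors beyond M this is the Weierstrass inequality: the product of the 1 - y_i is at
    least 1 minus the sum of the y_i. *)
Lemma euler_partial_ge (q : C) (M n : nat) : cabs q < 1 -> (M <= n)%N ->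
  cabs (euler_partial q M) * (1 - \sum_(M.+1 <= i < n.+1) cabs q ^+ i) <= cabs (euler_partial q n).
Proof.
move=> q1 /subnKC <-; elim: (n - M)%N => [|j IH]; first by rewrite addn0 big_geq // subr0 mulr1.
rewrite addnS euler_partialS cabsM big_nat_recr ?ltnS ?leq_addr //=.
have q0 := cabs_ge0 q; have P0 := cabs_ge0 (euler_partial q M).
set S := \sum_(_ <= i < _) _ in IH *; set y := cabs q ^+ _.
have y0 : 0 <= y by rewrite exprn_ge0.
have y1 : y <= 1 by rewrite exprn_ile1 // ltW.
have S0 : 0 <= S by apply: sumr_ge0 => i _; rewrite exprn_ge0.
have h : 1 - y <= cabs (1 - q ^+ (M + j).+1) by rewrite /y -cabs1 -cabsX cabs_ge_sub.
apply: (@le_trans _ _ (cabs (euler_partial q (M + j)) * (1 - y))); last first.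
  by rewrite ler_wpM2l ?cabs_ge0.
apply: (@le_trans _ _ (cabs (euler_partial q M) * (1 - S) * (1 - y))); last first.
  by rewrite ler_wpM2r ?subr_ge0.
rewrite -mulrA ler_wpM2l //; have : 0 <= S * y by rewrite mulr_ge0.
lra.
Qed.

(** Beyond an M with tail sum below 1/2, the partial products stay above half the modulus of the
    M-th one, which is not 0. *)
Lemma euler_prod_neq0 (q : C) : cabs q < 1 -> euler_prod q != 0.
Proof.
move=> q1; have q0 := cabs_ge0 q; have [cv _] := euler_prod_approx q q1.
have d0 : 0 < 1 - cabs q by lra.
have e0 : 0 < (1 - cabs q) / 2 by lra.
have [M HM] := expr_small _ _ q0 q1 e0.
have P0 : 0 < cabs (euler_partial q M).
  rewrite cabs_gt0 /euler_partial prodf_seq_neq0; apply/allP => i.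
  rewrite mem_index_iota => /andP[i1 _]; rewrite implyTb subr_eq0; apply/eqP => E.
  have := congr1 cabs E; rewrite cabs1 cabsX => E1.
  by have := exprn_ilt1 i q0 q1; rewrite -E1 ltxx -lt0n i1.
have ge n : (M <= n)%N -> cabs (euler_partial q M) / 2 <= cabs (euler_partial q n).
  move=> Mn; apply: le_trans (euler_partial_ge q M n q1 Mn).
  rewrite ler_wpM2l ?ltW //; have := sum_geom_le _ M.+1 n.+1 q0 q1.
  have : cabs q ^+ M.+1 / (1 - cabs q) < 1 / 2.
    by rewrite ltr_pdivrMr //; have := HM M.+1 (leqW (leqnn M)); lra.
  set S := \sum_(_ <= i < _) _; lra.
apply/eqP => E; have h0 : 0 < cabs (euler_partial q M) / 2 by lra.
have [M' HM'] := cv _ h0; have := HM' (maxn M M') (leq_maxr _ _).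
by rewrite E subr0 ltNge ge // leq_maxl.
Qed.

(** F and p agree up to O(q^(l+1)) at 0. This stands in for q-expansions: no power series has to
    converge, and p may be the truncated product that defines [eta_coef]. *)
Definition approx (l : nat) (F : C -> C) (p : {poly C}) : Prop :=
  exists K rho : R, [/\ 0 <= K, 0 < rho, rho <= 1 &
    forall q, cabs q < rho -> cabs (F q - p.[q]) <= K * cabs q ^+ l.+1].

Definition poly_bound (p : {poly C}) : R := \sum_(i < size p) cabs p`_i.

Lemma poly_bound_ge0 (p : {poly C}) : 0 <= poly_bound p.
Proof. by apply: sumr_ge0 => i _; apply: cabs_ge0. Qed.

Lemma horner_le_bound (p : {poly C}) (q : C) : cabs q <= 1 -> cabs p.[q] <= poly_bound p.
Proof.
move=> q1; rewrite horner_coef; apply: le_trans (cabs_sum _ _ _ _) _.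
apply: ler_sum => i _; rewrite cabsM cabsX -[X in _ <= X]mulr1 ler_wpM2l ?cabs_ge0 //.
by rewrite exprn_ile1 ?cabs_ge0.
Qed.

Lemma approx_poly (l : nat) (p : {poly C}) : approx l (fun q => p.[q]) p.
Proof.
by exists 0, 1; split=> // q _; rewrite subrr cabs0 mul0r.
Qed.

Lemma approx_ext (l : nat) (F G : C -> C) (p : {poly C}) :
  (forall q, cabs q < 1 -> F q = G q) -> approx l F p -> approx l G p.
Proof.
move=> FG [K [rho [K0 r0 r1 H]]]; exists K, rho; split=> // q qr.
by rewrite -FG ?H //; apply: lt_le_trans r1.
Qed.

Lemma approx_mul (l : nat) (F G : C -> C) (p r : {poly C}) :
  approx l F p -> approx l G r -> approx l (fun q => F q * G q) (p * r).
Proof.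
move=> [K [rho [K0 r0 r1 H]]] [K' [rho' [K0' r0' r1' H']]].
have Bp := poly_bound_ge0 p; have Br := poly_bound_ge0 r.
exists (K * (poly_bound r + K') + poly_bound p * K'), (Num.min rho rho'); split.
- by apply: addr_ge0; apply: mulr_ge0 => //; apply: addr_ge0.
- by rewrite lt_min r0.
- by rewrite ge_min r1.
move=> q; rewrite lt_min => /andP[qr qr'].
have q1 : cabs q <= 1 by apply: ltW; apply: lt_le_trans r1.
have q0 := cabs_ge0 q.
have Gb : cabs (G q) <= poly_bound r + K'.
  have -> : G q = r.[q] + (G q - r.[q]) by ring.
  apply: le_trans (cabsD _ _) _; apply: lerD; first exact: horner_le_bound.
  apply: le_trans (H' q qr') _; rewrite -[X in _ <= X]mulr1 ler_wpM2l // exprn_ile1 //.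
have -> : F q * G q - (p * r).[q] = (F q - p.[q]) * G q + p.[q] * (G q - r.[q]).
  by rewrite hornerM; ring.
apply: le_trans (cabsD _ _) _; rewrite !cabsM mulrDl.
apply: lerD.
  rewrite [X in _ <= X]mulrAC; apply: ler_pM => //; rewrite ?cabs_ge0 //; exact: H.
rewrite -mulrA; apply: ler_pM; rewrite ?cabs_ge0 //; [exact: horner_le_bound|exact: H'].
Qed.

Lemma approx_expn (l : nat) (F : C -> C) (p : {poly C}) (n : nat) :
  approx l F p -> approx l (fun q => F q ^+ n) (p ^+ n).
Proof.
move=> H; elim: n => [|n IH].
  by apply: approx_ext (approx_poly l 1) => q _; rewrite hornerC expr0.
by rewrite exprS; apply: approx_ext (approx_mul _ _ _ _ _ H IH) => q _; rewrite exprS.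
Qed.

Lemma approx_prod (T : Type) (s : seq T) (l : nat) (F : T -> C -> C) (p : T -> {poly C}) :
  (forall i, approx l (F i) (p i)) ->
  approx l (fun q => \prod_(i <- s) F i q) (\prod_(i <- s) p i).
Proof.
move=> H; elim: s => [|i s IH].
  by apply: approx_ext (approx_poly l _) => q _; rewrite !big_nil hornerC.
by rewrite big_cons; apply: approx_ext (approx_mul _ _ _ _ _ (H i) IH) => q _; rewrite big_cons.
Qed.

(** 1/F - p' is 1/F times 1 - F p'. The second factor is O(q^(l+1)) because p p' is 1 modulo
    X^(l+1), and |F| >= 1/2 near 0. *)
Lemma approx_inv (l : nat) (F : C -> C) (p p' s : {poly C}) :
  approx l F p -> p.[0] = 1 -> p * p' = 1 + 'X^(l.+1) * s ->
  approx l (fun q => (F q)^-1) p'.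
Proof.
move=> [K [rho [K0 r0 r1 H]]] p0 pp'.
have [u Eu] : exists u : {poly C}, p = 1 + 'X * u.
  have : root (p - 1) 0 by rewrite rootE hornerD hornerN hornerC p0 subrr.
  move=> /factor_theorem [u Eu]; exists u.
  by rewrite mulrC -['X]subr0 -Eu addrC subrK.
set B := poly_bound u; have B0 : 0 <= B := poly_bound_ge0 u.
have S0 := poly_bound_ge0 s; have P0 := poly_bound_ge0 p'.
have D0 : 0 < 2 * (K + B + 1) by lra.
(* The radius ensures (K + B) |q| < 1/2, where K controls F - p and B controls (p - 1)/X. *)
exists (2 * (poly_bound s + K * poly_bound p')), (Num.min rho (2 * (K + B + 1))^-1); split.
- by rewrite mulr_ge0 // addr_ge0 // mulr_ge0.
- by rewrite lt_min r0 invr_gt0.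
- by rewrite ge_min r1.
move=> q; rewrite lt_min => /andP[qr qr'].
have q1 : cabs q <= 1 by apply: ltW; apply: lt_le_trans r1.
have q0 := cabs_ge0 q.
have HF := H q qr.
have lq : cabs q ^+ l.+1 <= cabs q by rewrite exprS -[X in _ <= X]mulr1 ler_wpM2l // exprn_ile1.
have q2 : cabs q * (2 * (K + B + 1)) < 1.
  by rewrite -ltr_pdivlMr // div1r.
have F1 : cabs (F q - 1) <= (K + B) * cabs q.
  have -> : F q - 1 = (F q - p.[q]) + q * u.[q] by rewrite Eu hornerD hornerM hornerX hornerC; ring.
  apply: le_trans (cabsD _ _) _; rewrite mulrDl; apply: lerD.
    by apply: le_trans HF _; rewrite ler_wpM2l.
  by rewrite cabsM mulrC ler_wpM2r // horner_le_bound.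
have Fge : 1 / 2 <= cabs (F q).
  have e1 : 1 - (1 - F q) = F q by ring.
  have := cabs_ge_sub 1 (1 - F q); rewrite e1 cabs1 (cabs_sub 1) => h.
  have : (K + B) * cabs q <= (K + B + 1) * cabs q by rewrite ler_wpM2r // lerDl.
  by move: h q2 F1; lra.
have Fn0 : F q != 0 by rewrite -cabs_gt0; apply: lt_le_trans Fge; lra.
have -> : (F q)^-1 - p'.[q] = (F q)^-1 * (- (q ^+ l.+1 * s.[q]) + (p.[q] - F q) * p'.[q]).
  have := congr1 (fun f => f.[q]) pp'; rewrite hornerM hornerD hornerM hornerXn hornerC => E.
  have -> : q ^+ l.+1 * s.[q] = p.[q] * p'.[q] - 1 by rewrite E; ring.
  by field.
rewrite cabsM cabsV.
have iF : (cabs (F q))^-1 <= 2.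
  rewrite -[2]invrK lef_pV2 ?posrE ?invr_gt0 //; first by move: Fge; lra.
  by apply: lt_le_trans Fge; lra.
rewrite -mulrA; apply: ler_pM; rewrite ?invr_ge0 ?cabs_ge0 //.
apply: le_trans (cabsD _ _) _; rewrite cabsN !cabsM cabsX mulrDl; apply: lerD.
  by rewrite mulrC ler_wpM2r ?exprn_ge0 // horner_le_bound.
rewrite mulrAC; apply: ler_pM; rewrite ?cabs_ge0 //; last exact: horner_le_bound.
by rewrite cabs_sub.
Qed.

Lemma approx_comp (l n : nat) (F : C -> C) (p : {poly C}) : (0 < n)%N ->
  approx l F p -> approx l (fun q => F (q ^+ n)) (p \Po 'X^n).
Proof.
move=> n0 [K [rho [K0 r0 r1 H]]]; exists K, rho; split=> // q qr.
have q0 := cabs_ge0 q.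
have q1 : cabs q <= 1 by apply: ltW; apply: lt_le_trans r1.
have qn : cabs (q ^+ n) <= cabs q.
  by rewrite cabsX -{2}[cabs q]expr1 ler_wiXn2l.
rewrite horner_comp hornerXn; apply: le_trans (H _ (le_lt_trans qn qr)) _.
by rewrite ler_wpM2l // lerXn2r ?nnegrE ?cabs_ge0.
Qed.

Definition polyZC (p : {poly int}) : {poly C} := map_poly (intr : int -> C) p.

Lemma euler_prod_approx_poly (l : nat) :
  approx l euler_prod (polyZC (\prod_(1 <= m < l.+1) (1 - 'X^m))).
Proof.
(* For |q| < 1/2 both occurrences of 1/(1 - |q|) in the tail bound are at most 2. *)
exists (Rtrigo_def.exp 2 * 2), (1 / 2); split; try lra.
  by rewrite mulr_ge0 // ltW // expR_gt0.
move=> q qh; have q1 : cabs q < 1 by lra.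
have [_ H] := euler_prod_approx q q1.
have -> : (polyZC (\prod_(1 <= m < l.+1) (1 - 'X^m))).[q] = euler_partial q l.
  rewrite /polyZC rmorph_prod horner_prod; apply: eq_bigr => m _.
  by rewrite rmorphB rmorph1 /= map_polyXn hornerD hornerN hornerXn hornerC.
rewrite cabs_sub; apply: le_trans (H l) _.
have d0 : 0 < 1 - cabs q by lra.
have i2 : (1 - cabs q)^-1 <= 2 by rewrite -[2]invrK lef_pV2 ?posrE ?invr_gt0 //; lra.
have e2 : Rtrigo_def.exp (1 - cabs q)^-1 <= Rtrigo_def.exp 2.
  move: i2; rewrite le_eqVlt => /orP[/eqP -> //|/RltP lt].
  by apply/ltW/RltP; apply: Rpower.exp_increasing.
rewrite -mulrA; apply: ler_pM => //.
- by rewrite ltW // expR_gt0.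
- by rewrite divr_ge0 ?exprn_ge0 ?cabs_ge0 // ltW.
by rewrite mulrC ler_wpM2r // exprn_ge0 ?cabs_ge0.
Qed.

Lemma geom_trunc_inv (m l : nat) : (0 < m)%N ->
  (1 - 'X^m) * geom_trunc m l = 1 - 'X^(m * l.+1).
Proof.
move=> m0; rewrite /geom_trunc; elim: l => [|l IH].
  by rewrite big_ord_recl big_ord0 addr0 muln0 expr0 mulr1 muln1.
by rewrite big_ord_recr /= mulrDr IH [(m * l.+2)%N]mulnSr exprD; ring.
Qed.

(** Each pair of factors multiplies to 1 - X^(m (l+1)), which is 1 modulo X^(l+1). *)
Lemma prod_inv_trunc (l k : nat) : (k <= l)%N ->
  exists s : {poly int}, (\prod_(1 <= m < k.+1) (1 - 'X^m)) * (\prod_(1 <= m < k.+1) geom_trunc m l)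
     = 1 + 'X^(l.+1) * s.
Proof.
elim: k => [|k IH] kl; first by exists 0; rewrite !big_geq // mulr0 addr0 mulr1.
have [s Es] := IH (ltnW kl).
rewrite big_nat_recr //= [X in _ * X]big_nat_recr //= mulrACA Es geom_trunc_inv //.
exists (s - 'X^(k * l.+1) * (1 + 'X^(l.+1) * s)).
by rewrite mulSn exprD; ring.
Qed.

Lemma euler_prod_exprz_approx (l : nat) (s : int) :
  approx l (fun q => euler_prod q ^ s) (polyZC (\prod_(1 <= m < l.+1) eta_factor m s l)).
Proof.
rewrite /eta_factor; case: s => n.
  have := approx_expn _ _ _ n (euler_prod_approx_poly l).
  rewrite /polyZC -rmorphXn /= => H.
  by rewrite -prodrXl in H.
set p := \prod_(1 <= m < l.+1) (1 - 'X^m : {poly int}).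
set p' := \prod_(1 <= m < l.+1) (geom_trunc m l).
have [s Es] := prod_inv_trunc l l (leqnn l).
have ap : approx l (fun q => (euler_prod q)^-1) (polyZC p').
  apply: (approx_inv _ _ (polyZC p) _ (polyZC s)).
  - exact: euler_prod_approx_poly.
  - rewrite /polyZC rmorph_prod horner_prod big_nat big1 // => m /andP[m0 _].
    by rewrite rmorphB rmorph1 /= map_polyXn hornerD hornerN hornerXn hornerC expr0n eqn0Ngt m0 subr0.
  - by rewrite /polyZC -rmorphM Es rmorphD rmorph1 rmorphM /= map_polyXn.
have := approx_expn _ _ _ n.+1 ap; rewrite /polyZC -rmorphXn /= /p' -prodrXl.
by apply: approx_ext => q _; rewrite exprVn.
Qed.

Definition eta_poly (N : nat) (r : nat -> int) (l : nat) : {poly int} :=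
  \prod_(n <- divisors N) \prod_(1 <= m < l.+1) eta_factor (n * m) (r n) l.

Lemma eta_factor_comp (n m l : nat) (s : int) :
  eta_factor m s l \Po 'X^n = eta_factor (n * m) s l.
Proof.
have XE j : 'X^j \Po 'X^n = 'X^(n * j) :> {poly int} by rewrite comp_Xn_poly -exprM.
have C1 : (1 : {poly int}) \Po 'X^n = 1 by rewrite -[1]/(1%:P) comp_polyC.
rewrite /eta_factor; case: ifP => _; rewrite rmorphXn /=; congr (_ ^+ _).
  by rewrite comp_polyB XE C1.
rewrite /geom_trunc rmorph_sum /=; apply: eq_bigr => t _.
by rewrite XE mulnA.
Qed.

Definition eta_fun (N : nat) (r : nat -> int) (q : C) : C :=
  \prod_(n <- divisors N) euler_prod (q ^+ n) ^ (r n).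

Lemma eta_fun_approx (N : nat) (r : nat -> int) (l : nat) : (0 < N)%N ->
  approx l (eta_fun N r) (polyZC (eta_poly N r l)).
Proof.
move=> N0; rewrite /eta_poly /polyZC rmorph_prod /=.
(* [approx_prod] asks for every index, hence the dummy value at n = 0, which does not divide N. *)
have H n : approx l (fun q => if (0 < n)%N then euler_prod (q ^+ n) ^ r n else 1)
    (if (0 < n)%N then polyZC (\prod_(1 <= m < l.+1) eta_factor (n * m) (r n) l) else 1).
  case: posnP => n0; first by apply: approx_ext (approx_poly l 1) => q _; rewrite hornerC.
  have := approx_comp _ n _ _ n0 (euler_prod_exprz_approx l (r n)).
  rewrite /polyZC -(map_polyXn (intr : int -> C)) -map_comp_poly rmorph_prod.
  by rewrite (eq_bigr _ (fun m _ => eta_factor_comp n m l (r n))).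
have := approx_prod _ (divisors N) l _ _ H.
have E (T : comPzRingType) (f : nat -> T) :
    \prod_(n <- divisors N) (if (0 < n)%N then f n else 1) = \prod_(n <- divisors N) f n.
  rewrite big_seq [RHS]big_seq; apply: eq_bigr => n; rewrite -dvdn_divisors // => nN.
  by rewrite (dvdn_gt0 N0 nN).
by rewrite E; apply: approx_ext => q _; rewrite E.
Qed.

Lemma Im_natr_mul (n : nat) (t : C) : complex.Im (n%:R * t) = n%:R * complex.Im t.
Proof.
by rewrite -[n%:R : C](rmorph_nat (real_complex R)); case: t => a b; simpc => /=; ring.
Qed.

Lemma euler_prod_pow_neq0 (q : C) (n : nat) : (0 < n)%N -> cabs q < 1 ->
  euler_prod (q ^+ n) != 0.
Proof.
move=> n0 q1; apply: euler_prod_neq0; rewrite cabsX exprn_ilt1 ?cabs_ge0 //.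
by rewrite -lt0n.
Qed.

Lemma eta_fun_neq0 (N : nat) (r : nat -> int) (q : C) : (0 < N)%N -> cabs q < 1 ->
  eta_fun N r q != 0.
Proof.
move=> N0 q1; rewrite /eta_fun prodf_seq_neq0; apply/allP => n.
rewrite -dvdn_divisors // => nN; apply: expfz_neq0.
by apply: euler_prod_pow_neq0 => //; apply: dvdn_gt0 nN.
Qed.

Lemma eC_sum (T : Type) (s : seq T) (F : T -> C) :
  eC (\sum_(i <- s) F i) = \prod_(i <- s) eC (F i).
Proof. by elim/big_rec2: _ => [|i x y _ <-]; rewrite ?eC0 ?eCD. Qed.

(** The factors e(n t / 24) cancel since the sum of n [r n] is 0; f thus depends on q = e(t)
    alone. *)
Lemma eta_quotE (N : nat) (r : nat -> int) (t : C) : (0 < N)%N ->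
  \sum_(n <- divisors N) n%:Z * r n = 0 ->
  eta_quot N r t = eta_fun N r (eC t).
Proof.
move=> N0 S2; rewrite /eta_quot /eta_fun.
transitivity (\prod_(n <- divisors N) (eC ((r n)%:~R * (n%:R * t / 24%:R)) * euler_prod (eC t ^+ n) ^ r n)).
  apply: eq_bigr => n _.
  rewrite (eCMz (r n) (n%:R * t / 24%:R)).
  rewrite -expfzMl.
  rewrite -(eCMn n t).
  by [].
rewrite big_split /= -eC_sum.
have -> : \sum_(n <- divisors N) (r n)%:~R * (n%:R * t / 24%:R) = (\sum_(n <- divisors N) n%:Z * r n)%:~R * (t / 24%:R) :> C.
  rewrite rmorph_sum /= mulr_suml; apply: eq_bigr => n _; rewrite intrM -pmulrn; ring.
by rewrite S2 mul0r eC0 mul1r.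
Qed.

Lemma eta_quot_neq0 (N : nat) (r : nat -> int) (t : C) : (0 < N)%N ->
  \sum_(n <- divisors N) n%:Z * r n = 0 -> 0 < complex.Im t -> eta_quot N r t != 0.
Proof.
by move=> N0 S2 t0; rewrite eta_quotE // eta_fun_neq0 // cabs_eC_lt1.
Qed.

Lemma eta_quot_shift (N : nat) (r : nat -> int) (t : C) (m : int) : (0 < N)%N ->
  \sum_(n <- divisors N) n%:Z * r n = 0 -> eta_quot N r (t + m%:~R) = eta_quot N r t.
Proof.
move=> N0 S2; rewrite (eta_quotE N r (t + _) N0 S2) (eta_quotE N r t N0 S2).
by rewrite eCD eC_int mulr1.
Qed.

Definition low_coefs (p : {poly int}) (a : int) : Prop := p`_0 = 1 /\ p`_1 = a.

Lemma low_coefs1 : low_coefs 1 0.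
Proof. by rewrite /low_coefs !coef1. Qed.

Lemma low_coefsM (p q : {poly int}) (a b : int) :
  low_coefs p a -> low_coefs q b -> low_coefs (p * q) (a + b).
Proof.
move=> [p0 p1] [q0 q1]; rewrite /low_coefs !coefM !big_ord_recl !big_ord0 /=.
by rewrite !subn0 /bump /= subnn p0 p1 q0 q1; split; ring.
Qed.

Lemma low_coefsX (p : {poly int}) (a : int) (n : nat) :
  low_coefs p a -> low_coefs (p ^+ n) (n%:Z * a).
Proof.
move=> H; elim: n => [|n IH]; first by rewrite mul0r expr0; apply: low_coefs1.
by rewrite exprS (_ : n.+1%:Z * a = a + n%:Z * a); [apply: low_coefsM|rewrite -addn1 PoszD; ring].
Qed.

Lemma low_coefs_prod (T : eqType) (s : seq T) (F : T -> {poly int}) (a : T -> int) :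
  (forall i, i \in s -> low_coefs (F i) (a i)) ->
  low_coefs (\prod_(i <- s) F i) (\sum_(i <- s) a i).
Proof.
elim: s => [|i s IH] H; first by rewrite !big_nil; apply: low_coefs1.
rewrite !big_cons; apply: low_coefsM; first by apply: H; rewrite mem_head.
by apply: IH => j js; apply: H; rewrite inE js orbT.
Qed.

Lemma low_coefs_factor (j l : nat) (s : int) : (0 < j)%N -> (0 < l)%N ->
  low_coefs (eta_factor j s l) (if j == 1%N then - s else 0).
Proof.
move=> j0 l0; rewrite /eta_factor; case: s => n /=.
  have -> : (if j == 1%N then - n%:Z else 0) = n%:Z * (if j == 1%N then -1 else 0).
    by case: ifP => _; ring.
  apply: low_coefsX; rewrite /low_coefs !coefB !coef1 !coefXn.
  have -> : (0 == j)%N = false by case: (j) j0.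
  by rewrite [(1 == j)%N]eq_sym; case: ifP.
have -> : (if j == 1%N then - Negz n else 0) = n.+1%:Z * (if j == 1%N then 1 else 0).
  by case: ifP => _; rewrite ?NegzE; ring.
apply: low_coefsX; rewrite /low_coefs /geom_trunc !coef_sum; split.
  rewrite (bigD1 ord0) //= muln0 coefXn big1 ?addr0 // => i.
  rewrite -val_eqE /= => i0; rewrite coefXn eq_sym muln_eq0.
  by rewrite (negbTE (lt0n_neq0 j0)) (negbTE i0).
have l1 : (1 < l.+1)%N by [].
rewrite (bigD1 (Ordinal l1)) //= muln1 coefXn big1 ?addr0 => [|i].
  by rewrite eq_sym; case: ifP.
rewrite -val_eqE /= => i1; rewrite coefXn; case: eqP => // /esym /eqP.
by rewrite muln_eq1 (negbTE i1) andbF.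
Qed.

(** Linear coefficients of series with constant term 1 add up under multiplication, and only the
    factor with n = m = 1 has a nonzero one. *)
Lemma eta_poly_low_coefs (N l : nat) (r : nat -> int) : (0 < N)%N -> (0 < l)%N ->
  low_coefs (eta_poly N r l) (- r 1%N).
Proof.
move=> N0 l0; have -> : - r 1%N =
    \sum_(n <- divisors N) \sum_(m <- index_iota 1 l.+1) (if (n * m == 1)%N then - r n else 0).
  rewrite (bigD1_seq 1%N) ?divisors_uniq -?dvdn_divisors ?dvd1n //=.
  rewrite [X in _ + X]big1 ?addr0 => [|n n1].
    rewrite (bigD1_seq 1%N) ?iota_uniq ?mem_index_iota //= big1 ?addr0 // => m m1.
    by rewrite mul1n (negbTE m1).
  by rewrite big1 // => m _; rewrite muln_eq1 (negbTE n1).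
apply: low_coefs_prod => n; rewrite -dvdn_divisors // => nN.
apply: low_coefs_prod => m; rewrite mem_index_iota => /andP[m0 _].
by apply: low_coefs_factor; rewrite ?muln_gt0 ?m0 ?(dvdn_gt0 N0 nN).
Qed.

Lemma poly_split0 (p : {poly C}) : exists u : {poly C}, p = (p`_0)%:P + 'X * u.
Proof.
have : root (p - (p`_0)%:P) 0 by rewrite rootE hornerD hornerN hornerC horner_coef0 subrr.
move=> /factor_theorem [u Eu]; exists u.
by rewrite mulrC -['X]subr0 -Eu addrC subrK.
Qed.

Lemma small_poly_coef0 (p : {poly C}) (K rho : R) : 0 < rho ->
  (forall s : R, 0 < s -> s < rho -> cabs p.[s%:C] <= K * s) -> p`_0 = 0.
Proof.
move=> r0 H; have [u Eu] := poly_split0 p; set B := poly_bound u.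
have B0 : 0 <= B := poly_bound_ge0 u.
apply/eqP; rewrite -cabs_eq0; apply: contraT => n0.
have c0 : 0 < cabs p`_0 by rewrite lt_def n0 cabs_ge0.
pose M := `|K| + B + 1; have M0 : 0 < M by rewrite /M; have := normr_ge0 K; lra.
(* At this s, (|K| + B + 1) s is below |p_0|, whereas p_0 = p(s) - s u(s) is bounded by (|K| + B)
   s. *)
pose s := Num.min (Num.min rho 1) (cabs p`_0 / M) / 2.
have m0 : 0 < Num.min (Num.min rho 1) (cabs p`_0 / M) by rewrite !lt_min r0 ltr01 divr_gt0.
have s0 : 0 < s by rewrite /s; lra.
have : s < Num.min (Num.min rho 1) (cabs p`_0 / M) by rewrite /s; lra.
rewrite !lt_min => /andP[/andP[sr s1]]; rewrite ltr_pdivlMr // => sM.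
have Hs := H s s0 sr.
have us : cabs u.[s%:C] <= B.
  by apply: horner_le_bound; rewrite cabs_real ger0_norm ltW.
have : cabs p`_0 <= cabs p.[s%:C] + s * B.
  have -> : p`_0 = p.[s%:C] - s%:C * u.[s%:C].
    by rewrite {2}Eu hornerD hornerC hornerM hornerX; ring.
  apply: le_trans (cabsB _ _) _; rewrite lerD2l cabsM cabs_real ger0_norm ?(ltW s0) //.
  by rewrite ler_wpM2l // ltW.
have : K * s <= `|K| * s by rewrite ler_wpM2r ?(ltW s0) // ler_norm.
by move: sM; rewrite /M; nra.
Qed.

(* It suffices to test the size of a polynomial near [0] on positive reals. *)
Lemma small_poly_coef (l : nat) (p : {poly C}) (K rho : R) : 0 < rho ->
  (forall s : R, 0 < s -> s < rho -> cabs p.[s%:C] <= K * s ^+ l.+1) ->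
  forall i, (i <= l)%N -> p`_i = 0.
Proof.
move=> r0; elim: l p => [|l IH] p H.
  by move=> i; rewrite leqn0 => /eqP ->; apply: (small_poly_coef0 p K rho).
have p0 : p`_0 = 0.
  apply: (small_poly_coef0 p `|K| (Num.min rho 1)); first by rewrite lt_min r0 ltr01.
  move=> s s0; rewrite lt_min => /andP[sr s1]; apply: le_trans (H s s0 sr) _.
  apply: (@le_trans _ _ (`|K| * s ^+ l.+2)); first by rewrite ler_wpM2r ?exprn_ge0 ?(ltW s0) // ler_norm.
  by rewrite ler_wpM2l // exprS -[X in _ <= X]mulr1 ler_wpM2l ?(ltW s0) // exprn_ile1 // ltW.
have [u Eu] := poly_split0 p; rewrite p0 add0r in Eu.
have Hu : forall i, (i <= l)%N -> u`_i = 0.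
  apply: IH => s s0 sr; have := H s s0 sr.
  rewrite Eu hornerM hornerX cabsM cabs_real ger0_norm ?(ltW s0) // exprS mulrCA.
  by rewrite ler_pM2l.
by case=> [|i] // il; rewrite Eu coefXM; apply: Hu.
Qed.

(** * Fractional linear substitutions *)

Lemma holo_H_ext (f g : C -> C) :
  (forall t, 0 < complex.Im t -> f t = g t) -> holo_H f -> holo_H g.
Proof.
move=> fg hf t t0; have [L HL] := hf t t0; exists L => eps e0.
have [del [d0 Hd]] := HL eps e0.
(* A radius below Im t keeps t + h in the upper half-plane, where f and g agree. *)
exists (Num.min del (complex.Im t)); split; first by rewrite lt_min d0.
move=> h h0; rewrite lt_min => /andP[hd ht]; rewrite -!fg //; first exact: Hd.
have := (cabs_ReIm h).2; rewrite ler_norml => /andP[h1 _].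
by move: h1 ht; case: (t) (h) => [a b] [c d] /=; lra.
Qed.

Lemma holo_H_0 : holo_H (fun _ => 0).
Proof.
move=> t _; exists 0 => eps e0; exists 1; split=> // h _ _.
by rewrite subrr mul0r subrr cabs0.
Qed.

Lemma holo_HD (f g : C -> C) : holo_H f -> holo_H g -> holo_H (fun t => f t + g t).
Proof.
move=> hf hg t t0; have [L HL] := hf t t0; have [L' HL'] := hg t t0.
exists (L + L') => eps e0; have e2 : 0 < eps / 2 by lra.
have [del [d0 Hd]] := HL _ e2; have [del' [d0' Hd']] := HL' _ e2.
exists (Num.min del del'); split; first by rewrite lt_min d0.
move=> h h0; rewrite lt_min => /andP[hd hd'].
have -> : (f (t + h) + g (t + h) - (f t + g t)) / h - (L + L') =
   ((f (t + h) - f t) / h - L) + ((g (t + h) - g t) / h - L') by field.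
apply: le_lt_trans (cabsD _ _) _; have := Hd h h0 hd; have := Hd' h h0 hd'; lra.
Qed.

Lemma holo_HZ (c : C) (f : C -> C) : holo_H f -> holo_H (fun t => c * f t).
Proof.
move=> hf t t0; have [L HL] := hf t t0; exists (c * L) => eps e0.
have c0 := cabs_ge0 c; have e2 : 0 < eps / (cabs c + 1) by rewrite divr_gt0 //; lra.
have [del [d0 Hd]] := HL _ e2; exists del; split=> // h h0 hd.
have -> : (c * f (t + h) - c * f t) / h - c * L = c * ((f (t + h) - f t) / h - L) by field.
rewrite cabsM; have := Hd h h0 hd; rewrite ltr_pdivlMr; last lra.
have := cabs_ge0 ((f (t + h) - f t) / h - L); nra.
Qed.

Lemma holo_H_sum (T : Type) (s : seq T) (F : T -> C -> C) :
  (forall i, holo_H (F i)) -> holo_H (fun t => \sum_(i <- s) F i t).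
Proof.
move=> H; elim: s => [|i s IH].
  by apply: holo_H_ext holo_H_0 => t _; rewrite big_nil.
by apply: holo_H_ext (holo_HD _ _ (H i) IH) => t _; rewrite big_cons.
Qed.

Lemma Im_affine (x y : R) (t : C) : complex.Im (x%:C * t + y%:C) = x * complex.Im t.
Proof. by case: t => a b; simpc => /=; ring. Qed.

Lemma holo_H_affine (x y : R) (f : C -> C) : 0 < x -> holo_H f ->
  holo_H (fun t => f (x%:C * t + y%:C)).
Proof.
move=> x0 hf t t0; have t0' : 0 < complex.Im (x%:C * t + y%:C) by rewrite Im_affine mulr_gt0.
have [L HL] := hf _ t0'; exists (x%:C * L) => eps e0.
have e2 : 0 < eps / x by rewrite divr_gt0.
have [del [d0 Hd]] := HL _ e2; exists (del / x); split; first by rewrite divr_gt0.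
have xn0 : x%:C != 0 by rewrite -cabs_gt0 cabs_real normr_gt0 gt_eqF.
move=> h h0; rewrite ltr_pdivlMr // => hd.
have h0' : x%:C * h != 0 by rewrite mulf_neq0.
have hd' : cabs (x%:C * h) < del by rewrite cabsM cabs_real ger0_norm ?(ltW x0) // mulrC.
have := Hd _ h0' hd'; rewrite ltr_pdivlMr // => K.
have E : x%:C * (t + h) + y%:C = x%:C * t + y%:C + x%:C * h by ring.
rewrite E; set X := f _ - f _ in K *.
have -> : X / h - x%:C * L = x%:C * (X / (x%:C * h) - L) by field; rewrite h0 xn0.
by rewrite cabsM cabs_real ger0_norm ?(ltW x0) // mulrC.
Qed.

Lemma intC_real (m : int) : (m%:~R : C) = (m%:~R : R)%:C.
Proof. by rewrite rmorph_int. Qed.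

Lemma affine_natE (a d : nat) (b : int) (t : C) : (0 < d)%N ->
  (a%:R * t + b%:~R) / d%:R = (a%:R / d%:R : R)%:C * t + (b%:~R / d%:R : R)%:C.
Proof.
move=> d0; have dn0 : (d%:R : C) != 0 by rewrite pnatr_eq0 -lt0n.
rewrite !rmorphM /= fmorphV /= !rmorph_nat rmorph_int; field.
exact: dn0.
Qed.

Lemma Im_affine_nat (a d : nat) (b : int) (t : C) : (0 < d)%N ->
  complex.Im ((a%:R * t + b%:~R) / d%:R) = a%:R / d%:R * complex.Im t.
Proof. by move=> d0; rewrite affine_natE // Im_affine. Qed.

Lemma Im_affine_gt0 (a d : nat) (b : int) (t : C) : (0 < a)%N -> (0 < d)%N ->
  0 < complex.Im t -> 0 < complex.Im ((a%:R * t + b%:~R) / d%:R).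
Proof.
by move=> a0 d0 t0; rewrite Im_affine_nat // mulr_gt0 // divr_gt0 // ltr0n.
Qed.

Lemma mob_denom_neq0 (c d : int) (t : C) : 0 < complex.Im t -> (c != 0) || (d != 0) ->
  c%:~R * t + d%:~R != 0.
Proof.
move=> t0 cd; apply/eqP => E.
have I0 : complex.Im (c%:~R * t + d%:~R) = 0 by rewrite E.
have R0 : complex.Re (c%:~R * t + d%:~R) = 0 by rewrite E.
move: I0 R0; rewrite !intC_real Im_affine => /eqP; rewrite mulf_eq0 (gt_eqF t0) orbF intr_eq0 => /eqP c0.
rewrite c0 mul0r add0r /= => /eqP; rewrite intr_eq0 => /eqP d0.
by move: cd; rewrite c0 d0 eqxx.
Qed.

Lemma det_nz (a b c d : int) : a * d - b * c = 1 -> (c != 0) || (d != 0).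
Proof.
move=> det; have [c0|//] := eqVneq c 0; have [d0|//] := eqVneq d 0.
by move: det; rewrite c0 d0 !mulr0 subr0.
Qed.

(* [(a b; 0 d) gamma = gamma' (a' b'; 0 d')], with entries [A B G D] of [gamma]
   and [A' B' G' D'] of [gamma']. *)
Definition tri_rel (a b d A B G D A' B' G' D' a' b' d' : int) : Prop :=
  [/\ a * A + b * G = A' * a', a * B + b * D = A' * b' + B' * d',
      d * G = G' * a' & d * D = G' * b' + D' * d'].

(** The lower row of the common product of matrices, read in two ways, gives d (G t + D) = d' (G' t'
    + D'). *)
Lemma tri_mob (a d a' d' : nat) (b b' A B G D A' B' G' D' : int) (t : C) :
  (0 < a)%N -> (0 < d)%N -> (0 < a')%N -> (0 < d')%N ->
  tri_rel a b d A B G D A' B' G' D' a' b' d' ->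
  A * D - B * G = 1 -> A' * D' - B' * G' = 1 -> 0 < complex.Im t ->
  let t' := (a'%:R * t + b'%:~R) / d'%:R in
  (a%:R * mob A B G D t + b%:~R) / d%:R = mob A' B' G' D' t' /\
  G'%:~R * t' + D'%:~R = (d%:R / d'%:R) * (G%:~R * t + D%:~R).
Proof.
move=> a0 d0 a0' d0' [e1 e2 e3 e4] det det' t0 t'.
have I' : 0 < complex.Im t' by apply: Im_affine_gt0.
have n0 := mob_denom_neq0 G D t t0 (det_nz _ _ _ _ det).
have n0' := mob_denom_neq0 G' D' t' I' (det_nz _ _ _ _ det').
have dn0 : (d%:R : C) != 0 by rewrite pnatr_eq0 -lt0n.
have dn0' : (d'%:R : C) != 0 by rewrite pnatr_eq0 -lt0n.
have c1 : a%:R * A%:~R + b%:~R * G%:~R = A'%:~R * a'%:R :> C.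
  by rewrite ![_%:R]pmulrn -!intrM -intrD e1.
have c2 : a%:R * B%:~R + b%:~R * D%:~R = A'%:~R * b'%:~R + B'%:~R * d'%:R :> C.
  by rewrite ![_%:R]pmulrn -!intrM -!intrD e2.
have c3 : d%:R * G%:~R = G'%:~R * a'%:R :> C by rewrite ![_%:R]pmulrn -!intrM e3.
have c4 : d%:R * D%:~R = G'%:~R * b'%:~R + D'%:~R * d'%:R :> C.
  by rewrite ![_%:R]pmulrn -!intrM -!intrD e4.
have E : G'%:~R * t' + D'%:~R = (d%:R / d'%:R) * (G%:~R * t + D%:~R).
  transitivity ((G'%:~R * a'%:R * t + (G'%:~R * b'%:~R + D'%:~R * d'%:R)) / d'%:R : C).
    by rewrite /t'; field; exact: dn0'.
  by rewrite -c3 -c4; field; exact: dn0'.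
split=> //; rewrite /mob E.
have -> : A'%:~R * t' + B'%:~R = ((a%:R * A%:~R + b%:~R * G%:~R) * t + (a%:R * B%:~R + b%:~R * D%:~R)) / d'%:R.
  by rewrite c1 c2 /t'; field; exact: dn0'.
by field; rewrite n0 dn0 dn0'.
Qed.

(** Hermite normal form of the product (a b; 0 d) gamma: a' is the gcd of its first column, and that
    column divided by a' is the first column of gamma', completed to determinant 1 by Bezout
    coefficients. *)
Lemma tri_exists (a d : nat) (b A B G D : int) : (0 < a)%N -> (0 < d)%N ->
  A * D - B * G = 1 ->
  exists (a' b' d' : nat) (A' B' G' D' : int),
    [/\ [/\ (0 < a')%N, (0 < d')%N, (b' < d')%N & (a * d = a' * d')%N], A' * D' - B' * G' = 1 &
      tri_rel a b d A B G D A' B' G' D' a' b' d'].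
Proof.
move=> a0 d0 det; set x := a%:Z * A + b * G; set y := d%:Z * G.
have n0 : (x != 0) || (y != 0).
  apply: contraT; rewrite negb_or !negbK => /andP[/eqP x0 /eqP y0].
  have dz : d%:Z != 0 by rewrite eqz_nat -lt0n.
  have az : a%:Z != 0 by rewrite eqz_nat -lt0n.
  have C0 : G = 0 by move/eqP: y0; rewrite mulf_eq0 (negbTE dz) => /eqP.
  have A0 : A = 0 by move/eqP: x0; rewrite /x C0 mulr0 addr0 mulf_eq0 (negbTE az) => /eqP.
  by move: det; rewrite C0 A0 mul0r mulr0 subr0.
pose g := gcdn `|x| `|y|.
have g0 : (0 < g)%N.
  rewrite gcdn_gt0 !absz_gt0; move: n0; case: eqVneq => //=.
have gx : (g%:Z %| x)%Z by rewrite dvdzE /= dvdn_gcdl.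
have gy : (g%:Z %| y)%Z by rewrite dvdzE /= dvdn_gcdr.
have /dvdzP[A' EA] := gx; have /dvdzP[G' EC] := gy.
have gz : g%:Z != 0 by rewrite eqz_nat -lt0n.
have [u [v Euv]] := Bezoutz x y.
have Euv' : u * A' + v * G' = 1.
  apply: (mulIf gz); rewrite mul1r -[RHS]Euv EA EC; ring.
have detxy : x * (d%:Z * D) - (a%:Z * B + b * D) * y = a%:Z * d%:Z.
  transitivity (a%:Z * d%:Z * (A * D - B * G)); [rewrite /x /y; ring | by rewrite det mulr1].
have : (g%:Z %| a%:Z * d%:Z)%Z.
  rewrite -detxy; apply: rpredB; [exact: dvdz_mulr|exact: dvdz_mull].
rewrite -PoszM dvdzE /= => /dvdnP[d' Ed'].
have d0' : (0 < d')%N.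
  by have : (0 < a * d)%N; [rewrite muln_gt0 a0|rewrite Ed' muln_gt0 => /andP[]].
have dz' : d'%:Z != 0 by rewrite eqz_nat -lt0n.
pose beta := u * (a%:Z * B + b * D) + v * (d%:Z * D).
have Ebeta := divz_eq beta d'%:Z; set q := (beta %/ d'%:Z)%Z in Ebeta.
have b0 := modz_ge0 beta dz'; have b1 := ltz_mod beta dz'.
have Eb' : (beta %% d'%:Z)%Z = `|(beta %% d'%:Z)%Z|%N%:Z by rewrite gez0_abs.
set b' := `|(beta %% d'%:Z)%Z|%N in Eb'.
(* The second column of gamma' is (-v, u) plus q times the first; this translation reduces the upper
   right entry [beta] to b' in [0, d'). *)
exists g, b', d', A', (A' * q - v), G', (G' * q + u).
have gd : g%:Z * d'%:Z = a%:Z * d%:Z by rewrite -!PoszM Ed' mulnC.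
split.
- split=> //; last by rewrite Ed' mulnC.
  by rewrite -ltz_nat -Eb' (lt_le_trans b1).
- by transitivity (u * A' + v * G'); [ring|].
have key : g%:Z * (d'%:Z) = A' * g%:Z * (d%:Z * D) - (a%:Z * B + b * D) * (G' * g%:Z).
  by rewrite -EA -EC detxy gd.
have key' : d'%:Z = A' * (d%:Z * D) - (a%:Z * B + b * D) * G'.
  by apply: (mulfI gz); rewrite key; ring.
split.
- by rewrite -/x EA.
- transitivity (A' * (q * d'%:Z + b'%:Z) - v * d'%:Z); last ring.
  rewrite -Eb' -Ebeta key' /beta.
  transitivity ((a%:Z * B + b * D) * (u * A' + v * G')); [by rewrite Euv' mulr1|ring].
- by rewrite -/y EC.
transitivity (G' * (q * d'%:Z + b'%:Z) + u * d'%:Z); last ring.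
rewrite -Eb' -Ebeta key' /beta.
transitivity ((d%:Z * D) * (u * A' + v * G')); [by rewrite Euv' mulr1|ring].
Qed.

(** Even powers of [psqrt] are powers of its argument, and it vanishes only at 0: nothing more is
    used about the choice of the root. *)
Lemma psqrt_sqr (z : C) : psqrt z ^+ 2 = z.
Proof.
have [hr _] := cabs_ReIm z; move: hr; rewrite ler_norml => /andP[h1 h2].
have p0 : 0 <= (cabs z + complex.Re z) / 2 by lra.
have m0 : 0 <= (cabs z - complex.Re z) / 2 by lra.
have Ep := sqr_sqrtr p0; have Em := sqr_sqrtr m0.
have Epm : Num.sqrt ((cabs z + complex.Re z) / 2) * Num.sqrt ((cabs z - complex.Re z) / 2) = `|complex.Im z| / 2.
  rewrite -sqrtrM // -[RHS]ger0_norm ?divr_ge0 // -sqrtr_sqr; congr Num.sqrt.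
  have : cabs z ^+ 2 = complex.Re z ^+ 2 + complex.Im z ^+ 2.
    by rewrite sqr_sqrtr // addr_ge0 // sqr_ge0.
  rewrite expr_div_n real_normK ?num_real // => E.
  transitivity ((cabs z ^+ 2 - complex.Re z ^+ 2) / 4); first by field.
  by rewrite E; field.
rewrite /psqrt; set p := Num.sqrt _ in Ep Epm *; set m := Num.sqrt _ in Em Epm *.
clearbody p m.
rewrite expr2; case: z h1 h2 p0 m0 Ep Em Epm => x y /= _ _ _ _ Ep Em Epm.
simpc; congr (_ +i* _).
  have -> : (if 0 <= y then 1 else -1) * m * ((if 0 <= y then 1 else -1) * m) = m ^+ 2.
    by case: ifP => _; ring.
  by rewrite -expr2 Ep Em; field.
have [y0|y0] := leP 0 y.
  by rewrite !mul1r (mulrC m) Epm ger0_norm //; field.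
by rewrite !mulN1r mulrN mulNr (mulrC m) Epm ltr0_norm //; field.
Qed.

(** * The transformation law along diagonal and triangular matrices *)

Definition e24 (P : int) : C := e (P%:~R / 24).

Lemma eD (x y : R) : e (x + y) = e x * e y.
Proof. by rewrite /e rmorphD eCD. Qed.

Lemma e_int (m : int) : e m%:~R = 1.
Proof. by rewrite /e rmorph_int eC_int. Qed.

Lemma e24_mod (P t : int) : e24 (P + 24 * t) = e24 P.
Proof.
rewrite /e24 (_ : (P + 24 * t)%:~R / 24 = P%:~R / 24 + t%:~R); first by rewrite eD e_int mulr1.
by rewrite intrD intrM; field.
Qed.

(** The increment is 0, 12 or -12, and e(12/24) = -1. *)
Lemma e24_sign (P : int) (s s' : int) : s = 1 \/ s = -1 -> s' = 1 \/ s' = -1 ->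
  e24 (P + 6 * (s - s')) = (s * s')%:~R * e24 P.
Proof.
have H : e24 (P + 12) = - e24 P.
  rewrite /e24 (_ : (P + 12)%:~R / 24 = P%:~R / 24 + 1 / 2).
    by rewrite eD e_half mulrN1.
  by rewrite intrD; field.
move=> [] -> [] ->.
- by rewrite subrr mulr0 addr0 !mul1r.
- by rewrite mul1r rmorphN1 mulN1r -H; congr e24.
- rewrite mulr1 rmorphN1 mulN1r -H -(e24_mod _ 1); congr e24; ring.
- by rewrite subrr mulr0 addr0 mulrNN !mul1r.
Qed.

Lemma transf_pos (N : nat) (r : nat -> int) (f : C -> C) (a b : int) (G d : nat) (t : C) :
  transf_law N r f -> (0 < N)%N -> (0 < G)%N -> (0 < d)%N ->
  a * d%:Z - b * (G * N)%N%:Z = 1 -> 0 < complex.Im t ->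
  psqrt ((G * N)%N%:Z%:~R * t + d%:Z%:~R) ^ (- twok N r) * f (mob a b (G * N)%N%:Z d%:Z t)
    = e24 (chexp N r a b G d) * f t.
Proof.
move=> tr N0 G0 d0 det t0; have NG : (N%:Z %| (G * N)%N%:Z)%Z by rewrite dvdzE /= dvdn_mull.
have := tr a b (G * N)%N%:Z d%:Z det NG 1 (or_introl erefl) t t0.
rewrite /chi exp1rz !mul1r => ->; congr (_ * _).
rewrite char_exp_chexp // /e24; congr e.
by rewrite fmorph_div /= ratr_int rmorph_nat.
Qed.

(* Only [a = 1] occurs when [twok] is odd, so the rounding of [twok / 2] is harmless. *)
Definition hweight (N : nat) (r : nat -> int) (l a : nat) : C :=
  (hsign N r l a)%:~R * (a%:R : C) ^ (twok N r %/ 2)%Z.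

(** The law of f at gamma and t, and at gamma' and delta' t, expresses all values through f(t) and
    f(delta' t). In integral weight the automorphy factors leave (d / d')^k = (a' / a)^k,
    compensated by the powers in [hweight], and the characters leave a sign, compensated by
    [hsign]. *)
Lemma diag_arrow_pos (N l : nat) (r : nat -> int) (f : C -> C)
    (a d a' d' G D : nat) (A B A' B' G' D' : int) (t : C) :
  transf_law N r f -> (0 < N)%N -> \sum_(n <- divisors N) n%:Z * r n = 0 ->
  (24%:Z %| cosum N r * (l%:Z - 1))%Z -> odd l || odd N ->
  (0 < l)%N -> (a * d = l)%N -> (a' * d' = l)%N -> coprime N a -> coprime N a' ->
  (odd `|twok N r| -> [/\ a = 1%N, a' = 1%N, odd l & exists s, l = (s * s)%N]) ->
  (0 < G)%N -> (0 < D)%N -> (odd l -> odd D) ->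
  tri_rel a 0 d A B (G * N)%N D A' B' G' D' a' 0 d' -> (N%:Z %| G')%Z ->
  A * D%:Z - B * (G * N)%N%:Z = 1 -> A' * D' - B' * G' = 1 -> 0 < complex.Im t ->
  hweight N r l a * f ((a%:R * mob A B (G * N)%N D t + 0%:~R) / d%:R) * f t =
  hweight N r l a' * f ((a'%:R * t + 0%:~R) / d'%:R) * f (mob A B (G * N)%N D t).
Proof.
move=> tr N0 S2 S1 ol l0 Ead Ead' ca ca' half G0 D0 oD rel NG' det det' t0.
have [a0 d0] : (0 < a)%N /\ (0 < d)%N by apply/andP; rewrite -muln_gt0 Ead.
have [a0' d0'] : (0 < a')%N /\ (0 < d')%N by apply/andP; rewrite -muln_gt0 Ead'.
have [E1 E2] := tri_mob a d a' d' 0 0 _ _ _ _ _ _ _ _ t a0 d0 a0' d0' rel det det' t0.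
have t0' : 0 < complex.Im ((a'%:R * t + 0%:~R) / d'%:R) by apply: Im_affine_gt0.
have [r1 r2 r3 r4] := rel; rewrite ?mul0r ?mulr0 ?addr0 ?add0r in r1 r2 r3 r4.
(* The relations d G = G' a' and d D = D' d' make the lower row of gamma' positive too, so that
   [transf_pos] applies to it. *)
have [G2 EG2] : exists G2 : nat, G' = (G2 * N)%N%:Z.
  have /dvdzP[q Eq] := NG'; have q0 : 0 <= q.
    have : 0 <= G' * a'%:Z by rewrite -r3.
    by rewrite Eq pmulr_lge0 ?ltz_nat // pmulr_lge0 ?ltz_nat.
  by exists `|q|%N; rewrite Eq PoszM gez0_abs.
have [D2 ED2] : exists D2 : nat, D' = D2%:Z.
  have q0 : 0 <= D' by have : 0 <= D' * d'%:Z by [rewrite -r4]; rewrite pmulr_lge0 ?ltz_nat.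
  by exists `|D'|%N; rewrite gez0_abs.
rewrite {NG'}EG2 {}ED2 in r3 r4 det' E1 E2 *.
have r3' : (d * G = G2 * a')%N.
  have : (d * (G * N) = G2 * N * a')%N by apply/eqP; rewrite -eqz_nat !PoszM -PoszM r3 !PoszM.
  by rewrite mulnA [(G2 * N * a')%N]mulnAC => /eqP; rewrite eqn_pmul2r // => /eqP.
have r4' : (d * D = D2 * d')%N by apply/eqP; rewrite -eqz_nat !PoszM r4.
have G20 : (0 < G2)%N by case: (G2) r3' => //; rewrite mul0n => /eqP; rewrite muln_eq0 !eqn0Ngt d0 G0.
have D20 : (0 < D2)%N by case: (D2) r4' => //; rewrite mul0n => /eqP; rewrite muln_eq0 !eqn0Ngt d0 D0.
have F1 := transf_pos N r f A B G D t tr N0 G0 D0 det t0.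
have F2 := transf_pos N r f A' B' G2 D2 _ tr N0 G20 D20 det' t0'.
rewrite -E1 E2 in F2.
set z := (G * N)%N%:~R * t + D%:~R in F1 F2.
have zn0 : z != 0 by apply: mob_denom_neq0 => //; apply: det_nz det.
move: F1 F2; set ft := f t; set fm := f (mob _ _ _ _ t); set f2 := f (_ / d%:R); set f3 := f (_ / d'%:R).
clearbody ft fm f2 f3 => F1 F2.
have pn0 w : w != 0 -> psqrt w != 0.
  by move=> w0; apply: contra w0 => /eqP p0; rewrite -(psqrt_sqr w) p0 expr0n.
(* In half-integral weight a = a' = 1 and d = d' = l: both factors c t + d coincide, and the same
   power of [psqrt] cancels. *)
case ek : (odd `|twok N r|) half => half.
  have [Ea Ea' oddl [s Es]] := half isT.
  rewrite Ea mul1n in Ead; rewrite Ea' mul1n in Ead'.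
  rewrite {}Ea {}Ea' {}Ead {}Ead' in F1 F2 r1 r2 r3' r4' *.
  have s0 : (0 < s)%N by case: (s) Es l0 => //; rewrite mul0n => ->.
  have EG : G2 = (s * s * G)%N by rewrite -Es r3' muln1.
  have ED : D2 = D by apply/eqP; rewrite -(eqn_pmul2r l0) -r4' mulnC.
  have EA : A' = A by rewrite -[LHS]mulr1 -r1 mul1r.
  have ln0 : (l%:R : C) != 0 by rewrite pnatr_eq0 -lt0n.
  rewrite divff // mul1r EG ED EA in F2; rewrite EG ED EA in det'.
  have S1' : (24%:Z %| cosum N r * ((s * s)%N%:Z - 1))%Z by rewrite -Es.
  have [q Eq] := chexp_square N r s A B B' G D N0 G0 s0 det det' S2 S1' (oD oddl).
  rewrite Eq e24_mod in F2.
  have pz : psqrt z ^ (- twok N r) != 0 by apply/expfz_neq0/pn0.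
  apply: (mulfI pz); move: F1 F2; set pk := psqrt z ^ _ => F1 F2.
  transitivity (hweight N r l 1 * (pk * f2) * ft); first by ring.
  rewrite F2; transitivity (hweight N r l 1 * f3 * (pk * fm)); last by ring.
  by rewrite F1; ring.
have Ek : - twok N r = 2 * (- (twok N r %/ 2)%Z) by move: ek; lia.
set k := (twok N r %/ 2)%Z in Ek.
have P2 w : psqrt w ^ (- twok N r) = (w ^ k)^-1.
  by rewrite Ek -exprz_exp -[psqrt w ^ 2]/(psqrt w ^+ 2) psqrt_sqr invr_expz.
have zk0 : z ^ k != 0 by apply: expfz_neq0.
have dn0 : (d%:R : C) != 0 by rewrite pnatr_eq0 -lt0n.
have dn0' : (d'%:R : C) != 0 by rewrite pnatr_eq0 -lt0n.
have an0 : (a%:R : C) != 0 by rewrite pnatr_eq0 -lt0n.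
have Dk0 : (d%:R / d'%:R : C) ^ k != 0 by rewrite expfz_neq0 // mulf_neq0 // invr_neq0.
rewrite !P2 expfzMl in F1 F2.
have {}F1 : fm = z ^ k * (e24 (chexp N r A B G D) * ft) by rewrite -F1 mulVKf.
have {}F2 : f2 = ((d%:R / d'%:R) ^ k * z ^ k) * (e24 (chexp N r A' B' G2 D2) * f3).
  by rewrite -F2 mulVKf // mulf_neq0.
(* [a = x u] and [a' = y u] with [x], [y] coprime; then [d = y v] and [d' = x v]. *)
pose u := gcdn a a'; have u0 : (0 < u)%N by rewrite gcdn_gt0 a0.
have /dvdnP[x Ex] : (u %| a)%N := dvdn_gcdl _ _.
have /dvdnP[y Ey] : (u %| a')%N := dvdn_gcdr _ _.
have cxy : coprime x y.
  by rewrite /coprime -(eqn_pmul2r u0) muln_gcdl -Ex -Ey mul1n.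
have Exy : (x * d = y * d')%N.
  by apply/eqP; rewrite -(eqn_pmul2r u0) mulnAC -Ex Ead mulnAC -Ey Ead'.
have y0 : (0 < y)%N by move: a0'; rewrite Ey muln_gt0 => /andP[].
have x0 : (0 < x)%N by move: a0; rewrite Ex muln_gt0 => /andP[].
have /dvdnP[v Ev] : (y %| d)%N.
  by rewrite -(Gauss_dvdr d (_ : coprime y x)) 1?coprime_sym // Exy dvdn_mulr.
have Ev' : d' = (v * x)%N.
  by apply/eqP; rewrite -(eqn_pmul2l y0) -Exy Ev; apply/eqP; ring.
have cx : coprime N x by move: ca; rewrite Ex coprimeMr => /andP[].
have cy : coprime N y by move: ca'; rewrite Ey coprimeMr => /andP[].
have cu : coprime N u by move: ca; rewrite Ex coprimeMr => /andP[].
have El : l = (u * x * y * v)%N by rewrite -Ead Ex Ev; ring.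
have uz : u%:Z != 0 by rewrite eqz_nat -lt0n.
have Exa : x%:Z * A = y%:Z * A'.
  by apply: (mulIf uz); rewrite mulrAC -PoszM -Ex r1 Ey PoszM; ring.
have Evc : (v * G = u * G2)%N.
  apply/eqP; rewrite -(eqn_pmul2l y0); apply/eqP.
  by transitivity (d * G)%N; [rewrite Ev; ring | rewrite r3' Ey; ring].
have v0 : (0 < v)%N by move: d0; rewrite Ev muln_gt0 => /andP[].
have Eyd : (y * D = x * D2)%N.
  apply/eqP; rewrite -(eqn_pmul2l v0); apply/eqP.
  by transitivity (d * D)%N; [rewrite Ev; ring | rewrite r4' Ev'; ring].
have [hm [q Eq]] := chexp_hecke N r l u x y v A B A' B' G G2 D D2 N0 G0 D0 G20 D20 det det' S2 S1 El cx cy Exa Evc Eyd (negbT ek) ol oD.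
have opar (p1 p2 : nat) : (odd l -> odd p1 /\ odd p2) -> if odd l then odd p1 && odd p2 else odd N.
  by case: (odd l) ol => /= [_ /(_ isT)[-> ->]|->].
have olu : odd l -> [/\ odd u, odd x, odd y & odd v].
  by rewrite El !oddM => /andP[/andP[/andP[]]].
have hx : hsign N r l a = hsign N r l x * hsign N r l u.
  by rewrite Ex hsignM // opar // => /olu[].
have hy : hsign N r l a' = hsign N r l y * hsign N r l u.
  by rewrite Ey hsignM // opar // => /olu[].
have He : (hsign N r l a)%:~R * e24 (chexp N r A' B' G2 D2) = (hsign N r l a')%:~R * e24 (chexp N r A B G D).
  rewrite Eq e24_mod e24_sign; [|exact: hsign_pm|exact: hsign_pm].
  rewrite mulrA -intrM; congr (_%:~R * _); rewrite hx hy.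
  have sq m : hsign N r l m * hsign N r l m = 1 by case: (hsign_pm N r l m) => ->.
  transitivity (hsign N r l x * hsign N r l u * (hsign N r l D * (hsign N r l x * hsign N r l D2)) * hsign N r l x * (hsign N r l x * hsign N r l x)).
    rewrite !sq mulr1; transitivity (hsign N r l u * (hsign N r l x * hsign N r l x) * (hsign N r l x * (hsign N r l D * hsign N r l D2))); last ring.
    by rewrite sq mulr1; ring.
  rewrite sq mulr1 -hm.
  transitivity (hsign N r l y * hsign N r l u * (hsign N r l x * hsign N r l x) * (hsign N r l D * hsign N r l D)); first ring.
  by rewrite !sq !mulr1.
have Hk : (a%:R : C) ^ k * (d%:R / d'%:R) ^ k = (a'%:R : C) ^ k.
  rewrite -expfzMl; congr (_ ^ _); rewrite mulrA -natrM Ead -Ead' natrM mulfK //.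
rewrite F1 F2 /hweight -/k -Hk.
set ak := _ ^ k; set dk := (_ / _) ^ k; set zk := z ^ k; set E := e24 _ in He *; set E' := e24 _ in He *.
transitivity ((hsign N r l a)%:~R * E * (ak * dk) * zk * f3 * ft); first by ring.
by rewrite He; ring.
Qed.

Lemma mobN (A B G D : int) (t : C) : mob (- A) (- B) (- G) (- D) t = mob A B G D t.
Proof. by rewrite /mob !rmorphN /= !mulNr -!opprD invrN mulrNN. Qed.

Lemma tri_relN (a b d A B G D A' B' G' D' a' b' d' : int) :
  tri_rel a b d A B G D A' B' G' D' a' b' d' ->
  tri_rel a b d (- A) (- B) (- G) (- D) (- A') (- B') (- G') (- D') a' b' d'.
Proof.
by case=> r1 r2 r3 r4; split; rewrite !mulrN !mulNr -?opprD ?r1 ?r2 ?r3 ?r4.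
Qed.

(** What is needed of f, N and l for the operator to preserve M_k. In half-integral weight the last
    clause leaves a = 1 only. *)
Definition hecke_hyps (N l : nat) (r : nat -> int) (f : C -> C) : Prop :=
  [/\ [/\ transf_law N r f, forall t (m : int), f (t + m%:~R) = f t &
       forall t, 0 < complex.Im t -> f t != 0],
      [/\ (0 < N)%N, (0 < l)%N & \sum_(n <- divisors N) n%:Z * r n = 0],
      (24%:Z %| cosum N r * (l%:Z - 1))%Z, odd l || odd N &
      odd `|twok N r| -> [/\ odd l, exists s, l = (s * s)%N &
        forall a, (a %| l)%N -> coprime N a -> a = 1%N]].

(* Replacing [gamma] by [- gamma] makes [G] nonnegative, and translating [t] by
   multiples of [d'] makes [D] positive, and odd if [l] is odd. *)
Lemma diag_arrow (N l : nat) (r : nat -> int) (f : C -> C)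
    (a d a' d' : nat) (A B G D A' B' G' D' : int) (t : C) :
  hecke_hyps N l r f -> (a * d = l)%N -> (a' * d' = l)%N -> coprime N a -> coprime N a' ->
  tri_rel a 0 d A B G D A' B' G' D' a' 0 d' -> (N%:Z %| G)%Z -> (N%:Z %| G')%Z ->
  A * D - B * G = 1 -> A' * D' - B' * G' = 1 -> 0 < complex.Im t ->
  hweight N r l a * f ((a%:R * mob A B G D t + 0%:~R) / d%:R) * f t =
  hweight N r l a' * f ((a'%:R * t + 0%:~R) / d'%:R) * f (mob A B G D t).
Proof.
move=> [[tr fT f0] [N0 l0 S2] S1 ol half] Ead Ead' ca ca' rel NG NG' det det' t0.
have half' : odd `|twok N r| -> [/\ a = 1%N, a' = 1%N, odd l & exists s, l = (s * s)%N].
  move=> /half [h1 h2 h3]; split=> //; apply: h3 => //.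
    by rewrite -Ead dvdn_mulr.
  by rewrite -Ead' dvdn_mulr.
have [a0 d0] : (0 < a)%N /\ (0 < d)%N by apply/andP; rewrite -muln_gt0 Ead.
have [a0' d0'] : (0 < a')%N /\ (0 < d')%N by apply/andP; rewrite -muln_gt0 Ead'.
have dn0 : (d%:R : C) != 0 by rewrite pnatr_eq0 -lt0n.
have dn0' : (d'%:R : C) != 0 by rewrite pnatr_eq0 -lt0n.
wlog Gge : A B G D A' B' G' D' rel NG NG' det det' / 0 <= G.
  move=> W; have [|Gneg] := leP 0 G; first by move=> Gp; exact: (W A B G D A' B' G' D' rel NG NG' det det' Gp).
  rewrite -(mobN A B G D t); apply: (W (- A) (- B) (- G) (- D) (- A') (- B') (- G') (- D')).
  - exact: tri_relN.
  - by rewrite dvdzE abszN -dvdzE.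
  - by rewrite dvdzE abszN -dvdzE.
  - by rewrite !mulrNN.
  - by rewrite !mulrNN.
  - by rewrite oppr_ge0 ltW.
have [r1 r2 r3 r4] := rel; rewrite ?mul0r ?mulr0 ?addr0 ?add0r in r1 r2 r3 r4.
have az : a%:Z != 0 by rewrite eqz_nat -lt0n.
(* If G = 0, gamma and gamma' are translations up to sign, a = a' and d = d', and periodicity of f
   suffices. *)
have [G0|Gn0] := eqVneq G 0.
  have az' : a'%:Z != 0 by rewrite eqz_nat -lt0n.
  have G0' : G' = 0.
    by move/eqP: r3; rewrite G0 mulr0 eq_sym mulf_eq0 (negbTE az') orbF => /eqP.
  rewrite G0 mulr0 subr0 in det; rewrite G0' mulr0 subr0 in det'.
  have AD (p q : int) : p * q = 1 -> p = q /\ (p = 1 \/ p = -1).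
    move=> pq; have := congr1 absz pq; rewrite abszM => /eqP; rewrite muln_eq1 => /andP[/eqP hp _].
    have hp' : p = 1 \/ p = -1 by lia.
    by case: hp' pq => ->; rewrite ?mul1r ?mulN1r => Eq; split; lia.
  have [DA A1] := AD _ _ det; have [DA' A1'] := AD _ _ det'.
  have Eaa : a = a'.
    by move: r1; case: A1 => ->; case: A1' => ->; lia.
  have Edd : d = d' by apply/eqP; rewrite -(eqn_pmul2l a0) Ead Eaa Ead'.
  have An0 : (A%:~R : C) != 0 by rewrite intr_eq0; case: A1 => ->.
  have AAR : (A%:~R : C) * A%:~R = 1 by rewrite -intrM {2}DA det.
  have AVE : (A%:~R : C)^-1 = A%:~R by apply: (mulfI An0); rewrite divff // AAR.
  have Em : mob A B G D t = t + (A * B)%:~R.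
    rewrite /mob G0 rmorph0 mul0r add0r -DA AVE intrM.
    transitivity (A%:~R * A%:~R * t + A%:~R * B%:~R : C); first by ring.
    by rewrite AAR mul1r.
  rewrite -Eaa -Edd in r2 *.
  have -> : (a%:R * mob A B G D t + 0%:~R) / d%:R = (a%:R * t + 0%:~R) / d%:R + (A * B')%:~R.
    have c2 : a%:R * B%:~R = B'%:~R * d%:R :> C by rewrite ![_%:R]pmulrn -!intrM r2.
    rewrite Em !intrM; transitivity ((a%:R * t + 0 + A%:~R * (a%:R * B%:~R)) / d%:R : C); first by field.
    by rewrite c2; field.
  by rewrite Em !fT; ring.
have Gpos : 0 < G by rewrite lt_def Gn0 Gge.
have [G1 EG1] : exists G1 : nat, G = (G1 * N)%N%:Z.
  have /dvdzP[q Eq] := NG; have q0 : 0 <= q by move: Gge; rewrite Eq pmulr_lge0 ?ltz_nat.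
  by exists `|q|%N; rewrite Eq PoszM gez0_abs.
have G10 : (0 < G1)%N by move: Gpos; rewrite EG1 ltz_nat muln_gt0 => /andP[].
have oGD : ~~ odd `|D| -> odd `|G|.
  move=> oD; case oG: (odd `|G|) => //; exfalso.
  have [D2 ED2] : exists D2, D = 2 * D2 by exists (D %/ 2)%Z; lia.
  have [G2 EG2] : exists G2, G = 2 * G2 by exists (G %/ 2)%Z; lia.
  have : 2 * (A * D2 - B * G2) = 1 by rewrite -[RHS]det ED2 EG2; ring.
  lia.
have [j [jge jodd]] : exists j : nat, 0 < D + d'%:Z * j%:Z * G /\ (odd l -> odd `|D + d'%:Z * j%:Z * G|).
  (* As j0 exceeds |D| and d' G >= 1, the new D is positive. Moreover j0 is odd exactly when D is
     even, and then G is odd, so the new D is odd if d' is. *)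
  pose j0 := ((`|D|.*2).+1 + odd `|D|)%N.
  exists j0; split.
    have : j0%:Z <= d'%:Z * j0%:Z * G.
      have j0p : 0 <= j0%:Z by [].
      have d1 : 1 <= d'%:Z by rewrite lez_nat.
      have dG : 1 <= d'%:Z * G by rewrite -[X in X <= _]mulr1; apply: ler_pM.
      have -> : d'%:Z * j0%:Z * G = j0%:Z * (d'%:Z * G) by ring.
      by rewrite -[X in X <= _]mulr1 ler_wpM2l.
    rewrite /j0; lia.
  rewrite -Ead' oddM => /andP[_ od'].
  have oE : odd `|D + d'%:Z * j0%:Z * G| = odd `|D| (+) (odd j0 && odd `|G|).
    by rewrite odd_abszD !abszM !oddM od'.
  have oj : odd j0 = ~~ odd `|D| by rewrite /j0 oddD /= odd_double; case: (odd `|D|).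
  by rewrite oE oj; case: (boolP (odd `|D|)) => //= /oGD ->.
set D1 := D + _ in jge jodd.
have [D1n ED1] : exists D1n : nat, D1 = D1n%:Z by exists `|D1|%N; rewrite gez0_abs // ltW.
pose B1 := B + d'%:Z * j%:Z * A.
pose B1' := B' + a'%:Z * j%:Z * A'; pose D1' := D' + a'%:Z * j%:Z * G'.
pose t1 := t + (- (d'%:Z * j%:Z))%:~R.
have Em : mob A B1 G D1 t1 = mob A B G D t.
  rewrite /mob; congr (_ / _); rewrite /t1 /B1 /D1 !(intrD, intrM, rmorphN) /=; ring.
have t10 : 0 < complex.Im t1.
  by rewrite /t1 intC_real -{1}[t]mul1r -[1]/(1%:C) Im_affine mul1r.
have E3 : f ((a'%:R * t1 + 0%:~R) / d'%:R) = f ((a'%:R * t + 0%:~R) / d'%:R).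
  rewrite -[RHS](fT _ (- (a'%:Z * j%:Z))); congr f.
  by rewrite /t1 !(intrM, rmorphN) /= -!pmulrn; field.
rewrite -Em -E3 -(fT t (- (d'%:Z * j%:Z))) -/t1.
rewrite ED1 EG1 in Em det jge jodd *.
apply: (@diag_arrow_pos N l r f a d a' d' G1 D1n A B1 A' B1' G' D1') => //.
- split; rewrite ?mul0r ?mulr0 ?addr0 ?add0r //.
  + by rewrite /B1 /B1' mulrDr r2 mulrDl; congr (_ + _); rewrite mulrCA r1; ring.
  + by rewrite -EG1.
  + rewrite -ED1 /D1 /D1' mulrDr r4 mulrDl; congr (_ + _).
    by transitivity (d'%:Z * j%:Z * (d%:Z * G)); [ring|rewrite r3; ring].
- by rewrite -ED1 -EG1 /B1 /D1 -[RHS]det -EG1; ring.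
- by rewrite /B1' /D1' -[RHS]det'; ring.
Qed.

(* As [a] and [d] are coprime, [b = s d + a p], so [(a b; 0 d)] is a diagonal
   matrix between two translations; likewise for [(a' b'; 0 d')]. *)
Lemma hecke_arrow (N l : nat) (r : nat -> int) (f : C -> C)
    (a d a' d' : nat) (b b' A B G D A' B' G' D' : int) (t : C) :
  hecke_hyps N l r f -> (a * d = l)%N -> (a' * d' = l)%N -> coprime N a -> coprime N a' ->
  coprime a d -> coprime a' d' ->
  tri_rel a b d A B G D A' B' G' D' a' b' d' -> (N%:Z %| G)%Z -> (N%:Z %| G')%Z ->
  A * D - B * G = 1 -> A' * D' - B' * G' = 1 -> 0 < complex.Im t ->
  hweight N r l a * f ((a%:R * mob A B G D t + b%:~R) / d%:R) * f t =
  hweight N r l a' * f ((a'%:R * t + b'%:~R) / d'%:R) * f (mob A B G D t).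
Proof.
move=> H Ead Ead' ca ca' cad cad' [r1 r2 r3 r4] NG NG' det det' t0.
have [[tr fT f0] [N0 l0 S2] S1 ol half] := H.
have [a0 d0] : (0 < a)%N /\ (0 < d)%N by apply/andP; rewrite -muln_gt0 Ead.
have [a0' d0'] : (0 < a')%N /\ (0 < d')%N by apply/andP; rewrite -muln_gt0 Ead'.
have dn0 : (d%:R : C) != 0 by rewrite pnatr_eq0 -lt0n.
have dn0' : (d'%:R : C) != 0 by rewrite pnatr_eq0 -lt0n.
have split_b (m n : nat) (c : int) : coprime m n -> exists s p : int, c = s * n%:Z + m%:Z * p.
  move=> cmn; have /coprimezP[[u v] /= E] : coprimez m%:Z n%:Z by [].
  exists (c * v), (c * u); rewrite -[LHS]mulr1 -E; ring.
have [s [p Eb]] := split_b a d b cad; have [s' [p' Eb']] := split_b a' d' b' cad'.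
have zn0 := mob_denom_neq0 G D t t0 (det_nz _ _ _ _ det).
(* With T^n the translation by n, (a b; 0 d) = T^s diag(a, d) T^p; hence gamma becomes T^p gamma
   T^(-p') and gamma' becomes T^(-s) gamma' T^(s'). *)
pose A1 := A + p * G; pose B1 := B + p * D - p' * A1; pose D1 := D - p' * G.
pose A1' := A' - s * G'; pose B1' := B' - s * D' + s' * A1'; pose D1' := D' + s' * G'.
have Em : mob A1 B1 G D1 (t + p'%:~R) = mob A B G D t + p%:~R.
  rewrite /mob.
  have -> : G%:~R * (t + p'%:~R) + D1%:~R = G%:~R * t + D%:~R.
    by rewrite /D1 !(intrD, intrM, rmorphN) /=; ring.
  have -> : A1%:~R * (t + p'%:~R) + B1%:~R = (A%:~R * t + B%:~R) + p%:~R * (G%:~R * t + D%:~R).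
    by rewrite /B1 /A1 !(intrD, intrM, rmorphN) /=; ring.
  by field.
have t1 : 0 < complex.Im (t + p'%:~R).
  by rewrite intC_real -{1}[t]mul1r -[1]/(1%:C) Im_affine mul1r.
have rel1 : tri_rel a 0 d A1 B1 G D1 A1' B1' G' D1' a' 0 d'.
  split; rewrite ?mul0r ?mulr0 ?addr0 ?add0r //.
  - rewrite /A1 /A1'; transitivity (a%:Z * A + (s * d%:Z + a%:Z * p) * G - s * (d%:Z * G)); first by ring.
    by rewrite -Eb r1 r3; ring.
  - rewrite /B1 /B1' /A1 /A1'.
    transitivity ((a%:Z * B + (s * d%:Z + a%:Z * p) * D) - s * (d%:Z * D) 
      - p' * ((a%:Z * A + (s * d%:Z + a%:Z * p) * G) - s * (d%:Z * G))); first by ring.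
    by rewrite -Eb r1 r2 r3 r4 Eb'; ring.
  - rewrite /D1 /D1'; transitivity (d%:Z * D - p' * (d%:Z * G)); first by ring.
    by rewrite r3 r4 Eb'; ring.
have det1 : A1 * D1 - B1 * G = 1 by rewrite -[RHS]det /B1 /D1 /A1; ring.
have det1' : A1' * D1' - B1' * G' = 1 by rewrite -[RHS]det' /B1' /D1' /A1'; ring.
have := diag_arrow N l r f a d a' d' _ _ _ _ _ _ _ _ _ H Ead Ead' ca ca' rel1 NG NG' det1 det1' t1.
rewrite Em !fT.
have -> : f ((a%:R * (mob A B G D t + p%:~R) + 0%:~R) / d%:R) = f ((a%:R * mob A B G D t + b%:~R) / d%:R).
  rewrite -(fT _ s); congr f; rewrite Eb intrD !intrM -!pmulrn; field; exact: dn0.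
have -> // : f ((a'%:R * (t + p'%:~R) + 0%:~R) / d'%:R) = f ((a'%:R * t + b'%:~R) / d'%:R).
rewrite -(fT _ s'); congr f; rewrite Eb' intrD !intrM -!pmulrn; field; exact: dn0'.
Qed.

(** The partner of a term is known only through a relation. A choice of partners is an injection of
    the finite set s into itself, hence a permutation. *)
Lemma sum_matching (T : eqType) (V : nmodType) (s : seq T) (R : T -> T -> Prop) (F G : T -> V) :
  uniq s ->
  (forall p, p \in s -> exists2 p', p' \in s & R p p') ->
  (forall p q p', p \in s -> q \in s -> p' \in s -> R p p' -> R q p' -> p = q) ->
  (forall p p', p \in s -> p' \in s -> R p p' -> F p = G p') ->
  \sum_(p <- s) F p = \sum_(p <- s) G p.
Proof.
move=> us ex inj FG.
pose sg p := ClassicalEpsilon.epsilon (inhabits p) (fun p' => p' \in s /\ R p p').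
have sgP p : p \in s -> sg p \in s /\ R p (sg p).
  move=> ps; apply: (ClassicalEpsilon.epsilon_spec (inhabits p) (fun p' => p' \in s /\ R p p')).
  by have [p' p's Rp] := ex p ps; exists p'.
have sinj : {in s &, injective sg}.
  move=> p q ps qs E; have [ss Rp] := sgP p ps; have [_ Rq] := sgP q qs.
  by apply: (inj p q (sg p)) => //; rewrite E.
have um : uniq (map sg s) by rewrite map_inj_in_uniq.
have sub : {subset map sg s <= s} by move=> _ /mapP[p ps ->]; have [] := sgP p ps.
have [_ Es] := uniq_min_size um sub (eq_leq (esym (size_map sg s))).
rewrite -[RHS](perm_big _ (uniq_perm um us Es)) big_map /=.
rewrite big_seq [RHS]big_seq; apply: eq_bigr => p ps.
by have [ss Rp] := sgP p ps; apply: FG.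
Qed.

(** * The Hecke operator *)

(* [(a, b)] stands for the matrix [(a b; 0 l/a)]. *)
Definition hecke_pairs (N l : nat) : seq (nat * nat) :=
  [seq (a, b) | a <- [seq a <- divisors l | coprime a N], b <- iota 0 (l %/ a)].

Lemma mem_hecke_pairs (N l : nat) (p : nat * nat) : (0 < l)%N ->
  p \in hecke_pairs N l = [&& (p.1 %| l)%N, coprime N p.1 & (p.2 < l %/ p.1)%N].
Proof.
move=> l0; apply/allpairsPdep/idP => [[a [b [+ + ->]]] /=|].
  by rewrite mem_filter mem_iota -dvdn_divisors // => /andP[ca ->]; rewrite coprime_sym ca.
case: p => a b /= /and3P[al ca bl]; exists a, b; split=> //.
  by rewrite mem_filter -dvdn_divisors // al coprime_sym ca.
by rewrite mem_iota.
Qed.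

Lemma uniq_hecke_pairs (N l : nat) : uniq (hecke_pairs N l).
Proof.
apply: allpairs_uniq_dep => [||[a b] [a' b'] _ _ [-> ->]] //.
  by rewrite filter_uniq // divisors_uniq.
by move=> a _; apply: iota_uniq.
Qed.

Definition hecke_term (N l : nat) (r : nat -> int) (f : C -> C) (p : nat * nat) (t : C) : C :=
  hweight N r l p.1 * f ((p.1%:R * t + p.2%:Z%:~R) / (l %/ p.1)%N%:R).

Definition hecke (N l : nat) (r : nat -> int) (f : C -> C) (t : C) : C :=
  \sum_(p <- hecke_pairs N l) hecke_term N l r f p t.

Lemma coprimez_add_mul (n a b q : int) : coprimez n a -> coprimez n (a + b * (q * n)).
Proof.
move=> /coprimezP[[u v] /= E]; apply/coprimezP; exists (u - v * b * q, v) => /=.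
by rewrite -E; ring.
Qed.

(** As N divides G, A is prime to N, and so is A' a' = a A + b G. Then N divides G' a' = d G with a'
    prime to N. *)
Lemma tri_level (N a d : nat) (b A B G D A' B' G' D' : int) (a' b' d' : nat) :
  coprime N a -> A * D - B * G = 1 -> (N%:Z %| G)%Z ->
  tri_rel a b d A B G D A' B' G' D' a' b' d' -> coprime N a' /\ (N%:Z %| G')%Z.
Proof.
move=> ca det /dvdzP[q Eq] [r1 _ r3 _].
have cA : coprimez N%:Z A.
  by apply/coprimezP; exists (- B * q, D); rewrite /= -det Eq; ring.
have : coprimez N%:Z (a%:Z * A) by rewrite coprimezMr cA andbT.
move=> /(coprimez_add_mul _ _ b q); rewrite -Eq r1 coprimezMr => /andP[_ ca'].
split=> //; rewrite dvdzE -(Gauss_dvdl _ (_ : coprime `|N%:Z| `|a'%:Z|)) // -abszM -r3 Eq.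
by rewrite !abszM mulnA dvdn_mull.
Qed.

(** Two triangular matrices with the same partner differ by gamma_1 gamma_2^-1, an upper triangular
    element of SL2(Z) with positive diagonal, hence a translation; the bounds on b1 and b2 make it
    trivial. *)
Lemma tri_inj (a1 d1 a2 d2 a' b' d' b1 b2 : nat)
    (A B G D A1 B1 G1 D1 A2 B2 G2 D2 : int) :
  (0 < a1)%N -> (0 < d1)%N -> (0 < a2)%N -> (0 < d2)%N ->
  (b1 < d1)%N -> (b2 < d2)%N ->
  A * D - B * G = 1 -> A1 * D1 - B1 * G1 = 1 -> A2 * D2 - B2 * G2 = 1 ->
  tri_rel a1 b1 d1 A B G D A1 B1 G1 D1 a' b' d' ->
  tri_rel a2 b2 d2 A B G D A2 B2 G2 D2 a' b' d' ->
  a1 = a2 /\ b1 = b2.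
Proof.
move=> a10 d10 a20 d20 bd1 bd2 det det1 det2 [r1 r2 r3 r4] [s1 s2 s3 s4].
(* [(e11 e12; e21 e22) = (a' b'; 0 d') (A B; G D)^-1] *)
pose e11 := a'%:Z * D - b'%:Z * G; pose e12 := b'%:Z * A - a'%:Z * B.
pose e21 := - d'%:Z * G; pose e22 := d'%:Z * A.
have E (x : int) : x = x * (A * D - B * G) by rewrite det mulr1.
have p1 : a1%:Z = A1 * e11 + B1 * e21.
  transitivity (D * (a1%:Z * A + b1%:Z * G) - G * (a1%:Z * B + b1%:Z * D)).
    by rewrite [LHS]E; ring.
  by rewrite r1 r2 /e11 /e21; ring.
have p2 : b1%:Z = A1 * e12 + B1 * e22.
  transitivity (A * (a1%:Z * B + b1%:Z * D) - B * (a1%:Z * A + b1%:Z * G)).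
    by rewrite [LHS]E; ring.
  by rewrite r1 r2 /e12 /e22; ring.
have p3 : 0 = G1 * e11 + D1 * e21.
  transitivity (D * (d1%:Z * G) - G * (d1%:Z * D)); first by ring.
  by rewrite r3 r4 /e11 /e21; ring.
have p4 : d1%:Z = G1 * e12 + D1 * e22.
  transitivity (A * (d1%:Z * D) - B * (d1%:Z * G)); first by rewrite [LHS]E; ring.
  by rewrite r3 r4 /e12 /e22; ring.
have q1 : a2%:Z = A2 * e11 + B2 * e21.
  transitivity (D * (a2%:Z * A + b2%:Z * G) - G * (a2%:Z * B + b2%:Z * D)).
    by rewrite [LHS]E; ring.
  by rewrite s1 s2 /e11 /e21; ring.
have q2 : b2%:Z = A2 * e12 + B2 * e22.
  transitivity (A * (a2%:Z * B + b2%:Z * D) - B * (a2%:Z * A + b2%:Z * G)).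
    by rewrite [LHS]E; ring.
  by rewrite s1 s2 /e12 /e22; ring.
have q3 : 0 = G2 * e11 + D2 * e21.
  transitivity (D * (d2%:Z * G) - G * (d2%:Z * D)); first by ring.
  by rewrite s3 s4 /e11 /e21; ring.
have q4 : d2%:Z = G2 * e12 + D2 * e22.
  transitivity (A * (d2%:Z * D) - B * (d2%:Z * G)); first by rewrite [LHS]E; ring.
  by rewrite s3 s4 /e12 /e22; ring.
clearbody e11 e12 e21 e22.
have E2 (x : int) : x = x * (A2 * D2 - B2 * G2) by rewrite det2 mulr1.
have f11 : e11 = D2 * a2%:Z.
  rewrite [LHS]E2 q1; transitivity (D2 * (A2 * e11 + B2 * e21) - B2 * (G2 * e11 + D2 * e21)); first by ring.
  by rewrite -q3; ring.
have f21 : e21 = - G2 * a2%:Z.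
  rewrite [LHS]E2 q1; transitivity (A2 * (G2 * e11 + D2 * e21) - G2 * (A2 * e11 + B2 * e21)); first by ring.
  by rewrite -q3; ring.
have f12 : e12 = D2 * b2%:Z - B2 * d2%:Z by rewrite q2 q4 [LHS]E2; ring.
have f22 : e22 = A2 * d2%:Z - G2 * b2%:Z by rewrite q2 q4 [LHS]E2; ring.
have az2 : a2%:Z != 0 by rewrite eqz_nat -lt0n.
have m21 : G1 * D2 - D1 * G2 = 0.
  by apply: (mulIf az2); rewrite mul0r p3 f11 f21; ring.
(* Entries of gamma_1 gamma_2^-1, whose lower left entry has just been shown to vanish. *)
pose m11 := A1 * D2 - B1 * G2; pose m22 := D1 * A2 - G1 * B2; pose m12 := B1 * A2 - A1 * B2.
have g1 : a1%:Z = m11 * a2%:Z by rewrite p1 f11 f21 /m11; ring.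
have g4 : d1%:Z = m22 * d2%:Z.
  rewrite p4 f12 f22 /m22; transitivity ((G1 * D2 - D1 * G2) * b2%:Z + (D1 * A2 - G1 * B2) * d2%:Z); first by ring.
  by rewrite m21 mul0r add0r.
have g2 : b1%:Z = m11 * b2%:Z + m12 * d2%:Z by rewrite p2 f12 f22 /m11 /m12; ring.
have mm : m11 * m22 = 1.
  transitivity ((A1 * D1 - B1 * G1) * (A2 * D2 - B2 * G2) + m12 * (G1 * D2 - D1 * G2)); first by rewrite /m11 /m22 /m12; ring.
  by rewrite det1 det2 m21 mulr0 addr0 mulr1.
have m11p : 0 < m11 by rewrite -(pmulr_lgt0 _ (_ : 0 < a2%:Z)) // -g1.
have m11e : m11 = 1.
  have := congr1 absz mm; rewrite abszM => /eqP; rewrite muln_eq1 => /andP[/eqP h _].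
  by rewrite -[m11]gez0_abs ?h // ltW.
rewrite m11e mul1r in g1; rewrite m11e mul1r in g2.
rewrite m11e mul1r in mm; rewrite mm mul1r in g4.
case: g1 => Ea; case: g4 => Ed; split=> //.
have : m12 = 0.
  have [//|m0] := eqVneq m12 0; exfalso.
  have h : `|b1%:Z - b2%:Z|%N = (`|m12| * d2)%N by rewrite g2 addrAC subrr add0r abszM absz_nat.
  have : (d2 <= `|m12| * d2)%N by rewrite leq_pmull // absz_gt0.
  rewrite -h; rewrite Ed in bd1; clear - bd1 bd2; lia.
by move=> m0; move: g2; rewrite m0 mul0r addr0 => -[].
Qed.

Lemma hecke_equivariant (N l : nat) (r : nat -> int) (f : C -> C) (A B G D : int) (t : C) :
  hecke_hyps N l r f ->
  (forall a, (a %| l)%N -> coprime N a -> coprime a (l %/ a)) ->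
  (N%:Z %| G)%Z -> A * D - B * G = 1 -> 0 < complex.Im t ->
  hecke N l r f (mob A B G D t) * f t = hecke N l r f t * f (mob A B G D t).
Proof.
move=> H cop NG det t0; have [_ [N0 l0 _] _ _ _] := H.
rewrite /hecke !mulr_suml.
pose R (p p' : nat * nat) := exists A' B' G' D' : int,
  [/\ tri_rel p.1 p.2 (l %/ p.1)%N A B G D A' B' G' D' p'.1 p'.2 (l %/ p'.1)%N,
      A' * D' - B' * G' = 1 & (N%:Z %| G')%Z].
have pos a : (a %| l)%N -> (0 < a)%N && (0 < l %/ a)%N.
  by move=> al; rewrite (dvdn_gt0 l0 al) divn_gt0 ?(dvdn_gt0 l0 al) // dvdn_leq.
apply: (@sum_matching _ _ _ R); first exact: uniq_hecke_pairs.
- move=> [a b]; rewrite mem_hecke_pairs //= => /and3P[al ca bl].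
  have /andP[a0 d0] := pos a al.
  have [a' [b' [d' [A' [B' [G' [D' [[a0' d0' bd' ad'] det' rel]]]]]]]] := tri_exists a (l %/ a) b A B G D a0 d0 det.
  have [ca' NG'] := tri_level _ _ _ _ _ _ _ _ _ _ _ _ _ _ _ ca det NG rel.
  have Ed' : (l %/ a' = d')%N by rewrite -(divnK al) mulnC ad' mulKn.
  exists (a', b').
    by rewrite mem_hecke_pairs //= ca' Ed' bd' -(divnK al) mulnC ad' dvdn_mulr.
  by exists A', B', G', D'; rewrite /= Ed'.
- move=> [a1 b1] [a2 b2] [a' b']; rewrite !mem_hecke_pairs //=.
  move=> /and3P[al1 _ bl1] /and3P[al2 _ bl2] _ [A1 [B1 [G1 [D1 [rel1 det1 _]]]]] [A2 [B2 [G2 [D2 [rel2 det2 _]]]]].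
  have /andP[a10 d10] := pos a1 al1; have /andP[a20 d20] := pos a2 al2.
  by have [-> ->] := tri_inj _ _ _ _ _ _ _ _ _ _ _ _ _ _ _ _ _ _ _ _ _ a10 d10 a20 d20 bl1 bl2 det det1 det2 rel1 rel2.
move=> [a b] [a' b']; rewrite !mem_hecke_pairs //=.
move=> /and3P[al ca bl] /and3P[al' ca' bl'] [A' [B' [G' [D' [rel det' NG']]]]].
rewrite /hecke_term /=.
by apply: hecke_arrow rel _ _ _ _ _ => //; rewrite ?cop // mulnC divnK.
Qed.

Lemma Rpower_gt0 (x y : R) : 0 < Rpower.Rpower x y.
Proof. exact: expR_gt0. Qed.

Lemma RpowerM (x y z : R) : 0 < x -> 0 < y ->
  Rpower.Rpower (x * y) z = Rpower.Rpower x z * Rpower.Rpower y z.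
Proof.
by move=> /RltP x0 /RltP y0; rewrite -[RHS]RmultE Rpower.Rpower_mult_distr.
Qed.

Lemma cusp_bounded0 (k : R) : cusp_bounded k (fun _ => 0).
Proof. by move=> a b c d det; exists 0, 0 => t _; rewrite cabs0 mul0r. Qed.

Lemma cusp_boundedD (k : R) (f g : C -> C) :
  cusp_bounded k f -> cusp_bounded k g -> cusp_bounded k (fun t => f t + g t).
Proof.
move=> hf hg a b c d det; have [M [y0 H]] := hf a b c d det.
have [M' [y0' H']] := hg a b c d det; exists (M + M'), (Num.max y0 y0') => t.
rewrite gt_max => /andP[t1 t2]; apply: le_trans (lerD (H t t1) (H' t t2)).
by rewrite -mulrDl ler_wpM2r ?cabsD // ltW // Rpower_gt0.
Qed.

Lemma cusp_boundedZ (k : R) (c0 : C) (f : C -> C) :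
  cusp_bounded k f -> cusp_bounded k (fun t => c0 * f t).
Proof.
move=> hf a b c d det; have [M [y0 H]] := hf a b c d det.
exists (cabs c0 * M), y0 => t t0; rewrite cabsM -mulrA ler_wpM2l ?cabs_ge0 //; exact: H.
Qed.

Lemma cusp_bounded_sum (k : R) (T : eqType) (s : seq T) (F : T -> C -> C) :
  (forall i, i \in s -> cusp_bounded k (F i)) ->
  cusp_bounded k (fun t => \sum_(i <- s) F i t).
Proof.
move=> H; have E (s' : seq T) : {subset s' <= s} ->
    cusp_bounded k (fun t => \sum_(i <- s') F i t).
  elim: s' => [|i s' IH] sub a b c d det.
    have [M [y0 K]] := cusp_bounded0 k a b c d det.
    by exists M, y0 => t t0; rewrite big_nil; exact: K.
  have Hi : cusp_bounded k (F i) by apply/H/sub; rewrite mem_head.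
  have Hs := IH (fun j js => sub j (mem_behead (s := i :: s') js)).
  have [M [y0 K]] := cusp_boundedD k _ _ Hi Hs a b c d det.
  by exists M, y0 => t t0; rewrite big_cons; exact: K.
exact: E.
Qed.

(** By delta gamma = gamma' delta', the growth at the cusp of gamma is that of f at the cusp of
    gamma', with the height rescaled by a' / d' and the automorphy factor by d / d'. *)
Lemma cusp_bounded_affine (k : R) (f : C -> C) (a d : nat) (b : int) :
  (0 < a)%N -> (0 < d)%N -> cusp_bounded k f ->
  cusp_bounded k (fun t => f ((a%:R * t + b%:~R) / d%:R)).
Proof.
move=> a0 d0 hf A B G D det.
have [a' [b' [d' [A' [B' [G' [D' [[a0' d0' bd' ad'] det' rel]]]]]]]] := tri_exists a d b A B G D a0 d0 det.
have [M [y0 H]] := hf A' B' G' D' det'.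
pose c : R := d%:R / d'%:R; have c0 : 0 < c by rewrite divr_gt0 // ltr0n.
pose e0 : R := a'%:R / d'%:R; have e00 : 0 < e0 by rewrite divr_gt0 // ltr0n.
exists (M / Rpower.Rpower c (- k)), (Num.max 0 (y0 / e0)) => t.
rewrite gt_max ltr_pdivrMr // => /andP[t0 ty].
have [E1 E2] := tri_mob a d a' d' b b' A B G D A' B' G' D' t a0 d0 a0' d0' rel det det' t0.
have zn0 := mob_denom_neq0 G D t t0 (det_nz _ _ _ _ det).
have ty' : y0 < complex.Im ((a'%:R * t + b'%:Z%:~R) / d'%:R) by rewrite Im_affine_nat // mulrC.
have := H _ ty'; rewrite E1 E2 cabsM.
have -> : cabs (d%:R / d'%:R) = c by rewrite cabs_div !cabs_nat.
rewrite RpowerM ?cabs_gt0 // => K.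
rewrite ler_pdivlMr; first by apply: le_trans K; rewrite -mulrA [X in _ * X]mulrC.
exact: Rpower_gt0.
Qed.

Lemma hecke_in_M (N l : nat) (r : nat -> int) (f : C -> C) :
  hecke_hyps N l r f ->
  (forall a, (a %| l)%N -> coprime N a -> coprime a (l %/ a)) ->
  in_M N r f -> in_M N r (hecke N l r f).
Proof.
move=> H cop [holf [tr cb]]; have [[_ _ f0] [N0 l0 _] _ _ _] := H.
have pos p : p \in hecke_pairs N l -> (0 < p.1)%N && (0 < l %/ p.1)%N.
  rewrite mem_hecke_pairs // => /and3P[al _ _].
  by rewrite (dvdn_gt0 l0 al) divn_gt0 ?(dvdn_gt0 l0 al) // dvdn_leq.
split; last split.
(* [holo_H_sum] asks for holomorphy at every index, hence the guard: outside the list a or l / a may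
   be 0. *)
- rewrite /hecke; apply: (holo_H_ext (fun t => \sum_(p <- hecke_pairs N l) (if p \in hecke_pairs N l then hecke_term N l r f p t else 0))).
    by move=> t _; rewrite [RHS]big_seq [LHS]big_seq; apply: eq_bigr => p ->.
  apply: (holo_H_sum _ (hecke_pairs N l) (fun p t => if p \in hecke_pairs N l then hecke_term N l r f p t else 0)) => p.
  case: (boolP (p \in hecke_pairs N l)) => [ps|_]; last exact: holo_H_0.
  have /andP[a0 d0] := pos p ps; apply: holo_HZ.
  apply: holo_H_ext (holo_H_affine (p.1%:R / (l %/ p.1)%:R) (p.2%:Z%:~R / (l %/ p.1)%:R) f _ holf).
    by move=> t _; rewrite affine_natE.
  by rewrite divr_gt0 // ltr0n.
- move=> a b c d det Nc eps he t t0; have E := hecke_equivariant N l r f a b c d t H cop Nc det t0.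
  have T := tr a b c d det Nc eps he t t0; apply: (mulIf (f0 t t0)).
  by rewrite -mulrA E mulrCA T mulrCA mulrA.
rewrite /hecke; apply: cusp_bounded_sum => p ps; have /andP[a0 d0] := pos p ps.
by apply: cusp_boundedZ; apply: cusp_bounded_affine.
Qed.

Lemma approxD (l : nat) (F G : C -> C) (p r : {poly C}) :
  approx l F p -> approx l G r -> approx l (fun q => F q + G q) (p + r).
Proof.
move=> [K [rho [K0 r0 r1 H]]] [K' [rho' [K0' r0' r1' H']]].
exists (K + K'), (Num.min rho rho'); split.
- exact: addr_ge0.
- by rewrite lt_min r0.
- by rewrite ge_min r1.
move=> q; rewrite lt_min => /andP[qr qr'].
have -> : F q + G q - (p + r).[q] = (F q - p.[q]) + (G q - r.[q]) by rewrite hornerD; ring.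
apply: le_trans (cabsD _ _) _; rewrite mulrDl; apply: lerD; [exact: H|exact: H'].
Qed.

Lemma approxZ (l : nat) (c : C) (F : C -> C) (p : {poly C}) :
  approx l F p -> approx l (fun q => c * F q) (c *: p).
Proof.
move=> H; rewrite -mul_polyC; apply: approx_ext (approx_mul _ _ _ _ _ (approx_poly l c%:P) H) => q _.
by rewrite hornerC.
Qed.

Lemma approx_sum (T : Type) (s : seq T) (l : nat) (F : T -> C -> C) (p : T -> {poly C}) :
  (forall i, approx l (F i) (p i)) ->
  approx l (fun q => \sum_(i <- s) F i q) (\sum_(i <- s) p i).
Proof.
move=> H; elim: s => [|i s IH].
  by apply: approx_ext (approx_poly l _) => q _; rewrite !big_nil hornerC.
by rewrite big_cons; apply: approx_ext (approxD _ _ _ _ _ (H i) IH) => q _; rewrite big_cons.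
Qed.

Definition poly_rot (z : C) (p : {poly C}) : {poly C} := \poly_(i < size p) (p`_i * z ^+ i).

Lemma coef_poly_rot (z : C) (p : {poly C}) (i : nat) : (poly_rot z p)`_i = p`_i * z ^+ i.
Proof.
rewrite coef_poly; case: ltnP => // le.
by rewrite nth_default // mul0r.
Qed.

Lemma approx_rot (l : nat) (z : C) (F : C -> C) (p : {poly C}) : cabs z = 1 ->
  approx l F p -> approx l (fun q => F (z * q)) (poly_rot z p).
Proof.
move=> z1 [K [rho [K0 r0 r1 H]]]; exists K, rho; split=> // q qr.
have zq : cabs (z * q) = cabs q by rewrite cabsM z1 mul1r.
have -> : (poly_rot z p).[q] = p.[z * q].
  by rewrite horner_poly horner_coef; apply: eq_bigr => i _; rewrite exprMn mulrA.
by have := H (z * q); rewrite zq; apply.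
Qed.

(** * Comparison of coefficients *)

Lemma eC_imag (y : R) : eC (0 +i* y) = (Rtrigo_def.exp (- (2 * Rtrigo1.PI * y)))%:C.
Proof.
have E : (2 * Rtrigo1.PI)%:C * 'i * (0 +i* y) = (- (2 * Rtrigo1.PI * y))%:C.
  by simpc; rewrite ?mul0r ?mulr0 ?oppr0.
by rewrite /eC E /cexp /= Rtrigo_def.cos_0 Rtrigo_def.sin_0; simpc.
Qed.

Lemma expR_lt (x y : R) : x < y -> Rtrigo_def.exp x < Rtrigo_def.exp y.
Proof. by move=> /RltP lt; apply/RltP; apply: Rpower.exp_increasing. Qed.

Lemma expR_ln (s : R) : 0 < s -> Rtrigo_def.exp (Rpower.ln s) = s.
Proof. by move=> /RltP s0; rewrite Rpower.exp_ln. Qed.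

(** The point of the imaginary axis with q = s; positive real values of q suffice as test points. *)
Definition tau (s : R) : C := 0 +i* (- Rpower.ln s / (2 * Rtrigo1.PI)).

Lemma pi2_gt0 : 0 < 2 * Rtrigo1.PI :> R.
Proof. by apply: mulr_gt0 => //; exact: PI_gt0. Qed.

Lemma eC_tau (s : R) : 0 < s -> eC (tau s) = s%:C.
Proof.
move=> s0; rewrite eC_imag; congr (_%:C).
have p0 := pi2_gt0.
by rewrite mulrC divfK ?gt_eqF // opprK expR_ln.
Qed.

Lemma Im_tau (s y : R) : 0 < s -> s < Rtrigo_def.exp (- (2 * Rtrigo1.PI * y)) ->
  y < complex.Im (tau s).
Proof.
move=> s0 sy; rewrite /tau /= ltr_pdivlMr ?pi2_gt0 //.
rewrite ltrNr ltNge; apply/negP.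
rewrite le_eqVlt => /orP[/eqP E|lt].
  by move: sy; rewrite -{1}(expR_ln s s0) -E mulrC ltxx.
have := expR_lt _ _ lt; rewrite expR_ln // mulrC => lt'.
by have := lt_trans sy lt'; rewrite ltxx.
Qed.

Lemma eta_quot_not_cusp (N : nat) (r : nat -> int) : (0 < N)%N ->
  \sum_(n <- divisors N) n%:Z * r n = 0 -> ~ in_S N r (eta_quot N r).
Proof.
move=> N0 S2 [_ [_ cv]].
have [y0 Hy] := cv 1 0 0 1 (erefl _) (1 / 2) ltac:(lra).
have [K [rho [K0 r0 r1 H]]] := eta_fun_approx N r 0 N0.
(* At s = m / 2, |f - 1| <= K s < 1/2, while [tau s] lies above the height y0 beyond which a cusp
   form is below 1/2. *)
pose m := Num.min (Num.min rho (1 / (2 * (K + 1)))) (Num.min (Rtrigo_def.exp (- (2 * Rtrigo1.PI * y0))) (Rtrigo_def.exp (- (2 * Rtrigo1.PI * 0)))).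
have m0 : 0 < m by rewrite !lt_min r0 !expR_gt0 !andbT divr_gt0 //; lra.
have s0 : 0 < m / 2 by lra.
have : m / 2 < m by lra.
rewrite {2}/m !lt_min => /andP[/andP[sr sK] /andP[sy s1]].
set s := m / 2 in s0 sr sK sy s1.
have ty := Im_tau s y0 s0 sy; have t0 := Im_tau s 0 s0 s1.
have := Hy _ ty.
have -> : mob 1 0 0 1 (tau s) = tau s.
  by rewrite /mob rmorph1 rmorph0 mul1r addr0 mul0r add0r divr1.
have -> : cabs (0%:~R * tau s + 1%:~R) = 1 by rewrite rmorph0 rmorph1 mul0r add0r cabs1.
have -> : Rpower.Rpower 1 (- weight N r) = 1.
  by rewrite /Rpower.Rpower Rpower.ln_1 RmultE mulr0 expR0.
rewrite mulr1 (eta_quotE N r _ N0 S2) (eC_tau s s0) => h.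
have cs : cabs s%:C = s by rewrite cabs_real ger0_norm // ltW.
have := H s%:C; rewrite cs => /(_ sr).
have -> : (polyZC (eta_poly N r 0)).[s%:C] = 1.
  have -> : eta_poly N r 0 = 1 by rewrite /eta_poly big1 // => n _; rewrite big_geq.
  have P1 : polyZC 1 = 1 by exact: rmorph1.
  by rewrite P1 hornerC.
rewrite expr1 => h2.
have h3 := cabs_ge_sub 1 (1 - eta_fun N r s%:C).
have e1 : 1 - (1 - eta_fun N r s%:C) = eta_fun N r s%:C by ring.
rewrite e1 cabs1 (cabs_sub 1) in h3.
have : K * s <= (K + 1) * s by rewrite ler_wpM2r ?lerDl // ltW.
move: sK; rewrite ltr_pdivlMr; last lra.
move: h h2 h3; set X := cabs (eta_fun N r s%:C); set Y := cabs (eta_fun N r s%:C - 1); lra.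
Qed.

Lemma hecke_eigen (N l : nat) (r : nat -> int) :
  weakly_admissible N r -> \sum_(n <- divisors N) n%:Z * r n = 0 ->
  hecke_hyps N l r (eta_quot N r) ->
  (forall a, (a %| l)%N -> coprime N a -> coprime a (l %/ a)) ->
  exists lam : C, forall t, 0 < complex.Im t ->
    hecke N l r (eta_quot N r) t = lam * eta_quot N r t.
Proof.
move=> [fM D] S2 H cop; have [[_ _ f0] [N0 l0 _] _ _ _] := H.
have [|[_ [_ /eta_quot_not_cusp]]] := D; last by move=> /(_ N0 S2).
move=> [g0 [_ [_ Hg]]].
have [mu Hmu] := Hg _ fM; have [nu Hnu] := Hg _ (hecke_in_M N l r _ H cop fM).
have i0 : 0 < complex.Im ('i : C) by rewrite /= ltr01.
have mu0 : mu != 0.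
  by apply: contraTneq (f0 _ i0) => E; rewrite (Hmu _ i0) E mul0r eqxx.
exists (nu / mu) => t t0; rewrite (Hnu t t0) (Hmu t t0); field; exact: mu0.
Qed.

(* In terms of [s = e(t / l)], both sides are polynomials up to [O(s^(l+1))]:
   compare the coefficients of [1] and of [s^l]. Only [a = 1] contributes to the
   latter, because [a^2] does not divide [l] for the other [a]. *)
Lemma hecke_coef (N l : nat) (r : nat -> int) (lam : C) :
  (0 < N)%N -> (0 < l)%N -> \sum_(n <- divisors N) n%:Z * r n = 0 ->
  (forall a, (a %| l)%N -> coprime N a -> coprime a (l %/ a)) ->
  (forall t, 0 < complex.Im t -> hecke N l r (eta_quot N r) t = lam * eta_quot N r t) ->
  lam = \sum_(a <- divisors l | coprime a N) (l %/ a)%:R * hweight N r l a /\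
  l%:R * (eta_coef N r l)%:~R * hweight N r l 1 = - (r 1%N)%:~R * lam.
Proof.
move=> N0 l0 S2 cop Heig.
have ap := eta_fun_approx N r l N0; set Q := polyZC (eta_poly N r l) in ap.
have [q0 q1] := eta_poly_low_coefs N l r N0 l0.
have Q0 : Q`_0 = 1 by rewrite coef_map q0 /= mulr1z.
have Q1 : Q`_1 = - (r 1%N)%:~R by rewrite coef_map q1 /= mulrNz.
have Ql : Q`_l = (eta_coef N r l)%:~R by rewrite coef_map.
(* With s = e(t / l) and d = l / a, e((a t + b) / d) = e(b / d) s^(a a), and z is the root of unity
   e(b / d). *)
pose z (p : nat * nat) : C := eC (p.2%:R / (l %/ p.1)%:R : R)%:C.
have z1 p : cabs (z p) = 1.
  by rewrite /z cabs_eC /= mulr0 oppr0 expR0.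
pose P : {poly C} := \sum_(p <- hecke_pairs N l) (if (0 < p.1)%N then hweight N r l p.1 *: (poly_rot (z p) Q \Po 'X^(p.1 * p.1)) else 0)
   + (- lam) *: (Q \Po 'X^l).
have apP : approx l (fun q => \sum_(p <- hecke_pairs N l) (if (0 < p.1)%N then hweight N r l p.1 * eta_fun N r (z p * q ^+ (p.1 * p.1)) else 0)
   + (- lam) * eta_fun N r (q ^+ l)) P.
  apply: approxD; last by apply: approxZ; apply: approx_comp.
  apply: approx_sum => p; case: ifP => p0.
    apply: approxZ; apply: (approx_comp l (p.1 * p.1) (fun q => eta_fun N r (z p * q))); first by rewrite muln_gt0 p0.
    exact: approx_rot.
  by apply: approx_ext (approx_poly l 0) => q _; rewrite hornerC.
have [K [rho [K0 r0 r1 H]]] := apP.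
have ln0 : (l%:R : C) != 0 by rewrite pnatr_eq0 -lt0n.
have Z : forall i, (i <= l)%N -> P`_i = 0.
  apply: (small_poly_coef l P K rho r0) => s s0 sr.
  have s1 : s < 1 by apply: lt_le_trans r1.
  have cs : cabs s%:C = s by rewrite cabs_real ger0_norm // ltW.
  have t0 : 0 < complex.Im (tau s).
    by apply: Im_tau => //; rewrite mulr0 oppr0 expR0.
  pose t := l%:R * tau s; have tp : 0 < complex.Im t by rewrite Im_natr_mul mulr_gt0 // ltr0n.
  have := H s%:C; rewrite cs => /(_ sr); rewrite cabs_sub.
  have -> : \sum_(p <- hecke_pairs N l) (if (0 < p.1)%N then hweight N r l p.1 * eta_fun N r (z p * s%:C ^+ (p.1 * p.1)) else 0)
      = hecke N l r (eta_quot N r) t.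
    rewrite /hecke big_seq [RHS]big_seq; apply: eq_bigr => p.
    rewrite mem_hecke_pairs // => /and3P[al ca bl]; rewrite (dvdn_gt0 l0 al) /hecke_term.
    rewrite (eta_quotE N r _ N0 S2); congr (_ * eta_fun N r _).
    rewrite -(eC_tau s s0) -eCMn /z -eCD; congr eC.
    have dn0 : ((l %/ p.1)%:R : C) != 0.
      by rewrite pnatr_eq0 -lt0n divn_gt0 ?(dvdn_gt0 l0 al) // dvdn_leq.
    rewrite /t -{2}(divnK al) rmorphM fmorphV /= !rmorph_nat !natrM -pmulrn; field.
    exact: dn0.
  have -> : eta_fun N r (s%:C ^+ l) = eta_quot N r t.
    by rewrite (eta_quotE N r t N0 S2) /t eCMn eC_tau.
  by rewrite (Heig t tp) mulNr subrr subr0.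
have cpos p i : p \in hecke_pairs N l ->
    (if (0 < p.1)%N then hweight N r l p.1 *: (poly_rot (z p) Q \Po 'X^(p.1 * p.1)) else 0)`_i
    = if (p.1 * p.1 %| i)%N then hweight N r l p.1 * (Q`_(i %/ (p.1 * p.1)) * z p ^+ (i %/ (p.1 * p.1))) else 0.
  rewrite mem_hecke_pairs // => /and3P[al _ _]; have a0 := dvdn_gt0 l0 al.
  rewrite a0 coefZ coef_comp_poly_Xn ?muln_gt0 ?a0 //; case: ifP => _; last by rewrite mulr0.
  by rewrite coef_poly_rot.
split.
  (* The constant term of f is 1, and each a occurs with l / a values of b. *)
  have := Z 0%N isT; rewrite /P coefD coefZ coef_comp_poly_Xn // dvdn0 div0n Q0 mulr1 => /eqP.
  rewrite subr_eq0 => /eqP <-; rewrite coef_sum.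
  transitivity (\sum_(p <- hecke_pairs N l) hweight N r l p.1).
    rewrite big_seq [RHS]big_seq; apply: eq_bigr => p pS.
    by rewrite cpos // dvdn0 div0n Q0 expr0 !mulr1.
  rewrite big_allpairs_dep /= big_filter; apply: eq_bigr => a _.
  by rewrite big_const_seq count_predT size_iota iter_addr addr0 mulr_natl.
(* On the right, f(t) is a series in s^l, so the coefficient at s^l is that of f at q, namely -
   r_1. *)
have := Z l (leqnn l); rewrite /P coefD coefZ coef_comp_poly_Xn // dvdnn divnn l0 Q1 => /eqP.
rewrite coef_sum mulrNN mulrC addr_eq0 => /eqP E.
rewrite mulNr -E big_seq.
transitivity (\sum_(p <- hecke_pairs N l | p \in hecke_pairs N l) (if p.1 == 1%N then (eta_coef N r l)%:~R * hweight N r l 1 else 0)); last first.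
  apply: eq_bigr => -[a b] pS; rewrite cpos //=.
  move: (pS); rewrite mem_hecke_pairs //= => /and3P[al ca bl].
  case: eqP => [->|a1].
    (* For a = 1 the root of unity enters as e(b / l)^l = 1, so all l values of b contribute
       c_f(l). *)
    rewrite muln1 dvd1n divn1 Ql /z /= -eCMn divn1.
    have -> : l%:R * (b%:R / l%:R : R)%:C = b%:R :> C.
      by rewrite rmorphM fmorphV /= !rmorph_nat mulrCA divff // mulr1.
    by rewrite eC_nat mulr1 mulrC.
  case: ifP => // aal; case: a1; apply/eqP.
  have := cop a al ca; rewrite /coprime; suff -> : gcdn a (l %/ a) = a by [].
  apply/gcdn_idPl; have a0 := dvdn_gt0 l0 al.
  by rewrite -(dvdn_pmul2l a0) [X in (_ %| X)%N]mulnC divnK.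
rewrite -big_seq big_allpairs_dep /= big_filter big_mkcond /=.
rewrite (bigD1_seq 1%N) ?divisors_uniq -?dvdn_divisors ?dvd1n //= coprime1n divn1.
rewrite big_const_seq count_predT size_iota iter_addr addr0 [X in _ + X]big1 ?addr0 => [|a a1].
  by rewrite -[RHS]mulr_natl; ring.
by case: ifP => // _; rewrite big1 // => b _; rewrite (negbTE a1).
Qed.

(** * Evaluation of the weights and the final formula *)

Lemma hsign1 (N : nat) (r : nat -> int) (l : nat) : odd l || odd N -> hsign N r l 1 = 1.
Proof.
move=> ol; have := hsignM N r l 1 1 (coprimen1 N) (coprimen1 N).
have -> : (if odd l then odd 1 && odd 1 else odd N) by case: (odd l) ol.
by move=> /(_ isT); case: (hsign_pm N r l 1) => ->.
Qed.

Lemma hweight1 (N : nat) (r : nat -> int) (l : nat) : odd l || odd N -> hweight N r l 1 = 1.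
Proof. by move=> ol; rewrite /hweight hsign1 // exp1rz mulr1. Qed.

Lemma kronecker1 (w : nat) : kronecker 1 w = 1.
Proof.
rewrite /kronecker big_seq big1 // => p; rewrite mem_primes => /andP[pp _].
rewrite (_ : kron_p 1 p = 1) ?expr1n // /kron_p; case: eqP => // p2.
rewrite dvdn1; have -> : (p == 1)%N = false by apply/eqP => E; rewrite E in pp.
case: existsP => // -[]; exists (Ordinal (prime_gt1 pp)); apply/eqP; by rewrite /= muln1.
Qed.

Lemma e_half_int (m : int) : e (m%:~R / 2) = (-1) ^ m.
Proof.
rewrite -e_half /e -(eCMz m); congr eC.
by rewrite !rmorphM /= rmorph_int mul1r.
Qed.

Lemma signz_odd (m : int) : (-1) ^ m = (-1) ^+ odd `|m| :> C.
Proof.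
case: m => n; first by rewrite -[(-1) ^ n%:Z]/((-1) ^+ n) -signr_odd.
by rewrite NegzE -invr_expz -[(-1) ^ n.+1%:Z]/((-1) ^+ n.+1) -signr_odd abszN absz_nat; case: odd; rewrite ?invrN1 ?invr1.
Qed.

(** Since l - l / a = (l / a) (a - 1) with l / a odd, the exponential is chi4(a)^(k + delta):
    chi4(a)^k is part of [hsign], and chi4(a)^delta is the cost of reciprocity in
    [jac_kronecker]. *)
Lemma hsign_odd (N : nat) (r : nat -> int) (l a : nat) :
  (0 < N)%N -> odd l -> ~~ odd `|twok N r| -> (a %| l)%N -> coprime a N ->
  (hsign N r l a)%:~R = (kronecker a (varpi N r))%:~R *
     e ((weight N r + (delta_of (varpi N r))%:R) * ((l - l %/ a)%N)%:R / 4%:R).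
Proof.
move=> N0 ol ek al caN; have oa : odd a by apply: dvdn_odd al ol.
have cNa : coprime N a by rewrite coprime_sym.
have od : odd (l %/ a) by apply: dvdn_odd (dvdn_div al) ol.
have cw := varpi_coprime N r a cNa.
rewrite /hsign ol jac_kronecker ?varpi_gt0 1?coprime_sym // /chi4 -exprM.
set D := delta_of _; set w := varpi N r; rewrite mulrAC -exprD mulrC intrM; congr (_ * _).
have El : ((l - l %/ a) = (l %/ a) * (a./2 * 2))%N.
  by rewrite -{1}(divnK al) -{2}[(l %/ a)%N]muln1 -mulnBr; congr (_ * _)%N; lia.
have [k Ek] : exists k : int, twok N r = 2 * k by exists ((twok N r) %/ 2)%Z; lia.
have -> : (weight N r + D%:R) * ((l - l %/ a)%N)%:R / 4%:R = (((k + D%:Z) * ((l %/ a)%N * a./2)%N%:Z)%:~R : R) / 2.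
  rewrite /weight Ek El !(intrM, intrD) !natrM -!pmulrn !natrM; by field.
rewrite e_half_int signz_odd rmorphXn /= rmorphN1 -[LHS]signr_odd; congr (_ ^+ nat_of_bool _).
rewrite abszM Ek !absz_nat; have -> : `|2 * k|./2 = `|k|%N by lia.
by rewrite oddM oddD !oddM od odd_abszD absz_nat; case: (odd a./2); case: (odd D); case: (odd `|k|).
Qed.

Lemma Rpower_int (x : R) (m : int) : 0 < x -> Rpower.Rpower x m%:~R = x ^ m.
Proof.
move=> x0; have P (n : nat) : Rpower.Rpower x n%:R = x ^+ n.
  by rewrite /Rpower.Rpower RmultE mulr_natl -expRX expR_ln.
case: m => n; first by rewrite -pmulrn P.
rewrite NegzE rmorphN /= -pmulrn -invr_expz -[x ^ n.+1%:Z]/(x ^+ n.+1) -P.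
have xn0 : Rpower.Rpower x n.+1%:R != 0 by rewrite gt_eqF // Rpower_gt0.
apply: (mulfI xn0); rewrite divff //.
by rewrite /Rpower.Rpower expRD !RmultE RplusE mulNr subrr expR0.
Qed.

(** A common prime factor of a and l / a would divide l twice without dividing N. *)
Lemma prime_sqr_dvd_coprime (N l a : nat) : (0 < l)%N ->
  (forall p : nat, prime p -> ~~ (p %| N)%N -> ~~ (p ^ 2 %| l)%N) ->
  (a %| l)%N -> coprime N a -> coprime a (l %/ a).
Proof.
move=> l0 sqf al ca; have [->|N1] := eqVneq a 1%N; first exact: coprime1n.
apply: contraT => nc; have g1 : (1 < gcdn a (l %/ a))%N.
  have : gcdn a (l %/ a) != 1%N by [].
  by have : (0 < gcdn a (l %/ a))%N; [rewrite gcdn_gt0 (dvdn_gt0 l0 al)|lia].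
have pp := pdiv_prime g1; set p := pdiv _ in pp.
have := pdiv_dvd (gcdn a (l %/ a)); rewrite -/p dvdn_gcd => /andP[pa pd].
have pN : ~~ (p %| N)%N.
  apply/negP => pN; have := dvdn_gcd p N a; rewrite pN pa (eqP ca) dvdn1 => /eqP E.
  by rewrite E in pp.
by have := sqf p pp pN; rewrite -(divnK al) expnS expn1 dvdn_mul.
Qed.

(** Every prime factor of a square divides it twice and therefore divides N. *)
Lemma square_coprime_dvd (N t a : nat) :
  (forall p : nat, prime p -> ~~ (p %| N)%N -> ~~ (p ^ 2 %| t ^ 2)%N) ->
  (0 < t)%N -> (a %| t ^ 2)%N -> coprime N a -> a = 1%N.
Proof.
move=> sqf t0 al ca; apply/eqP; apply: contraT => a1.
have a0 : (0 < a)%N by apply: dvdn_gt0 al; rewrite expn_gt0 t0.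
have pp : prime (pdiv a) by apply: pdiv_prime; lia.
have pN : ~~ (pdiv a %| N)%N.
  apply/negP => pN; have := dvdn_gcd (pdiv a) N a; rewrite pN pdiv_dvd (eqP ca) dvdn1 => /eqP E.
  by rewrite E in pp.
have pt : (pdiv a %| t)%N by have := dvdn_trans (pdiv_dvd a) al; rewrite Euclid_dvdX // => /andP[].
by have := sqf _ pp pN; rewrite dvdn_exp2r.
Qed.

Lemma radical_coprime_dvd (N l a : nat) : (0 < N)%N -> (0 < l)%N ->
  (radical l %| radical N)%N -> (a %| l)%N -> coprime N a -> a = 1%N.
Proof.
move=> N0 l0 rad al ca; apply/eqP; apply: contraT => a1.
have a0 := dvdn_gt0 l0 al.
have pp : prime (pdiv a) by apply: pdiv_prime; lia.
have pl : pdiv a \in primes l by rewrite mem_primes pp l0 (dvdn_trans (pdiv_dvd a) al).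
have : (pdiv a %| radical N)%N.
  apply: dvdn_trans rad; rewrite /radical (bigD1_seq _ pl) ?primes_uniq //=.
  exact: dvdn_mulr.
move=> pr; have pN : (pdiv a %| N)%N.
  apply: contraTT pr => pN; rewrite /radical big_seq.
  apply: (big_ind (fun m => ~~ (pdiv a %| m)%N)) => [|m n pm pn|q].
  - by rewrite dvdn1; apply: contraL pp => /eqP ->.
  - by rewrite Euclid_dvdM // negb_or pm.
  - by rewrite mem_primes => /and3P[_ _ qN]; apply: contra pN => /dvdn_trans; apply.
have := dvdn_gcd (pdiv a) N a; rewrite pdiv_dvd pN (eqP ca) dvdn1 => /eqP E.
by rewrite E in pp.
Qed.

(** With the second sum equal to 0, [m_f] is 24 / gcd(24, [cosum]); multiplication of l - 1 by
    [cosum] supplies the missing factor of 24. *)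
Lemma m_f_dvd (N : nat) (r : nat -> int) (l : nat) : (0 < l)%N ->
  \sum_(n <- divisors N) n%:Z * r n = 0 -> l = 1 %[mod m_f N r] ->
  (24%:Z %| cosum N r * (l%:Z - 1))%Z.
Proof.
move=> l0 S2; rewrite /m_f S2 absz0 gcdn0 -/(cosum N r) => /eqP; rewrite eqn_mod_dvd // => H.
rewrite dvdzE abszM; have -> : `|l%:Z - 1|%N = (l - 1)%N by lia.
set g := gcdn 24 _ in H; have g24 : (g %| 24)%N := dvdn_gcdl _ _.
by rewrite absz_nat -{1}(divnK g24) mulnC dvdn_mul // dvdn_gcdr.
Qed.

(** Dividing l c_f(l) = - r_1 lambda by l turns the factor l / a of lambda into 1 / a, whence the
    exponent k - 1. *)
Lemma eta_coef_formula (N : nat) (r : nat -> int) (l : nat) :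
  is_level N r -> weakly_admissible N r ->
  \sum_(n <- divisors N) n%:Z * r n = 0 -> in_L_f N r l ->
  (forall p : nat, prime p -> ~~ (p %| N)%N -> ~~ (p ^ 2 %| l)%N) ->
  odd l || odd N ->
  (eta_coef N r l)%:~R = - (r 1%N)%:~R *
       \sum_(a <- divisors l | coprime a N) hweight N r l a / a%:R :> C /\
  (odd `|twok N r| -> odd l /\ forall a, (a %| l)%N -> coprime N a -> a = 1%N).
Proof.
move=> [N0 _] adm S2 [l0 [l1 lsq]] sqf ol.
have half : odd `|twok N r| -> [/\ odd l, exists s, l = (s * s)%N &
        forall a, (a %| l)%N -> coprime N a -> a = 1%N].
  move=> /lsq [t Et]; have t0 : (0 < t)%N by case: (t) Et l0 => // ->.
  have h a : (a %| l)%N -> coprime N a -> a = 1%N.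
    by move=> al ca; apply: (square_coprime_dvd N t) => //; rewrite -?Et.
  split=> //; last by exists t; rewrite Et expnS expn1.
  (* For even l the divisor a = 2 would be prime to the odd N, contrary to [h]. *)
  apply: contraT => nl; have oN : odd N by move: ol; rewrite (negbTE nl).
  have /h : (2 %| l)%N by rewrite dvdn2.
  by rewrite coprimen2 oN => /(_ isT).
have S1 := m_f_dvd N r l l0 S2 l1.
have cop a := prime_sqr_dvd_coprime N l a l0 sqf.
have H : hecke_hyps N l r (eta_quot N r).
  have trl : transf_law N r (eta_quot N r) by case: adm => -[_ [trl _]] _; exact: trl.
  have fT t m := eta_quot_shift N r t m N0 S2.
  have f0 t := eta_quot_neq0 N r t N0 S2.
  exact: And5 (And3 trl fT f0) (And3 N0 l0 S2) S1 ol half.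
have [lam Hlam] := hecke_eigen N l r adm S2 H cop.
have [El Ec] := hecke_coef N l r lam N0 l0 S2 cop Hlam.
split; last by move=> /half [].
have ln0 : (l%:R : C) != 0 by rewrite pnatr_eq0 -lt0n.
apply: (mulfI ln0); rewrite hweight1 // mulr1 in Ec; rewrite Ec mulrCA; congr (_ * _).
rewrite El mulr_sumr big_seq_cond [RHS]big_seq_cond; apply: eq_bigr => a.
rewrite -dvdn_divisors // => /andP[al _].
have an0 : (a%:R : C) != 0 by rewrite pnatr_eq0 -lt0n (dvdn_gt0 l0 al).
have -> : l%:R = (l %/ a)%:R * a%:R :> C by rewrite -natrM divnK.
by field.
Qed.

Lemma hweight_div (N : nat) (r : nat -> int) (l a : nat) : (0 < a)%N ->
  ~~ odd `|twok N r| ->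
  hweight N r l a / a%:R = (hsign N r l a)%:~R * (Rpower.Rpower a%:R (weight N r - 1))%:C.
Proof.
move=> a0 ek; rewrite /hweight -mulrA; congr (_ * _).
have [k Ek] : exists k : int, twok N r = 2 * k by exists ((twok N r) %/ 2)%Z; lia.
have an0 : (a%:R : R) != 0 by rewrite pnatr_eq0 -lt0n.
have -> : weight N r - 1 = (k - 1)%:~R by rewrite /weight Ek intrM intrD rmorphN1; field.
rewrite Rpower_int ?ltr0n // Ek mulKz // expfzDr // rmorphM /= fmorphV /=.
by rewrite fmorphXz /= rmorph_nat.
Qed.

Theorem theorem9p20 (N : nat) (r : nat -> int) (l : nat) :
  is_level N r ->
  weakly_admissible N r ->
  \sum_(n <- divisors N) n%:Z * r n = 0 ->
  in_L_f N r l ->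
  (forall p : nat, prime p -> ~~ (p %| N)%N -> ~~ (p ^ 2 %| l)%N) ->
  odd l || odd N ->
  let k : R := weight N r in
  let w : nat := varpi N r in
  let dl : R := (delta_of w)%:R in
  let cl : C := (eta_coef N r l)%:~R in
  ((2 %| l)%N && ~~ (2 %| N)%N ->
     cl = - (r 1%N)%:~R *
       \sum_(a <- divisors l | coprime a N)
          (kronecker a w)%:~R * (Rpower.Rpower a%:R (k - 1))%:C) /\
  (odd l ->
     cl = - (r 1%N)%:~R *
       \sum_(a <- divisors l | coprime a N)
          (kronecker a w)%:~R * (Rpower.Rpower a%:R (k - 1))%:C *
          e ((k + dl) * ((l - l %/ a)%N)%:R / 4%:R)) /\
  ((radical l %| radical N)%N -> eta_coef N r l = - r 1%N).
Proof.
move=> lev adm S2 inL sqf ol k w dl cl.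
have N0 : (0 < N)%N by case: lev.
have l0 : (0 < l)%N by case: inL.
have [Ec half] := eta_coef_formula N r l lev adm S2 inL sqf ol.
have one (F : nat -> C) : (forall a, (a %| l)%N -> coprime N a -> a = 1%N) ->
    \sum_(a <- divisors l | coprime a N) F a = F 1%N.
  move=> h; rewrite big_mkcond (bigD1_seq 1%N) ?divisors_uniq -?dvdn_divisors ?dvd1n //=.
  rewrite coprime1n big_seq_cond big1 ?addr0 // => a /andP[+ a1].
  rewrite -dvdn_divisors // => al; case: ifP => // ca; case/eqP: a1; apply: h => //.
  by rewrite coprime_sym.
have R1 : Rpower.Rpower 1 (k - 1) = 1.
  by rewrite /Rpower.Rpower Rpower.ln_1 RmultE mulr0 expR0.
have e0 : e 0 = 1 by rewrite -[0]/(0%:~R) e_int.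
split; [|split].
- rewrite dvdn2 -dvdn2 => /andP[l2 N2]; have oN : odd N by rewrite -[odd N]negbK -dvdn2.
  have el : odd l = false by apply/negbTE; rewrite -dvdn2.
  (* An even l excludes half-integral weight, so [hweight_div] applies. *)
  have ek : ~~ odd `|twok N r| by apply/negP => /half; rewrite el => -[].
  rewrite /cl Ec; congr (_ * _); rewrite big_seq_cond [RHS]big_seq_cond; apply: eq_bigr => a.
  rewrite -dvdn_divisors // => /andP[al ca]; rewrite hweight_div ?(dvdn_gt0 l0 al) //.
  congr (_%:~R * _); rewrite /hsign el kronecker_jac ?odd_varpi // coprime_sym.
  by apply: varpi_coprime; rewrite coprime_sym.
- move=> oddl; rewrite /cl Ec; congr (_ * _).
  (* In half-integral weight both sums reduce to a = 1, where the symbol, the power and the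
     exponential are all 1. *)
  case ek : (odd `|twok N r|).
    have [_ h] := half ek; rewrite !one // hweight1 // divr1 kronecker1 R1 divn1 subnn.
    by rewrite mulr0 mul0r e0 !mulr1.
  rewrite big_seq_cond [RHS]big_seq_cond; apply: eq_bigr => a.
  rewrite -dvdn_divisors // => /andP[al ca]; rewrite hweight_div ?(dvdn_gt0 l0 al) ?ek //.
  by rewrite (hsign_odd N r l a) ?ek // mulrAC.
move=> rad; have h a := radical_coprime_dvd N l a N0 l0 rad.
apply: (@intr_inj C); rewrite Ec one // hweight1 // divr1 mulr1 rmorphN //.
Qed.
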